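(* Let $A$ be a UHF $C^*$-algebra such that $A\otimes A\cong A$ and $\gamma$ a universal UHF flow on $A$. If $\alpha$ is an approximately inner, quasi-UHF flow on $A$, then the flow $\alpha\otimes\gamma$ on $A\otimes A$ is a cocycle perturbation of a (universal) UHF flow on $A\otimes A$.
   Context: A flow on a unital $C^*$-algebra is a strongly continuous one-parameter group of *-automorphisms. For flows $\alpha$ on $A$ and $\beta$ on $B$, $\alpha\otimes\beta$ is the flow $t\mapsto\alpha_t\otimes\beta_t$ on $A\otimes B$. For a unitary $u$, $\mathrm{Ad}\,u(x)=uxu^*$. A flow $\alpha$ on $A$ is approximately inner if there is a sequence $(h_n)$ of self-adjoint elements of $A$ with $\alpha_t(x)=\lim_n\mathrm{Ad}\,e^{ih_nt}(x)$ for every $t\in\mathbb R$ and $x\in A$. A flow $\alpha$ on a UHF algebra $A$ is a UHF flow if there is an increasing sequence $(A_n)$ of full matrix $C^*$-subalgebras of $A$ with $1_A\in A_1$, $A=\overline{\bigcup_nA_n}$ and $\alpha_t(A_n)=A_n$ for all $n$ and $t$. Given a flow $\alpha$ on $A$, an $\alpha$-cocycle is a norm-continuous family $u=(u_t)_{t\in\mathbb R}$ of unitaries of $A$ with $u_s\alpha_s(u_t)=u_{s+t}$ for all $s,t$; the flow $t\mapsto \mathrm{Ad}\,u_t\circ\alpha_t$ is then called a cocycle perturbation of $\alpha$. A flow $\alpha$ on $A$ is cocycle conjugate to a flow $\beta$ on $B$ if there is an isomorphism $\varphi:A\to B$ such that $\alpha$ is a cocycle perturbation of $t\mapsto\varphi^{-1}\beta_t\varphi$.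 For a UHF algebra $A$ with $A\otimes A\cong A$, a UHF flow $\gamma$ on $A$ is universal if $\gamma\otimes\beta$ is cocycle conjugate to $\gamma$ for every UHF flow $\beta$ on $A$. The parenthetical ''(universal)'' means that the UHF flow in the conclusion can moreover be taken universal. For $C^*$-subalgebras $B_1,B_2$ of $A$ and $\epsilon>0$, write $B_1\stackrel{\epsilon}{\subset}B_2$ if for any $x_1\in B_1$ there is $x_2\in B_2$ with $\|x_1-x_2\|\le\epsilon\|x_1\|$; $\mathrm{dist}(B_1,B_2)$ is the infimum of $\epsilon>0$ such that $B_1\stackrel{\epsilon}{\subset}B_2$ and $B_2\stackrel{\epsilon}{\subset}B_1$. A flow $\alpha$ on a UHF algebra $A$ is quasi-UHF if there is a sequence $(A_n)$ of finite type I subfactors of $A$ (i.e. $C^*$-subalgebras isomorphic to full matrix algebras) such that $A=\overline{\bigcup_nA_n}$ and $\sup_{|t|\le1}\mathrm{dist}(A_n,\alpha_t(A_n))\to0$ as $n\to\infty$. *)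

(* Defs.v *)
From HB Require Import structures.
From mathcomp Require Import all_boot all_order all_algebra.
From mathcomp Require Import all_classical all_reals all_analysis.
From mathcomp Require Import complex.

Set Implicit Arguments.
Unset Strict Implicit.
Unset Printing Implicit Defensive.

Import Order.TTheory GRing.Theory Num.Theory.
Import numFieldNormedType.Exports.

Local Open Scope classical_set_scope.
Local Open Scope ring_scope.
Local Open Scope complex_scope.
Local Open Scope sesquilinear_scope.

(** Unital C*-algebras over R[i]; the norm [`|x|] takes its (nonnegative real)
    values in R[i].  This is a record over the Banach space, and not a structure
    of the hierarchy, because a join of normed modules and rings would be
    ambiguous with the one already provided by [numDomainType].  The ring
    operations of the carrier are registered below. *)
Record cstarType (R : realType) := CStar {
  cstar_space : completeNormedModType R[i] ;
  cstar_one : cstar_space ;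
  cstar_mul : cstar_space -> cstar_space -> cstar_space ;
  cstar_star : cstar_space -> cstar_space ;
  cstar_mulA : associative cstar_mul ;
  cstar_mul1l : left_id cstar_one cstar_mul ;
  cstar_mul1r : right_id cstar_one cstar_mul ;
  cstar_mulDl : left_distributive cstar_mul +%R ;
  cstar_mulDr : right_distributive cstar_mul +%R ;
  cstar_one_neq0 : cstar_one != 0 ;
  cstar_scaleAl : forall (c : R[i]) x y,
    c *: cstar_mul x y = cstar_mul (c *: x) y ;
  cstar_scaleAr : forall (c : R[i]) x y,
    c *: cstar_mul x y = cstar_mul x (c *: y) ;
  cstar_starK : involutive cstar_star ;
  cstar_starD : {morph cstar_star : x y / x + y} ;
  cstar_starZ : forall (c : R[i]) x,
    cstar_star (c *: x) = Num.conj c *: cstar_star x ;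
  cstar_starM : forall x y,
    cstar_star (cstar_mul x y) = cstar_mul (cstar_star y) (cstar_star x) ;
  cstar_normM : forall x y, `|cstar_mul x y| <= `|x| * `|y| ;
  cstar_norm : forall x, `|cstar_mul (cstar_star x) x| = `|x| ^+ 2
}.

Definition cstar_sort (R : realType) (A : cstarType R) : Type := cstar_space A.
Coercion cstar_sort : cstarType >-> Sortclass.

HB.instance Definition _ (R : realType) (A : cstarType R) :=
  CompleteNormedModule.copy (cstar_sort A) (cstar_space A).
HB.instance Definition _ (R : realType) (A : cstarType R) :=
  GRing.Zmodule_isNzRing.Build (cstar_sort A)
    (@cstar_mulA R A) (@cstar_mul1l R A) (@cstar_mul1r R A)
    (@cstar_mulDl R A) (@cstar_mulDr R A) (@cstar_one_neq0 R A).
HB.instance Definition _ (R : realType) (A : cstarType R) :=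
  GRing.Lmodule_isLalgebra.Build R[i] (cstar_sort A) (@cstar_scaleAl R A).
HB.instance Definition _ (R : realType) (A : cstarType R) :=
  GRing.Lalgebra_isAlgebra.Build R[i] (cstar_sort A) (@cstar_scaleAr R A).

Definition star (R : realType) (A : cstarType R) (x : A) : A := cstar_star x.

Definition star_hom (R : realType) (A B : cstarType R) (f : A -> B) : Prop :=
  [/\ linear f, f 1 = 1, {morph f : x y / x * y} & {morph f : x / star x}].

Definition star_isomorphic (R : realType) (A B : cstarType R) : Prop :=
  exists f : A -> B, star_hom f /\ bijective f.

(** The last field says that the C*-norm is the largest one.  UHF algebras are
    nuclear, so for them this is the unique C*-tensor product. *)
Record tensor_product (R : realType) (A B : cstarType R) := TensorProduct {
  tensor_alg :> cstarType R ;
  tinl : A -> tensor_alg ;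
  tinr : B -> tensor_alg ;
  tinl_hom : star_hom tinl ;
  tinr_hom : star_hom tinr ;
  tin_comm : forall a b, tinl a * tinr b = tinr b * tinl a ;
  (* the canonical map from the algebraic tensor product is injective *)
  tin_inj : forall n (a : 'I_n -> A) (b : 'I_n -> B),
    (forall c : 'I_n -> R[i], \sum_i c i *: b i = 0 -> forall i, c i = 0) ->
    \sum_i tinl (a i) * tinr (b i) = 0 -> forall i, a i = 0 ;
  tin_dense : closure [set x | exists n (a : 'I_n -> A) (b : 'I_n -> B),
    x = \sum_i tinl (a i) * tinr (b i)] = [set: tensor_alg] ;
  tin_univ : forall (D : cstarType R) (f : A -> D) (g : B -> D),
    star_hom f -> star_hom g -> (forall a b, f a * g b = g b * f a) ->
    exists2 h : tensor_alg -> D, star_hom h &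
      forall a b, h (tinl a * tinr b) = f a * g b
}.

Record flow (R : realType) (A : cstarType R) := Flow {
  flow_fun :> R -> A -> A ;
  flow_hom : forall t, star_hom (flow_fun t) ;
  flow_bij : forall t, bijective (flow_fun t) ;
  flow0 : forall x, flow_fun 0 x = x ;
  flowD : forall s t x, flow_fun (s + t) x = flow_fun s (flow_fun t x) ;
  flow_continuous : forall x, continuous (fun t : R => flow_fun t x)
}.

Lemma tensor_map_ex (R : realType) (A B : cstarType R)
    (T : tensor_product A B) (f : A -> A) (g : B -> B) :
  star_hom f -> star_hom g ->
  exists h : T -> T, star_hom h /\
    forall a b, h (tinl T a * tinr T b) = tinl T (f a) * tinr T (g b).
Proof.
move=> [fl f1 fM fs] [gl g1 gM gs].
have [il i1 iM ist] := tinl_hom T; have [jl j1 jM jst] := tinr_hom T.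
have Hf : star_hom (tinl T \o f).
  split=> [c x y | | x y | x] /=; first by rewrite fl il.
  - by rewrite f1 i1.
  - by rewrite fM iM.
  - by rewrite fs ist.
have Hg : star_hom (tinr T \o g).
  split=> [c x y | | x y | x] /=; first by rewrite gl jl.
  - by rewrite g1 j1.
  - by rewrite gM jM.
  - by rewrite gs jst.
have [h Hh hE] := tin_univ T Hf Hg (fun a b => tin_comm T (f a) (g b)).
by exists h.
Qed.

Definition tensor_flow (R : realType) (A B : cstarType R)
    (T : tensor_product A B) (alpha : flow A) (beta : flow B) : R -> T -> T :=
  fun t => sval (cid (tensor_map_ex T (flow_hom alpha t) (flow_hom beta t))).

Arguments tensor_flow {R A B} T alpha beta t x.

Lemma tensor_flow_hom (R : realType) (A B : cstarType R)
    (T : tensor_product A B) (alpha : flow A) (beta : flow B) t :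
  star_hom (tensor_flow T alpha beta t).
Proof. by rewrite /tensor_flow; case: cid => h []. Qed.

Lemma tensor_flowE (R : realType) (A B : cstarType R)
    (T : tensor_product A B) (alpha : flow A) (beta : flow B) t a b :
  tensor_flow T alpha beta t (tinl T a * tinr T b) =
  tinl T (alpha t a) * tinr T (beta t b).
Proof. by rewrite /tensor_flow; case: cid => h []. Qed.

Definition unitary (R : realType) (A : cstarType R) (u : A) : Prop :=
  star u * u = 1 /\ u * star u = 1.

Definition Ad (R : realType) (A : cstarType R) (u x : A) : A :=
  u * x * star u.

Definition cstar_exp (R : realType) (A : cstarType R) (x : A) : A :=
  limn (series (fun k : nat => (k`!%:R^-1 : R[i]) *: x ^+ k)).

Definition approximately_inner (R : realType) (A : cstarType R)
    (alpha : flow A) : Prop :=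
  exists h : nat -> A, (forall n, star (h n) = h n) /\
    forall (t : R) (x : A),
      (fun n => Ad (cstar_exp (('i * t%:C) *: h n)) x) @ \oo --> alpha t x.

(** The unit of the subalgebra is not required to be that of A. *)
Definition full_matrix_subalgebra (R : realType) (A : cstarType R)
    (B : set A) : Prop :=
  exists k (f : 'M[R[i]]_k.+1 -> A),
    [/\ linear f, {morph f : M N / M *m N >-> M * N},
        (forall M, f (M ^t*) = star (f M)), injective f & range f = B].

Definition UHF_algebra (R : realType) (A : cstarType R) : Prop :=
  exists An : nat -> set A,
    [/\ forall n, full_matrix_subalgebra (An n),
        forall n, An n `<=` An n.+1,
        An 0%N 1 & closure (\bigcup_n An n) = [set: A]].

Definition UHF_flow (R : realType) (A : cstarType R) (alpha : flow A) : Prop :=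
  exists An : nat -> set A,
    [/\ forall n, full_matrix_subalgebra (An n),
        forall n, An n `<=` An n.+1,
        An 0%N 1, closure (\bigcup_n An n) = [set: A]
      & forall n (t : R), alpha t @` An n = An n].

Definition cocycle (R : realType) (A : cstarType R) (alpha : R -> A -> A)
    (u : R -> A) : Prop :=
  [/\ continuous u, forall t, unitary (u t)
    & forall s t, u s * alpha s (u t) = u (s + t)].

(** [beta] is a cocycle perturbation of [alpha]. *)
Definition cocycle_perturbation (R : realType) (A : cstarType R)
    (beta alpha : R -> A -> A) : Prop :=
  exists2 u : R -> A, cocycle alpha u &
    forall t x, beta t x = Ad (u t) (alpha t x).

Definition cocycle_conjugate (R : realType) (A B : cstarType R)
    (alpha : R -> A -> A) (beta : R -> B -> B) : Prop :=
  exists (phi : A -> B) (psi : B -> A),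
    [/\ star_hom phi, cancel phi psi, cancel psi phi
      & cocycle_perturbation alpha (fun t x => psi (beta t (phi x)))].

(** The tensor product is unique up to isomorphism, so the last conjunct
    quantifies over all its models; the second one is the standing assumption
    that A is isomorphic to its tensor square, and in particular provides a
    model. *)
Definition universal_UHF_flow (R : realType) (A : cstarType R)
    (gamma : flow A) : Prop :=
  [/\ UHF_flow gamma,
      exists T : tensor_product A A, star_isomorphic T A
    & forall (T : tensor_product A A) (beta : flow A), UHF_flow beta ->
        cocycle_conjugate (tensor_flow T gamma beta) gamma].

Definition eps_subset (R : realType) (A : cstarType R) (e : R)
    (B1 B2 : set A) : Prop :=
  forall x1, B1 x1 -> exists2 x2, B2 x2 & `|x1 - x2| <= e%:C * `|x1|.

Definition subalg_dist (R : realType) (A : cstarType R) (B1 B2 : set A) : R :=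
  inf [set e : R | [/\ 0 < e, eps_subset e B1 B2 & eps_subset e B2 B1]].

Definition quasi_UHF (R : realType) (A : cstarType R) (alpha : flow A) : Prop :=
  exists An : nat -> set A,
    [/\ forall n, full_matrix_subalgebra (An n),
        closure (\bigcup_n An n) = [set: A]
      & (fun n => sup [set subalg_dist (An n) (alpha t @` An n)
                      | t in [set t : R | `|t| <= 1]]) @ \oo --> (0 : R)].

(* Main.v *)
Require Import Defs.
From HB Require Import structures.
From mathcomp Require Import all_boot all_order all_algebra.
From mathcomp Require Import all_classical all_reals all_analysis.
From mathcomp Require Import complex ring lra.
Set Implicit Arguments.
Unset Strict Implicit.
Unset Printing Implicit Defensive.
Import Order.TTheory GRing.Theory Num.Theory.
Import numFieldNormedType.Exports.
Local Open Scope classical_set_scope.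
Local Open Scope ring_scope.
Local Open Scope complex_scope.
Local Open Scope sesquilinear_scope.

(** Szabo-style absorption.  Approximate alpha by inner flows Ad e^{ith_n} with h_n
    in matrix subalgebras of A.  Since A is a UHF algebra isomorphic to its tensor
    square, there is a UHF flow beta on A carrying an asymptotically central sequence
    of copies (A, Ad e^{ith_n}); so copies of (A, alpha) sit asymptotically centrally
    in gamma (x) beta, which is gamma up to cocycle conjugacy by universality.  Let
    delta be the resulting cocycle perturbation of gamma.  If C is a matrix subalgebra
    of A almost invariant under alpha, the flip unitary of C (x) C, with its second
    leg pushed into such a copy, is almost invariant under alpha (x) delta, almost
    commutes with 1 (x) A and moves C (x) 1 into 1 (x) A.  A one-sided intertwining
    along such unitaries makes alpha (x) delta cocycle conjugate to delta, hence
    alpha (x) gamma cocycle conjugate to gamma. *)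

(** * The real-valued norm and elementary convergence *)

(** The obstacle is the size of C. Its flip is a sum with one term for each pair of indices, whereas
    the quasi-UHF condition bounds only the distance from C to alpha_t(C); a termwise estimate of
    the motion of the flip would lose a factor growing with C. The bound [8 * d] is free of that
    factor. The product y of the flip F and the moved flip F_t almost commutes with both legs;
    averaging over both legs makes it almost commute with F, so that y^2 is near 1, and continuity
    from y = 1 at t = 0 keeps y itself near 1. Only then, with C fixed, is the copy receiving the
    second leg chosen, so the errors made there may depend on the number of matrix units of C. One
    side of the intertwining is enough because the limit embedding is isometric: its range is
    closed, and it contains approximations of ever larger finite sets. The UHF flow obtained is
    gamma transported by the resulting isomorphism of A with its tensor square, which is why it is
    universal too. *)

Section Norm.
Variable R : realType.

(** Moduli and norms are valued in [R[i]]. Their real parts bring the estimates to the ordered field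
    R, where [lra] and [nra] apply. *)
Definition cm (c : R[i]) : R := complex.Re `|c|.

Lemma cmE (c : R[i]) : `|c| = (cm c)%:C.
Proof. by rewrite /cm RRe_real// normr_real. Qed.

Lemma cm_ge0 c : 0 <= cm c.
Proof. by rewrite -lecR -cmE normr_ge0. Qed.

Lemma cmM c d : cm (c * d) = cm c * cm d.
Proof. by apply: complexI; rewrite rmorphM/= -!cmE normrM. Qed.

Lemma cmR (r : R) : cm r%:C = `|r|.
Proof. by rewrite /cm normc_def/= expr0n/= addr0 sqrtr_sqr. Qed.

Lemma cmR_ge0 (r : R) : 0 <= r -> cm r%:C = r.
Proof. by move=> ?; rewrite cmR ger0_norm. Qed.

Lemma cmN c : cm (- c) = cm c.
Proof. by rewrite /cm normrN. Qed.

Lemma conjR (r : R) : Num.conj (r%:C) = r%:C :> R[i].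
Proof. by apply: conj_Creal; rewrite complex_real. Qed.

Variable A : cstarType R.
Implicit Types x y z u v l : A.

Definition nm x : R := complex.Re `|x|.

Lemma nmE x : `|x| = (nm x)%:C.
Proof. by rewrite /nm RRe_real// normr_real. Qed.

Lemma nm_ge0 x : 0 <= nm x.
Proof. by rewrite -lecR -nmE normr_ge0. Qed.

Lemma nm0 : nm 0 = 0.
Proof. by rewrite /nm normr0. Qed.

Lemma nm_eq0 x : nm x = 0 -> x = 0.
Proof. by move=> h; apply/normr0_eq0; rewrite nmE h. Qed.

Lemma nmN x : nm (- x) = nm x.
Proof. by rewrite /nm normrN. Qed.

Lemma nmBC x y : nm (x - y) = nm (y - x).
Proof. by rewrite -nmN opprB. Qed.

Lemma nmD x y : nm (x + y) <= nm x + nm y.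
Proof. by rewrite -lecR rmorphD/= -!nmE ler_normD. Qed.

Lemma nmB x y : nm (x - y) <= nm x + nm y.
Proof. by rewrite -(nmN y) nmD. Qed.

Lemma nm_tri z x y : nm (x - y) <= nm (x - z) + nm (z - y).
Proof. by rewrite (_ : x - y = (x - z) + (z - y)) ?nmD// addrA subrK. Qed.

Lemma nm_le_add x y : nm x <= nm (x - y) + nm y.
Proof. by rewrite -{1}(subrK y x) nmD. Qed.

Lemma nmZ c x : nm (c *: x) = cm c * nm x.
Proof. by apply: complexI; rewrite rmorphM/= -nmE -cmE -nmE normrZ. Qed.

Lemma nmZR (r : R) x : 0 <= r -> nm (r%:C *: x) = r * nm x.
Proof. by move=> ?; rewrite nmZ cmR_ge0. Qed.

Lemma nmM x y : nm (x * y) <= nm x * nm y.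
Proof. by rewrite -lecR rmorphM/= -!nmE; exact: cstar_normM. Qed.

Lemma nm_starM x : nm (star x * x) = nm x ^+ 2.
Proof. by apply: complexI; rewrite rmorphXn/= -!nmE; exact: cstar_norm. Qed.

Lemma starK x : star (star x) = x.
Proof. exact: cstar_starK. Qed.

Lemma starD x y : star (x + y) = star x + star y.
Proof. exact: cstar_starD. Qed.

Lemma starZ c x : star (c *: x) = Num.conj c *: star x.
Proof. exact: cstar_starZ. Qed.

Lemma starZR (r : R) x : star (r%:C *: x) = r%:C *: star x.
Proof. by rewrite starZ conjR. Qed.

Lemma starM x y : star (x * y) = star y * star x.
Proof. exact: cstar_starM. Qed.

Lemma star0 : star (0 : A) = 0.
Proof. by have := starZ 0 (0 : A); rewrite conjC0 !scale0r. Qed.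

Lemma starN x : star (- x) = - star x.
Proof. by rewrite -scaleN1r starZ rmorphN1 scaleN1r. Qed.

Lemma starB x y : star (x - y) = star x - star y.
Proof. by rewrite starD starN. Qed.

Lemma star1 : star (1 : A) = 1.
Proof. by rewrite -[LHS]mulr1 -[X in _ * X]starK -starM mulr1 starK. Qed.

Lemma starX x n : star (x ^+ n) = star x ^+ n.
Proof. by elim: n => [|n IH]; rewrite ?star1// exprS exprSr starM IH. Qed.

Lemma star_sum I (r : seq I) (P : pred I) (F : I -> A) :
  star (\sum_(i <- r | P i) F i) = \sum_(i <- r | P i) star (F i).
Proof. by apply: (big_morph (@star R A) starD star0). Qed.

Lemma nm_star_le x : nm x <= nm (star x).
Proof.
have [/nm_eq0->|x0] := eqVneq (nm x) 0; first by rewrite star0 lexx.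
have xp : 0 < nm x by rewrite lt_neqAle eq_sym x0 nm_ge0.
by rewrite -(ler_pM2r xp) -expr2 -nm_starM nmM.
Qed.

Lemma nm_star x : nm (star x) = nm x.
Proof. by apply/eqP; rewrite eq_le nm_star_le andbT -{2}(starK x) nm_star_le. Qed.

Lemma nm1 : nm (1 : A) = 1.
Proof.
have := nm_starM (1 : A); rewrite star1 mul1r expr2 => h.
have : nm (1 : A) != 0 by apply: contra_neq (oner_neq0 A) => /nm_eq0.
by move=> n0; apply: (mulIf n0); rewrite -h mul1r.
Qed.

Lemma nmX x n : nm (x ^+ n) <= nm x ^+ n.
Proof.
elim: n => [|n IH]; first by rewrite !expr0 nm1.
by rewrite !exprS (le_trans (nmM _ _))// ler_wpM2l// nm_ge0.
Qed.

Lemma nm_sum I (r : seq I) (P : pred I) (F : I -> A) :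
  nm (\sum_(i <- r | P i) F i) <= \sum_(i <- r | P i) nm (F i).
Proof.
elim/big_rec2: _ => [|i a b _ h]; first by rewrite nm0.
by rewrite (le_trans (nmD _ _))// lerD2l.
Qed.

Lemma nmM3 x y z : nm (x * y * z) <= nm x * nm y * nm z.
Proof. by rewrite (le_trans (nmM _ _))// ler_wpM2r ?nm_ge0 ?nmM. Qed.

(* The C*-identity pins the norm of a self-adjoint element to its powers. *)
Lemma nm_sa_exp2 x n : star x = x -> nm (x ^+ (2 ^ n)) = nm x ^+ (2 ^ n).
Proof.
move=> xx; elim: n => [|n IH]; first by rewrite !expr1.
by rewrite expnS mulnC !exprM -IH -nm_starM starX xx expr2.
Qed.

Lemma unitary_nm u : unitary u -> nm u = 1.
Proof.
case=> h _; have := nm_starM u; rewrite h nm1 => /esym/eqP.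
rewrite sqrf_eq1 => /orP[/eqP//|/eqP h1].
by have := nm_ge0 u; rewrite h1; lra.
Qed.

Lemma nm_proj_le1 x : star x = x -> x * x = x -> nm x <= 1.
Proof.
move=> sx xx; have := nm_starM x; rewrite sx xx expr2 => h.
have [x0|x0] := eqVneq (nm x) 0; first by rewrite x0 ler01.
by rewrite -[X in _ <= X](mulfK x0) mul1r {2}h mulfK.
Qed.

Lemma nm_proj1 x : star x = x -> x * x = x -> x != 0 -> nm x = 1.
Proof.
move=> sx xx x0; have := nm_starM x; rewrite sx xx expr2 => h.
have n0 : nm x != 0 by apply: contra_neq x0 => /nm_eq0.
by apply: (mulIf n0); rewrite mul1r -h.
Qed.

Lemma unitary1 : unitary (1 : A).
Proof. by split; rewrite star1 mulr1. Qed.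

Lemma unitaryM u v : unitary u -> unitary v -> unitary (u * v).
Proof.
move=> [u1 u2] [v1 v2]; split; rewrite starM.
  by rewrite mulrA -(mulrA (star v)) u1 mulr1.
by rewrite mulrA -(mulrA u) v2 mulr1.
Qed.

Lemma unitary_star u : unitary u -> unitary (star u).
Proof. by case=> u1 u2; split; rewrite starK. Qed.

Lemma nm_ul u x : unitary u -> nm (u * x) = nm x.
Proof.
move=> uu; apply/eqP; rewrite eq_le; apply/andP; split.
  by rewrite (le_trans (nmM _ _))// unitary_nm// mul1r.
case: (uu) => h _; rewrite -{1}(mul1r x) -h -mulrA.
by rewrite (le_trans (nmM _ _))// (unitary_nm (unitary_star uu)) mul1r.
Qed.

Lemma nm_ur u x : unitary u -> nm (x * u) = nm x.
Proof. by move=> uu; rewrite -nm_star starM nm_ul ?nm_star//; apply: unitary_star. Qed.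

Lemma nm_Ad u x : unitary u -> nm (Ad u x) = nm x.
Proof. by move=> uu; rewrite /Ad nm_ur ?nm_ul//; apply: unitary_star. Qed.

Lemma AdD u x y : Ad u (x + y) = Ad u x + Ad u y.
Proof. by rewrite /Ad mulrDr mulrDl. Qed.

Lemma AdB u x y : Ad u (x - y) = Ad u x - Ad u y.
Proof. by rewrite /Ad mulrBr mulrBl. Qed.

Lemma AdZ u c x : Ad u (c *: x) = c *: Ad u x.
Proof. by rewrite /Ad -scalerAr -scalerAl. Qed.

Lemma AdM u x y : unitary u -> Ad u (x * y) = Ad u x * Ad u y.
Proof. by case=> h _; rewrite /Ad !mulrA -(mulrA _ (star u) u) h mulr1. Qed.

Lemma Ad_star u x : Ad u (star x) = star (Ad u x).
Proof. by rewrite /Ad !starM starK mulrA. Qed.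

Lemma Ad1 u : unitary u -> Ad u 1 = 1.
Proof. by case=> _ h; rewrite /Ad mulr1. Qed.

Lemma Ad_Ad u v x : Ad u (Ad v x) = Ad (u * v) x.
Proof. by rewrite /Ad starM !mulrA. Qed.

Lemma Ad_one x : Ad 1 x = x.
Proof. by rewrite /Ad star1 mul1r mulr1. Qed.

Lemma AdK u x : unitary u -> Ad (star u) (Ad u x) = x.
Proof. by case=> h _; rewrite Ad_Ad h Ad_one. Qed.

Lemma AdKV u x : unitary u -> Ad u (Ad (star u) x) = x.
Proof. by case=> _ h; rewrite Ad_Ad h Ad_one. Qed.

Lemma Ad_hom u : unitary u -> star_hom (Ad u : A -> A).
Proof.
move=> uu; split=> [c x y|||x]; first by rewrite AdD AdZ.
- exact: Ad1.
- by move=> x y; apply: AdM.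
- exact: Ad_star.
Qed.

Lemma Ad_comm u x : unitary u -> u * x = x * u -> Ad u x = x.
Proof. by case=> _ h e; rewrite /Ad e -mulrA h mulr1. Qed.

Lemma nm_AdB u v x : nm u <= 1 -> nm v <= 1 ->
  nm (Ad u x - Ad v x) <= 2 * nm (u - v) * nm x.
Proof.
move=> hu hv.
have -> : Ad u x - Ad v x = (u - v) * x * star u + v * x * star (u - v).
  by rewrite /Ad starB !mulrBl mulrBr addrA subrK.
apply: (le_trans (nmD _ _)).
have := nmM3 (u - v) x (star u); have := nmM3 v x (star (u - v)).
rewrite !nm_star => h1 h2.
have a0 := nm_ge0 (u - v); have b0 := nm_ge0 x.
have c0 : 0 <= nm (u - v) * nm x by rewrite mulr_ge0.
have h3 : nm (u - v) * nm x * nm u <= nm (u - v) * nm x * 1 by rewrite ler_wpM2l.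
have h4 : nm (u - v) * nm x * nm v <= nm (u - v) * nm x * 1 by rewrite ler_wpM2l.
by lra.
Qed.

Lemma nm_mulB x y x' y' :
  nm (x * y - x' * y') <= nm (x - x') * nm y + nm x' * nm (y - y').
Proof.
have -> : x * y - x' * y' = (x - x') * y + x' * (y - y').
  by rewrite mulrBl mulrBr addrA subrK.
by rewrite (le_trans (nmD _ _))// lerD ?nmM.
Qed.

Definition tends (u : nat -> A) (l : A) :=
  forall e : R, 0 < e -> exists N, forall n, (N <= n)%N -> nm (u n - l) < e.

Lemma eps_complex (e : R[i]) : 0 < e -> exists2 r : R, 0 < r & e = r%:C.
Proof.
move=> e0; exists (complex.Re e).
  by move: e0; rewrite ltcE => /andP[_].
by rewrite RRe_real// gtr0_real.
Qed.

Lemma cvg_tends (u : nat -> A) l : u @ \oo --> l <-> tends u l.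
Proof.
rewrite cvgrPdist_lt; split=> h.
  move=> e e0; have e0' : 0 < e%:C by rewrite ltcR.
  have [N _ HN] := h _ e0'.
  by exists N => n Nn; have := HN n Nn; rewrite /= nmE ltcR nmBC.
move=> _ /eps_complex[e e0 ->]; have [N HN] := h _ e0; exists N => // n Nn /=.
by rewrite nmE ltcR nmBC HN.
Qed.

Lemma tends_unique (u : nat -> A) l l' : tends u l -> tends u l' -> l = l'.
Proof.
by move=> /cvg_tends h /cvg_tends h'; apply: (cvg_unique _ h h').
Qed.

Definition is_cauchy (u : nat -> A) :=
  forall e : R, 0 < e -> exists N, forall n m, (N <= n)%N -> (N <= m)%N ->
    nm (u n - u m) < e.

Lemma cauchy_tends (u : nat -> A) : is_cauchy u -> exists l, tends u l.
Proof.
move=> h; suff : cvg (u @ \oo) by exists (lim (u @ \oo)); apply/cvg_tends.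
apply/cauchy_cvgP/cauchy_ballP => _ /eps_complex[e e0 ->].
have [N HN] := h _ e0.
exists ([set u n | n in [set n | (N <= n)%N]], [set u n | n in [set n | (N <= n)%N]]).
  by split; exists N => // n /= Nn; exists n.
case=> _ _ [/= [n Nn <-] [m Nm <-]].
by rewrite -ball_normE /= nmE ltcR HN.
Qed.

Lemma tends_cst l : tends (fun=> l) l.
Proof. by move=> e e0; exists 0%N => n _; rewrite subrr nm0. Qed.

Lemma tends_ext (u v : nat -> A) l : tends v l -> (forall n, u n = v n) -> tends u l.
Proof. by move=> h /funext->. Qed.

Lemma tendsD (u v : nat -> A) l m : tends u l -> tends v m -> tends (fun n => u n + v n) (l + m).
Proof. by move=> /cvg_tends h /cvg_tends k; apply/cvg_tends; apply: cvgD. Qed.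

Lemma tendsZ c (u : nat -> A) l : tends u l -> tends (fun n => c *: u n) (c *: l).
Proof. by move=> /cvg_tends h; apply/cvg_tends; apply: cvgZr. Qed.

Lemma tends_bound (u : nat -> A) l c : tends u l -> (forall n, nm (u n) <= c) -> nm l <= c.
Proof.
move=> h hc; rewrite leNgt; apply/negP => cl.
have [N HN] := h (nm l - c) (ltac:(lra)).
have := HN N (leqnn _); have := hc N; have := nm_le_add l (u N).
by rewrite (nmBC l); lra.
Qed.

Lemma tends_boundN (u : nat -> A) l c N :
  tends u l -> (forall n, (N <= n)%N -> nm (u n) <= c) -> nm l <= c.
Proof.
move=> h hc; apply: (@tends_bound (fun n => u (n + N)%N)).
  move=> e e0; have [M HM] := h e e0; exists M => n Mn.
  by apply: HM; rewrite (leq_trans Mn)// leq_addr.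
by move=> n; apply: hc; rewrite leq_addl.
Qed.

Lemma tendsM (u v : nat -> A) l m : tends u l -> tends v m -> tends (fun n => u n * v n) (l * m).
Proof.
move=> h k e e0.
have l0 := nm_ge0 l; have m0 := nm_ge0 m.
pose d := Num.min 1 (e / (nm l + nm m + 2)).
have c0 : 0 < nm l + nm m + 2 by lra.
have d0 : 0 < d by rewrite lt_min ltr01 divr_gt0.
have d1 : d <= 1 by rewrite ge_min lexx.
have d2 : d * (nm l + nm m + 2) <= e.
  by rewrite -ler_pdivlMr// ge_min lexx orbT.
have [N HN] := h d d0; have [M HM] := k d d0.
exists (maxn N M) => n; rewrite geq_max => /andP[Nn Mn].
have hu := HN n Nn; have hv := HM n Mn.
have h1 := nm_mulB (u n) (v n) l m.
have h2 : nm (v n) <= nm m + 1 by have := nm_le_add (v n) m; lra.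
have a0 := nm_ge0 (u n - l); have b0 := nm_ge0 (v n - m).
have h3 : nm (u n - l) * nm (v n) <= d * (nm m + 1).
  by apply: ler_pM => //; rewrite ?nm_ge0// ltW.
have h4 : nm l * nm (v n - m) <= nm l * d by rewrite ler_wpM2l// ltW.
suff : d * (nm m + 1) + nm l * d < e by lra.
apply: (@lt_le_trans _ _ (d * (nm l + nm m + 2))) => //.
by lra.
Qed.

Lemma tends_star (u : nat -> A) l : tends u l -> tends (fun n => star (u n)) (star l).
Proof. by move=> h e e0; have [N HN] := h e e0; exists N => n Nn; rewrite -starB nm_star HN. Qed.

Lemma tends_shift (u : nat -> A) l k : tends u l -> tends (fun n => u (n + k)%N) l.
Proof.
move=> h e e0; have [N HN] := h e e0; exists N => n Nn.
by apply: HN; rewrite (leq_trans Nn)// leq_addr.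
Qed.

Lemma half_lt (e c : R) : 0 < e -> exists N, forall n, (N <= n)%N -> c * 2^-1 ^+ n < e.
Proof.
move=> e0.
have [c0|c0] := leP c 0.
  exists 0%N => n _; apply: le_lt_trans e0.
  by rewrite mulr_le0_ge0// exprn_ge0// invr_ge0.
have [N HN] : exists N, c / e < N%:R.
  by exists (Num.trunc (c / e)).+1; rewrite truncnS_gt.
exists N => n Nn; rewrite exprVn ltr_pdivrMr ?exprn_gt0// mulrC -ltr_pdivrMr//.
apply: (lt_le_trans HN); rewrite -natrX ler_nat (leq_trans Nn)// ltnW//.
exact: ltn_expl.
Qed.

Lemma geom_dist (u : nat -> A) (c : R) :
  (forall n, nm (u n.+1 - u n) <= c * 2^-1 ^+ n) ->
  forall n m, (n <= m)%N -> nm (u m - u n) <= 2 * c * 2^-1 ^+ n.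
Proof.
move=> h n m nm_; rewrite -(subnK nm_); move: (m - n)%N => k {m nm_}.
(* The subtracted power makes the induction on k close; it is dropped afterwards. *)
suff H : nm (u (k + n)%N - u n) <= 2 * c * (2^-1 ^+ n - 2^-1 ^+ (k + n)).
  apply: (le_trans H); rewrite ler_wpM2l//; last first.
    by rewrite gerBl exprn_ge0// invr_ge0.
  have := le_trans (nm_ge0 _) (h 0%N); rewrite expr0; lra.
elim: k => [|k IH]; first by rewrite add0n !subrr nm0 mulr0.
have := nm_tri (u (k + n)%N) (u (k.+1 + n)%N) (u n).
have := h (k + n)%N; rewrite addSn exprS => h1 h2.
have -> : 2^-1 * 2^-1 ^+ (k + n) = 2^-1 ^+ (k + n) / 2 :> R by rewrite mulrC.
by move: h1 IH h2; move: (2^-1 ^+ (k + n)) (2^-1 ^+ n) => a b; lra.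
Qed.

(** Source of the limits built by iteration: square roots, inverses, the cocycle of the
    intertwining. The rate is kept because later estimates compare a limit with a given stage. *)
Lemma geom_tends (u : nat -> A) (c : R) :
  (forall n, nm (u n.+1 - u n) <= c * 2^-1 ^+ n) ->
  exists2 l, tends u l & forall n, nm (u n - l) <= 2 * c * 2^-1 ^+ n.
Proof.
move=> h; have H := geom_dist h.
have [l hl] : exists l, tends u l.
  apply: cauchy_tends => e e0.
  have [N HN] := half_lt (2 * c) (ltac:(lra) : 0 < e / 2).
  exists N => n m Nn Nm; have := nm_tri (u N) (u n) (u m).
  have := H _ _ Nn; have := H _ _ Nm; rewrite (nmBC (u N)).
  by have := HN N (leqnn _); lra.
exists l => // n; rewrite nmBC.
apply: (@tends_boundN (fun m => u m - u n) _ _ n); last by move=> m; apply: H.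
by apply: tendsD => //; apply: tends_cst.
Qed.

Lemma closure_epsP (S : set A) x :
  closure S x <-> forall e : R, 0 < e -> exists2 y, S y & nm (x - y) < e.
Proof.
split=> [h e e0|h B].
  have /h[y [Sy]] : nbhs x (ball x e%:C) by apply: nbhsx_ballx; rewrite ltcR.
  by rewrite -ball_normE /= nmE ltcR; exists y.
move=> /nbhs_ballP[_ /= /eps_complex[e e0 ->] H].
have [y Sy xy] := h e e0; exists y; split=> //; apply: H.
by rewrite -ball_normE /= nmE ltcR.
Qed.

Lemma continuousE (f : R -> A) : continuous f <->
  forall t (e : R), 0 < e -> exists2 d : R, 0 < d &
    forall s, `|s - t| < d -> nm (f s - f t) < e.
Proof.
split=> [h t e e0|h t].
  have /cvgrPdist_lt/(_ e%:C) := h t.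
  rewrite ltcR => /(_ e0) /nbhs_ballP[d /= d0 H]; exists d => // s sd.
  have := H s; rewrite /= nmE ltcR (nmBC (f t)); apply.
  by rewrite /ball /= distrC.
apply/cvgrPdist_lt => _ /eps_complex[e e0 ->].
have [d d0 H] := h t e e0; apply/nbhs_ballP; exists d => //= s.
move=> sd; rewrite nmE ltcR nmBC; apply: H.
by rewrite distrC.
Qed.

Definition csub (S : set A) := [/\ S 0, forall x y, S x -> S y -> S (x + y),
  forall c x, S x -> S (c *: x) &
  forall x, (forall e : R, 0 < e -> exists2 y, S y & nm (x - y) < e) -> S x].

Lemma csub_sum S I (r : seq I) (P : pred I) (F : I -> A) : csub S ->
  (forall i, P i -> S (F i)) -> S (\sum_(i <- r | P i) F i).
Proof. by case=> S0 SD _ _ h; apply: big_ind. Qed.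

Lemma csub_tends S (u : nat -> A) l : csub S -> (forall n, S (u n)) -> tends u l -> S l.
Proof.
case=> _ _ _ Sc h ul; apply: Sc => e e0; have [N HN] := ul e e0.
by exists (u N) => //; rewrite nmBC HN.
Qed.

Lemma csub_opp S x : csub S -> S x -> S (- x).
Proof. by case=> _ _ SZ _ Sx; rewrite -scaleN1r; apply: SZ. Qed.

(** Density of the span of G, encoded as an induction principle: a property that defines a closed
    subspace holds everywhere once it holds on G. *)
Definition spanning (G : set A) := forall S, csub S -> G `<=` S -> forall x, S x.

Lemma dense_spanning (G : set A) : closure G = [set: A] -> spanning G.
Proof.
move=> h S [_ _ _ Sc] GS x; apply: Sc => e e0.
have : closure G x by rewrite h.
by move=> /closure_epsP/(_ e e0)[y Gy xy]; exists y => //; apply: GS.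
Qed.

End Norm.

Arguments unitary1 {R A}.
Arguments starK {R A} x.

(** * Square roots and contractivity of *-homomorphisms *)

Section SquareRoot.
Variables (R : realType) (A : cstarType R).
Implicit Types x y z u v : A.

(** [y] lies in every closed (not necessarily unital) subalgebra containing [x]. *)
Definition gen_by x y := forall S : set A, csub S ->
  (forall a b, S a -> S b -> S (a * b)) -> S x -> S y.

Lemma gen_by_trans x y z : gen_by x y -> gen_by y z -> gen_by x z.
Proof. by move=> h k S cS mS Sx; apply: k => //; apply: h. Qed.

Lemma csub_commutant z : csub [set y : A | z * y = y * z].
Proof.
split=> /= [|x y h k|c x h|x h]; first by rewrite mulr0 mul0r.
- by rewrite mulrDr mulrDl h k.
- by rewrite -scalerAr -scalerAl h.
- apply/eqP; rewrite -subr_eq0; apply/eqP/nm_eq0/eqP; rewrite eq_le nm_ge0 andbT.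
  rewrite leNgt; apply/negP => e0; set e := nm _ in e0.
  have c0 : 0 < 2 * nm z + 1 by have := nm_ge0 z; lra.
  have [y Hy xy] := h (e / (2 * nm z + 1)) (divr_gt0 e0 c0).
  have : e <= 2 * nm z * nm (x - y).
    rewrite /e (_ : z * x - x * z = z * (x - y) - (x - y) * z); last first.
      by rewrite mulrBr mulrBl Hy opprB addrA subrK.
    have := nmB (z * (x - y)) ((x - y) * z).
    by have := nmM z (x - y); have := nmM (x - y) z; lra.
  have : e / (2 * nm z + 1) * (2 * nm z + 1) = e by rewrite divfK// gt_eqF.
  by have := nm_ge0 z; have := nm_ge0 (x - y); nra.
Qed.

Lemma gen_by_comm x y z : gen_by x y -> z * x = x * z -> z * y = y * z.
Proof.
move=> h; apply: (h [set y | z * y = y * z]); first exact: csub_commutant.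
by move=> a b /= Ha Hb; rewrite mulrA Ha -mulrA Hb mulrA.
Qed.

(** A fixed point of y -> (x + y^2)/2 satisfies (1 - y)^2 = 1 - x. On the ball of radius 1/2 this
    map at least halves the distance between successive iterates. The iterates from 0 are
    polynomials in x without constant term, whence [gen_by x y]. *)
Lemma sqrt_ex x : nm x <= 2^-1 -> exists y,
  [/\ nm y <= nm x, (1 - y) * (1 - y) = 1 - x,
      star x = x -> star y = y & gen_by x y].
Proof.
move=> hx; pose F y := (2^-1 : R)%:C *: (x + y * y).
pose u n := iter n F (0 : A).
have uS n : u n.+1 = F (u n) by [].
have x0 := nm_ge0 x; have h2 : (0 : R) <= 2^-1 by lra.
have ub n : nm (u n) <= nm x.
  elim: n => [|n IH]; first by rewrite nm0.
  rewrite uS /F nmZR//; have := nmD x (u n * u n); have := nmM (u n) (u n).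
  by have := nm_ge0 (u n); nra.
have ud n : nm (u n.+1 - u n) <= nm x * 2^-1 ^+ n.
  elim: n => [|n IH].
    by rewrite expr0 mulr1 uS /F /u /= mul0r addr0 subr0 nmZR//; lra.
  have -> : u n.+2 - u n.+1 =
      (2^-1 : R)%:C *: ((u n.+1 - u n) * u n.+1 + u n * (u n.+1 - u n)).
    rewrite uS [in X in _ - X]uS /F -scalerBr; congr (_ *: _).
    rewrite mulrBl mulrBr addrA subrK opprD addrACA subrr add0r//.
  rewrite nmZR//; have := nmD ((u n.+1 - u n) * u n.+1) (u n * (u n.+1 - u n)).
  have := nmM (u n.+1 - u n) (u n.+1); have := nmM (u n) (u n.+1 - u n).
  have := ub n; have := ub n.+1; have := nm_ge0 (u n); have := nm_ge0 (u n.+1).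
  have := nm_ge0 (u n.+1 - u n); rewrite exprS.
  move: IH; move: (2^-1 ^+ n) (nm (u n.+1 - u n)) (nm (u n)) (nm (u n.+1)) => a b c d.
  move=> IH b0 d0 c0 dx cx h1 h3 h4.
  have : b * d <= b * 2^-1 by rewrite ler_wpM2l//; lra.
  have : c * b <= 2^-1 * b by rewrite ler_wpM2r//; lra.
  by lra.
have [y uy _] := geom_tends ud.
have fix_y : y = F y.
  apply: (@tends_unique _ _ (fun n => u (n + 1)%N)); first exact: tends_shift.
  apply: (@tends_ext _ _ _ (fun n => F (u n))); last by move=> n; rewrite addn1 uS.
  by apply/tendsZ/tendsD; [exact: tends_cst | exact: tendsM].
exists y; split.
- exact: tends_bound uy ub.
- have e : y + y = x + y * y.
    rewrite {1 2}fix_y /F -scalerDl -rmorphD/=.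
    by rewrite (_ : 2^-1 + 2^-1 = 1 :> R) ?scale1r//; lra.
  by rewrite mulrBl mul1r mulrBr mulr1 -addrA -opprD addrA e addrK.
- move=> sx; apply: (tends_unique (tends_star uy)).
  apply: tends_ext uy _ => n; elim: n => [|n IH]; first exact: star0.
  by rewrite uS /F starZR starD sx starM IH.
- move=> S cS mS Sx; apply: (csub_tends cS _ uy) => n.
  case: (cS) => S0 SD SZ _.
  elim: n => [//|n IH]; rewrite uS; apply/SZ/SD => //; exact: mS.
Qed.

(** v is the Neumann series without its constant term, obtained as the fixed point of v -> y + y v.
    Splitting off the 1 keeps v in any closed subalgebra containing y, unital or not. *)
Lemma neumann y : nm y <= 2^-1 -> exists v,
  [/\ nm v <= 2 * nm y, (1 - y) * (1 + v) = 1, (1 + v) * (1 - y) = 1,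
      star y = y -> star v = v & gen_by y v].
Proof.
move=> hy; pose F v := y + y * v.
pose u n := iter n F (0 : A).
have uS n : u n.+1 = F (u n) by [].
have y0 := nm_ge0 y.
have ud n : nm (u n.+1 - u n) <= nm y * 2^-1 ^+ n.
  elim: n => [|n IH]; first by rewrite expr0 mulr1 uS /F /u /= mulr0 addr0 subr0.
  have -> : u n.+2 - u n.+1 = y * (u n.+1 - u n).
    by rewrite uS [in X in _ - X]uS /F mulrBr opprD addrACA subrr add0r.
  have := nmM y (u n.+1 - u n); have := nm_ge0 (u n.+1 - u n); rewrite exprS.
  move: IH; move: (2^-1 ^+ n) (nm (u n.+1 - u n)) (nm (y * _)) => a b c IH b0 h.
  have : nm y * b <= 2^-1 * b by rewrite ler_wpM2r.
  by lra.
have [v uv hv] := geom_tends ud.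
have gv : gen_by y v.
  move=> S cS mS Sy; apply: (csub_tends cS _ uv) => n.
  case: (cS) => S0 SD SZ _.
  by elim: n => [//|n IH]; rewrite uS; apply: SD => //; exact: mS.
have fix_v : v = F v.
  apply: (@tends_unique _ _ (fun n => u (n + 1)%N)); first exact: tends_shift.
  apply: (@tends_ext _ _ _ (fun n => F (u n))); last by move=> n; rewrite addn1 uS.
  by apply/tendsD; [exact: tends_cst|apply: tendsM => //; exact: tends_cst].
have cv : v * y = y * v by rewrite (gen_by_comm gv (erefl _)).
have e : (1 - y) * (1 + v) = 1.
  rewrite mulrBl mul1r mulrDr mulr1 {1}fix_v /F; exact: addrK.
exists v; split=> //.
- by have := hv 0%N; rewrite expr0 mulr1 /u /= sub0r nmN.
- by rewrite -[RHS]e mulrBr mulr1 mulrDl mul1r cv [RHS]mulrBl mul1r mulrDr mulr1.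
- move=> sy; apply: (tends_unique (tends_star uv)).
  apply: tends_ext uv _ => n.
  suff : star (u n) = u n /\ y * u n = u n * y by case.
  elim: n => [|n [IH1 IH2]]; first by rewrite /u /= star0 mulr0 mul0r.
  by rewrite uS /F starD starM IH1 sy -IH2 mulrDr mulrDl -(mulrA y) -IH2.
Qed.

(** 1 + v is the inverse square root of 1 - x. This replaces functional calculus when a near
    symmetry is rounded to a symmetry and a near isometry to an isometry. *)
Lemma invsqrt_ex x : nm x <= 2^-1 -> star x = x -> exists v,
  [/\ nm v <= 2 * nm x, star v = v, gen_by x v &
      forall a, a = 1 + v -> a * a * (1 - x) = 1 /\ a * (1 - x) * a = 1].
Proof.
move=> hx sx; have [y [ny ys /(_ sx) sy gy]] := sqrt_ex hx.
have [v [nv v1 v2 /(_ sy) sv gv]] := neumann (le_trans ny hx).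
exists v; split=> //; first lra.
  exact: gen_by_trans gv.
move=> _ ->; rewrite -ys; split.
  by rewrite mulrA -(mulrA (1 + v) (1 + v)) v2 mulr1 v2.
by rewrite mulrA v2 mul1r v1.
Qed.

End SquareRoot.

Section Hom.
Variables (R : realType) (A B : cstarType R) (f : A -> B).
Hypothesis fh : star_hom f.
Implicit Types x y z : A.

Lemma homD x y : f (x + y) = f x + f y.
Proof. by case: fh => fl _ _ _; have := fl 1 x y; rewrite !scale1r. Qed.

Lemma hom0 : f 0 = 0.
Proof. by apply: (addrI (f 0)); rewrite -homD !addr0. Qed.

Lemma homZ c x : f (c *: x) = c *: f x.
Proof. by case: fh => fl _ _ _; have := fl c x 0; rewrite hom0 !addr0. Qed.

Lemma homN x : f (- x) = - f x.
Proof. by rewrite -scaleN1r homZ scaleN1r. Qed.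

Lemma homB x y : f (x - y) = f x - f y.
Proof. by rewrite homD homN. Qed.

Lemma hom1 : f 1 = 1.
Proof. by case: fh. Qed.

Lemma homM x y : f (x * y) = f x * f y.
Proof. by case: fh => _ _ h _; apply: h. Qed.

Lemma homS x : f (star x) = star (f x).
Proof. by case: fh => _ _ _ h; apply: h. Qed.

Lemma homX x n : f (x ^+ n) = f x ^+ n.
Proof. by elim: n => [|n IH]; rewrite ?hom1// !exprS homM IH. Qed.

Lemma hom_sum I (r : seq I) (P : pred I) (F : I -> A) :
  f (\sum_(i <- r | P i) F i) = \sum_(i <- r | P i) f (F i).
Proof. by apply: (big_morph f homD hom0). Qed.

Lemma hom_unitary x : unitary x -> unitary (f x).
Proof. by case=> h k; split; rewrite -homS -homM ?h ?k hom1. Qed.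

Lemma hom_Ad x y : f (Ad x y) = Ad (f x) (f y).
Proof. by rewrite /Ad !homM homS. Qed.

(* x = (u + u^* )/2 for the unitary u = x + i sqrt(1 - x^2) *)
Lemma hom_sa_half x : star x = x -> nm x <= 2^-1 -> nm (f x) <= 1.
Proof.
move=> sx hx; have hxx : nm (x * x) <= 2^-1.
  by have := nmM x x; have := nm_ge0 x; nra.
have sxx : star (x * x) = x * x by rewrite starM sx.
have [y [_ ys /(_ sxx) sy gy]] := sqrt_ex hxx.
have cy : x * y = y * x by apply: (gen_by_comm gy); rewrite mulrA.
set s := 1 - y in ys; have ss : star s = s by rewrite /s starB star1 sy.
have cs : x * s = s * x by rewrite /s mulrBl mulrBr mulr1 mul1r cy.
pose u := x + 'i *: s; have su : star u = x - 'i *: s.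
  by rewrite /u starD starZ sx ss conjCi scaleNr.
have ii : ('i : R[i]) * 'i = -1 by rewrite -expr2 sqrCi.
have uu : unitary u.
  split; rewrite su /u.
    rewrite mulrBl !mulrDr -!scalerAl -!scalerAr !scalerA ii scaleN1r ys cs.
    by rewrite opprD opprK addrA addrK addrC subrK.
  rewrite mulrDl !mulrBr -!scalerAl -!scalerAr !scalerA ii scaleN1r ys cs opprK.
  by rewrite addrA subrK addrC subrK.
have ex : x = (2^-1 : R)%:C *: (u + star u).
  rewrite su /u addrACA subrr addr0 -mulr2n -(scaler_nat 2 x) scalerA.
  rewrite (_ : _ * _ = 1) ?scale1r//.
  by rewrite -(rmorph_nat (real_complex R)) -rmorphM/= mulVf ?rmorph1// pnatr_eq0.
rewrite ex homZ homD nmZR; last lra.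
have := unitary_nm (hom_unitary uu); have := unitary_nm (hom_unitary (unitary_star uu)).
by have := nmD (f u) (f (star u)); lra.
Qed.

(** If a > b > 0, Bernoulli's inequality makes (a/b)^(2^n) unbounded. Together with [nm_sa_exp2]
    this removes the constant from a crude comparison of norms. *)
Lemma pow2_le (a b c : R) : 0 <= a -> 0 <= b ->
  (forall n, a ^+ (2 ^ n) <= c * b ^+ (2 ^ n)) -> a <= b.
Proof.
move=> a0 b0 h; rewrite leNgt; apply/negP => ba.
have [b00|bn] := eqVneq b 0.
  by have := h 0%N; rewrite b00 expn0 !expr1 mulr0; lra.
have bp : 0 < b by rewrite lt_neqAle eq_sym bn.
pose r := a / b - 1.
have r0 : 0 < r by rewrite subr_gt0 ltr_pdivlMr// mul1r.
have bern n : 1 + n%:R * r <= (a / b) ^+ n.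
  elim: n => [|n IH]; first by rewrite expr0 mul0r addr0.
  have e : a / b = 1 + r by rewrite /r addrC subrK.
  rewrite exprS; rewrite e in IH *.
  have : 0 <= n%:R * r by rewrite mulr_ge0// ltW.
  rewrite -natr1; move: IH; move: ((1 + r) ^+ n) (n%:R : R) => p q IH qr.
  by nra.
have hc n : (a / b) ^+ (2 ^ n) <= c.
  by rewrite expr_div_n ler_pdivrMr ?exprn_gt0.
have [N HN] : exists N, c / r < N%:R.
  by exists (Num.trunc (c / r)).+1; rewrite truncnS_gt.
have := hc N; have := bern (2 ^ N)%N.
have : (N%:R : R) <= (2 ^ N)%N%:R by rewrite ler_nat ltnW// ltn_expl.
by move: HN; rewrite ltr_pdivrMr//; nra.
Qed.

(** Rescaling [hom_sa_half] gives the bound [2 * nm x]; applied to the powers x^(2^n), it loses its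
    factor 2. *)
Lemma hom_sa_le x : star x = x -> nm (f x) <= nm x.
Proof.
have H y : star y = y -> nm (f y) <= 2 * nm y.
  move=> sy; have [/nm_eq0->|y0] := eqVneq (nm y) 0; first by rewrite hom0 !nm0 mulr0.
  have yp : 0 < nm y by rewrite lt_neqAle eq_sym y0 nm_ge0.
  have c0 : 0 <= (2 * nm y)^-1 by rewrite invr_ge0; lra.
  have := @hom_sa_half (((2 * nm y)^-1)%:C *: y).
  rewrite starZR sy homZ !nmZR// => /(_ erefl).
  rewrite invfM mulfVK// lexx => /(_ isT).
  by rewrite -invfM mulrC ler_pdivrMr ?mul1r//; lra.
move=> sx; apply: (@pow2_le _ _ 2); rewrite ?nm_ge0// => n.
rewrite -(nm_sa_exp2 _ sx) -nm_sa_exp2; last by rewrite -homS sx.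
by rewrite -homX; apply: H; rewrite starX sx.
Qed.

Lemma hom_le x : nm (f x) <= nm x.
Proof.
rewrite -(@ler_pXn2r _ 2)// ?nnegrE ?nm_ge0// -!nm_starM -homS -homM.
by apply: hom_sa_le; rewrite starM starK.
Qed.

Lemma hom_tends (u : nat -> A) l : tends u l -> tends (fun n => f (u n)) (f l).
Proof.
move=> h e e0; have [N HN] := h e e0; exists N => n Nn.
by rewrite -homB (le_lt_trans (hom_le _)) ?HN.
Qed.

End Hom.

Section HomTheory.
Variables (R : realType).

Lemma id_hom (A : cstarType R) : star_hom (@id A).
Proof. by []. Qed.

Lemma comp_hom (A B C : cstarType R) (g : B -> C) (f : A -> B) :
  star_hom g -> star_hom f -> star_hom (g \o f).
Proof.
move=> gh fh; split=> [c x y||x y|x] /=.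
- by rewrite (homD fh) (homZ fh) (homD gh) (homZ gh).
- by rewrite (hom1 fh) (hom1 gh).
- by rewrite (homM fh) (homM gh).
- by rewrite (homS fh) (homS gh).
Qed.

Lemma hom_ext (A B : cstarType R) (f g : A -> B) (G : set A) :
  star_hom f -> star_hom g -> spanning G -> (forall x, G x -> f x = g x) -> f =1 g.
Proof.
move=> fh gh tG H; apply: (tG [set x | f x = g x]) => //.
split=> /= [|x y h k|c x h|x h]; first by rewrite (hom0 fh) (hom0 gh).
- by rewrite (homD fh) (homD gh) h k.
- by rewrite (homZ fh) (homZ gh) h.
- apply/eqP; rewrite -subr_eq0; apply/eqP/nm_eq0/eqP; rewrite eq_le nm_ge0 andbT.
  rewrite leNgt; apply/negP => e0; set e := nm _ in e0.
  have [y Hy xy] := h (e / 3) ltac:(lra).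
  have := nm_tri (f y) (f x) (g x); rewrite -/e -(homB fh) Hy -(homB gh).
  by have := hom_le fh (x - y); have := hom_le gh (y - x); rewrite (nmBC y); lra.
Qed.

Lemma bij_hom_inv (A B : cstarType R) (f : A -> B) (g : B -> A) :
  star_hom f -> cancel f g -> cancel g f -> star_hom g.
Proof.
move=> fh fK gK; have fi := can_inj fK.
split=> [c x y||x y|x]; apply: fi; rewrite ?(homD fh) ?(homZ fh) ?(homM fh) ?(homS fh) !gK//.
by rewrite (hom1 fh).
Qed.

Lemma can_hom_nm (A B : cstarType R) (f : A -> B) (g : B -> A) :
  star_hom f -> star_hom g -> cancel f g -> forall x, nm (f x) = nm x.
Proof.
move=> fh gh fK x; apply/eqP; rewrite eq_le hom_le//=.
by rewrite -{1}(fK x) hom_le.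
Qed.

Lemma flow_nm (A : cstarType R) (al : flow A) t x : nm (al t x) = nm x.
Proof.
apply: (can_hom_nm (g := al (- t))); try exact: flow_hom.
by move=> y; rewrite -flowD addNr flow0.
Qed.

End HomTheory.

(** * Matrix units and matrix subalgebras *)

Lemma sum_only (V : nmodType) (I : finType) (i : I) (F : I -> V) :
  (forall k, k != i -> F k = 0) -> \sum_k F k = F i.
Proof. by move=> h; rewrite (bigD1 i)//= big1 ?addr0. Qed.

Section Scalars.
Variable R : realType.

Lemma real_geom_lim (r : nat -> R) (C : R) :
  (forall n m, (n <= m)%N -> `|r m - r n| <= C * 2^-1 ^+ n) ->
  exists l, forall n, `|l - r n| <= C * 2^-1 ^+ n.
Proof.
move=> h; pose q n := C * 2^-1 ^+ n.
have hm n m : r m - q m <= r n + q n.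
  have [nm_|/ltnW mn] := leqP n m.
    have := h _ _ nm_; rewrite ler_norml => /andP[_].
    have : 0 <= q m by rewrite (le_trans _ (h _ _ (leqnn m))).
    by rewrite /q; lra.
  have := h _ _ mn; rewrite ler_norml => /andP[+ _].
  have : 0 <= q n by rewrite (le_trans _ (h _ _ (leqnn n))).
  by rewrite /q; lra.
(* Every lower bound [r n - q n] lies below every upper bound [r m + q m], so the supremum of the
   lower bounds is within [q n] of each [r n]. *)
pose S := [set r n - q n | n in [set: nat]].
have ubS n : ubound S (r n + q n) by move=> _ [m _ <-].
have S0 : S !=set0 by exists (r 0%N - q 0%N), 0%N.
have hS : has_sup S by split=> //; exists (r 0%N + q 0%N).
exists (sup S) => n; rewrite ler_norml; apply/andP; split.
  have : r n - q n <= sup S by apply: sup_upper_bound => //; exists n.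
  by rewrite /q; lra.
have : sup S <= r n + q n by apply: ge_sup.
by rewrite /q; lra.
Qed.

Lemma Re_le_cm (c : R[i]) : `|complex.Re c| <= cm c.
Proof. by rewrite -lecR -cmE normc_ge_Re. Qed.

Lemma Im_le_cm (c : R[i]) : `|complex.Im c| <= cm c.
Proof.
have := Re_le_cm (c * 'i); rewrite ReiNIm normrN cmM.
by rewrite (_ : cm 'i = 1) ?mulr1// /cm normCi.
Qed.

Lemma cm_le_ReIm (c : R[i]) : cm c <= `|complex.Re c| + `|complex.Im c|.
Proof.
rewrite {1}(complexE c) -lecR -cmE (le_trans (ler_normD _ _))//.
by rewrite rmorphD/= lerD// cmE ?cmM ?cmR// (_ : cm 'i = 1) ?mul1r// /cm normCi.
Qed.

Lemma complex_geom_lim (c : nat -> R[i]) (C : R) :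
  (forall n m, (n <= m)%N -> cm (c m - c n) <= C * 2^-1 ^+ n) ->
  exists l, forall n, cm (l - c n) <= 2 * C * 2^-1 ^+ n.
Proof.
move=> h.
have [x hx] : exists l, forall n, `|l - complex.Re (c n)| <= C * 2^-1 ^+ n.
  apply: real_geom_lim => n m /h; apply: le_trans.
  by rewrite (le_trans _ (Re_le_cm _))// raddfB.
have [y hy] : exists l, forall n, `|l - complex.Im (c n)| <= C * 2^-1 ^+ n.
  apply: real_geom_lim => n m /h; apply: le_trans.
  by rewrite (le_trans _ (Im_le_cm _))// raddfB.
exists (x +i* y)%C => n; apply: (le_trans (cm_le_ReIm _)).
by have := hx n; have := hy n; rewrite !raddfB/=; lra.
Qed.

(** Coefficients of approximations within 2^-n form a Cauchy sequence, since differences of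
    multiples of v have norm controlled from below by [nm v]. This is the one-dimensional case
    behind [csub_mspan]. *)
Lemma line_closed (A : cstarType R) (v x : A) : v != 0 ->
  (forall e : R, 0 < e -> exists c, nm (x - c *: v) < e) -> exists c, x = c *: v.
Proof.
move=> v0 h; have vp : 0 < nm v.
  rewrite lt_neqAle nm_ge0 andbT eq_sym; apply: contra_neq v0; exact: nm_eq0.
have /choice[c hc] : forall n, exists c, nm (x - c *: v) < 2^-1 ^+ n.
  by move=> n; apply: h; rewrite exprn_gt0// invr_gt0.
have q0 n : (0 : R) < 2^-1 ^+ n by rewrite exprn_gt0// invr_gt0.
have [l hl] : exists l, forall n, cm (l - c n) <= 2 * (2 / nm v) * 2^-1 ^+ n.
  apply: complex_geom_lim => n m nm_.
  rewrite mulrAC ler_pdivlMr// -nmZ scalerBl.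
  have := nm_tri x (c m *: v) (c n *: v); have := hc m; have := hc n.
  rewrite (nmBC _ x).
  have : (2^-1 : R) ^+ m <= 2^-1 ^+ n by rewrite ler_wiXn2l//; lra.
  by lra.
exists l; apply/eqP; rewrite -subr_eq0; apply/eqP/nm_eq0/eqP.
rewrite eq_le nm_ge0 andbT leNgt; apply/negP => e0.
have [N HN] := half_lt 5 e0.
have := HN N (leqnn _); have := hc N; have := hl N.
have := nm_tri (c N *: v) x (l *: v); rewrite -scalerBl nmZ.
rewrite -cmN opprB => h1.
have -> : 2 * (2 / nm v) * 2^-1 ^+ N = 4 * 2^-1 ^+ N / nm v by field; lra.
by rewrite ler_pdivlMr//; have := q0 N; lra.
Qed.

End Scalars.

Section MatrixUnits.
Variables (R : realType) (A : cstarType R) (I : finType).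
Implicit Types (e : I -> I -> A) (c d : I -> I -> R[i]) (x y : A).

(** The last clause excludes the zero system. The sum of the diagonal units is a projection that may
    differ from 1, as it may for the subalgebras in a quasi-UHF sequence. *)
Definition munits e := [/\
  (forall i j k l, e i j * e k l = if j == k then e i l else 0),
  (forall i j, star (e i j) = e j i) & exists i, e i i != 0].

Definition mcomb e c : A := \sum_i \sum_j c i j *: e i j.
Definition mspan e : set A := [set x | exists c, x = mcomb e c].

Lemma mcombD e c d : mcomb e c + mcomb e d = mcomb e (fun i j => c i j + d i j).
Proof.
rewrite /mcomb -big_split/=; apply: eq_bigr => i _.
by rewrite -big_split/=; apply: eq_bigr => j _; rewrite scalerDl.
Qed.

Lemma mcombZ e a c : a *: mcomb e c = mcomb e (fun i j => a * c i j).
Proof.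
rewrite /mcomb scaler_sumr; apply: eq_bigr => i _.
by rewrite scaler_sumr; apply: eq_bigr => j _; rewrite scalerA.
Qed.

Variable e : I -> I -> A.
Hypothesis eP : munits e.

Lemma mu_mul i j k l : e i j * e k l = if j == k then e i l else 0.
Proof. by case: eP. Qed.

Lemma mu_mulE i j l : e i j * e j l = e i l.
Proof. by rewrite mu_mul eqxx. Qed.

Lemma mu_mul0 i j k l : j != k -> e i j * e k l = 0.
Proof. by rewrite mu_mul => /negbTE->. Qed.

Lemma mu_star i j : star (e i j) = e j i.
Proof. by case: eP. Qed.

Lemma mu_neq0 i j : e i j != 0.
Proof.
case: (eP) => _ _ [k]; apply: contra_neq => h.
by rewrite -(mu_mulE k i k) -(mu_mulE i j k) h mul0r mulr0.
Qed.

Lemma mu_nm i j : nm (e i j) = 1.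
Proof.
have h : nm (e i j) ^+ 2 = 1.
  by rewrite -nm_starM mu_star mu_mulE nm_proj1 ?mu_mulE ?mu_star// mu_neq0.
move: h => /eqP; rewrite sqrf_eq1 => /orP[/eqP//|/eqP h1].
by have := nm_ge0 (e i j); rewrite h1; lra.
Qed.

Lemma mcombMl p i c : e p i * mcomb e c = \sum_j c i j *: e p j.
Proof.
rewrite /mcomb mulr_sumr (@sum_only _ _ i) => [|k ki]; rewrite mulr_sumr.
  by apply: eq_bigr => j _; rewrite -scalerAr mu_mulE.
by rewrite big1// => j _; rewrite -scalerAr mu_mul0 ?scaler0// eq_sym.
Qed.

Lemma mcombMlr p i c j q : e p i * mcomb e c * e j q = c i j *: e p q.
Proof.
rewrite mcombMl mulr_suml (@sum_only _ _ j) => [|k kj].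
  by rewrite -scalerAl mu_mulE.
by rewrite -scalerAl mu_mul0 ?scaler0.
Qed.

Lemma mcoef_le c i j : cm (c i j) <= nm (mcomb e c).
Proof.
have := mcombMlr i i c j j => /(congr1 (@nm R A)); rewrite nmZ mu_nm mulr1 => <-.
by have := nmM3 (e i i) (mcomb e c) (e j j); rewrite !mu_nm mulr1 mul1r.
Qed.

Lemma mcomb_nm_le c : nm (mcomb e c) <= \sum_i \sum_j cm (c i j).
Proof.
apply: (le_trans (nm_sum _ _ _)); apply: ler_sum => i _.
apply: (le_trans (nm_sum _ _ _)); apply: ler_sum => j _.
by rewrite nmZ mu_nm mulr1.
Qed.

Lemma mcombM c d :
  mcomb e c * mcomb e d = mcomb e (fun i j => \sum_k c i k * d k j).
Proof.
rewrite {1}/mcomb mulr_suml; apply: eq_bigr => i _.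
rewrite mulr_suml; under eq_bigr do rewrite -scalerAl mcombMl scaler_sumr.
rewrite exchange_big/=; apply: eq_bigr => j _; rewrite scaler_suml.
by apply: eq_bigr => k _; rewrite scalerA.
Qed.

Lemma mcomb_star c : star (mcomb e c) = mcomb e (fun i j => Num.conj (c j i)).
Proof.
rewrite /mcomb star_sum exchange_big/=; apply: eq_bigr => i _.
rewrite star_sum; apply: eq_bigr => j _.
by rewrite starZ mu_star.
Qed.

Lemma mcomb_inj c d : mcomb e c = mcomb e d -> forall i j, c i j = d i j.
Proof.
move=> h i j; have := mcombMlr i i c j j; rewrite h mcombMlr => /eqP.
rewrite -subr_eq0 -scalerBl scaler_eq0 (negbTE (mu_neq0 _ _)) orbF subr_eq0.
by move=> /eqP.
Qed.

Lemma mu_span i j : mspan e (e i j).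
Proof.
exists (fun k l => if (k == i) && (l == j) then 1 else 0).
rewrite /mcomb (@sum_only _ _ i) => [|k ki].
  rewrite (@sum_only _ _ j) => [|l lj]; rewrite eqxx/= ?eqxx ?scale1r//.
  by rewrite (negbTE lj) scale0r.
by rewrite big1// => l _; rewrite (negbTE ki) scale0r.
Qed.

Lemma mspanM x y : mspan e x -> mspan e y -> mspan e (x * y).
Proof. by move=> [c ->] [d ->]; eexists; exact: mcombM. Qed.

Lemma mspan_star x : mspan e x -> mspan e (star x).
Proof. by move=> [c ->]; eexists; exact: mcomb_star. Qed.

Let p := \sum_i e i i.

Lemma mspan_unit : mspan e p.
Proof.
rewrite /p; apply: big_ind => [|x y [c ->] [d ->]|i _].
- by exists (fun _ _ => 0); rewrite /mcomb big1// => i _; rewrite big1// => j _; rewrite scale0r.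
- by eexists; exact: mcombD.
- exact: mu_span.
Qed.

Lemma mu_unit_l x : mspan e x -> p * x = x.
Proof.
move=> [c ->]; rewrite /p mulr_suml /mcomb; apply: eq_bigr => i _.
exact: mcombMl.
Qed.

Lemma mu_unit_star : star p = p.
Proof. by rewrite /p star_sum; apply: eq_bigr => i _; rewrite mu_star. Qed.

Lemma mu_unit_r x : mspan e x -> x * p = x.
Proof.
move=> h; rewrite -(starK (x * p)) starM mu_unit_star mu_unit_l ?starK//.
exact: mspan_star.
Qed.

(** Closedness is the point. A limit x of the span satisfies x = p x p, because its approximations
    do, and each corner [e i i * x * e j j] is a limit of multiples of [e i j], hence such a
    multiple. *)
Lemma csub_mspan : csub (mspan e).
Proof.
split.
- by exists (fun _ _ => 0); rewrite /mcomb big1// => i _; rewrite big1// => j _; rewrite scale0r.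
- by move=> x y [c ->] [d ->]; eexists; exact: mcombD.
- by move=> a x [c ->]; eexists; exact: mcombZ.
move=> x hx.
have np : nm p <= 1.
  apply: nm_proj_le1 mu_unit_star _.
  exact: mu_unit_l mspan_unit.
have pxp : x = p * x * p.
  apply/eqP; rewrite -subr_eq0; apply/eqP/nm_eq0/eqP.
  rewrite eq_le nm_ge0 andbT leNgt; apply/negP => e0; set d := nm _ in e0.
  have [y Sy xy] := hx (d / 3) ltac:(lra).
  have : x - p * x * p = (x - y) - p * (x - y) * p.
    by rewrite mulrBr mulrBl (mu_unit_l Sy) (mu_unit_r Sy) opprB addrA subrK.
  move=> /(congr1 (@nm R A)); rewrite -/d.
  have := nmB (x - y) (p * (x - y) * p); have := nmM3 p (x - y) p.
  have := nm_ge0 (x - y); have := nm_ge0 p.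
  move: xy; move: (nm (p * (x - y) * p)) (nm (x - y)) (nm p) np => g a b np.
  move=> xy b0 a0 h1 h2 h3.
  have h4 : b * a <= a by rewrite ler_piMl.
  have : b * a * b <= b * a by rewrite ler_piMr// mulr_ge0.
  by lra.
have hc i j : exists a, e i i * x * e j j = a *: e i j.
  apply: line_closed; first exact: mu_neq0.
  move=> d d0; have [_ [c ->] xy] := hx d d0; exists (c i j).
  rewrite -mcombMlr -mulrBl -mulrBr (le_lt_trans (nmM3 _ _ _))//.
  by rewrite !mu_nm mul1r mulr1.
have /choice[c hcc] : forall ij : I * I, exists a, e ij.1 ij.1 * x * e ij.2 ij.2 = a *: e ij.1 ij.2.
  by move=> [i j]; apply: hc.
exists (fun i j => c (i, j)); rewrite pxp /p /mcomb mulr_suml mulr_suml.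
apply: eq_bigr => i _; rewrite mulr_sumr; apply: eq_bigr => j _.
by rewrite -(hcc (i, j)).
Qed.

End MatrixUnits.

(* Boundedness of the comparison map between two copies of a matrix algebra
   upgrades to isometry: apply it to large powers of [x^* x]. *)
Lemma munits_nm_le (R : realType) (A B : cstarType R) (I : finType)
    (e : I -> I -> A) (f : I -> I -> B) c : munits e -> munits f ->
  nm (mcomb e c) <= nm (mcomb f c).
Proof.
move=> eP fP; pose P x y := exists c, x = mcomb e c /\ y = mcomb f c.
have PM x y x' y' : P x y -> P x' y' -> P (x * x') (y * y').
  by move=> [a [-> ->]] [b [-> ->]]; eexists; split; apply: mcombM.
have PS x y : P x y -> P (star x) (star y).
  by move=> [a [-> ->]]; eexists; split; apply: mcomb_star.
have PX x y n : P x y -> P (x ^+ n.+1) (y ^+ n.+1).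
  by move=> h; elim: n => [//|n IH]; rewrite exprS [y ^+ _]exprS; apply: PM.
pose C : R := \sum_(i : I) \sum_(j : I) 1.
have PC x y : P x y -> nm x <= C * nm y.
  move=> [a [-> ->]]; apply: (le_trans (mcomb_nm_le eP a)).
  rewrite /C mulr_suml; apply: ler_sum => i _; rewrite mulr_suml.
  by apply: ler_sum => j _; rewrite mul1r mcoef_le.
suff H x y : P x y -> nm x <= nm y by apply: H; exists c.
move=> h; rewrite -(@ler_pXn2r _ 2)// ?nnegrE ?nm_ge0// -!nm_starM.
apply: (@pow2_le _ _ _ C); rewrite ?nm_ge0// => n.
rewrite -!nm_sa_exp2; [|by rewrite starM starK..].
have := expn_gt0 2 n; case: (2 ^ n)%N => // k _.
by apply: PC; apply: PX; apply: PM => //; apply: PS.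
Qed.

Section MatrixAlgebras.
Variables (R : realType) (A : cstarType R).
Implicit Types (B : set A).


(** Unital matrix subalgebras. Any finite type may index the units, so that a product of two
    commuting ones is indexed by pairs without renumbering. *)
Definition mxalg B := exists (I : finType) (e : I -> I -> A),
  [/\ munits e, \sum_i e i i = 1 & B = mspan e].

Lemma mxalg1 B : mxalg B -> B 1.
Proof.
case=> I [e [eP e1 ->]]; rewrite -e1; apply: (csub_sum _ (csub_mspan eP)) => i _.
exact: mu_span.
Qed.

Lemma mxalg_csub B : mxalg B -> csub B.
Proof. by case=> I [e [eP e1 ->]]; apply: csub_mspan. Qed.

Lemma mxalgM B x y : mxalg B -> B x -> B y -> B (x * y).
Proof. by case=> I [e [eP e1 ->]]; apply: mspanM. Qed.

Lemma mxalgS B x : mxalg B -> B x -> B (star x).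
Proof. by case=> I [e [eP e1 ->]]; apply: mspan_star. Qed.

Lemma full_matrix_munits B : full_matrix_subalgebra B ->
  exists k (e : 'I_k.+1 -> 'I_k.+1 -> A), munits e /\ B = mspan e.
Proof.
case=> k [f [fl fM fS fi <-]].
have f0 : f 0 = 0.
  by have := fl 1 0 0; rewrite !scale1r addr0 => /(congr1 (+%R^~ (- f 0))); rewrite addrK subrr.
have fD x y : f (x + y) = f x + f y by have := fl 1 x y; rewrite !scale1r.
have fZ a x : f (a *: x) = a *: f x by have := fl a x 0; rewrite f0 !addr0.
exists k, (fun i j => f (delta_mx i j)); split.
  split=> [i j l m|i j|].
  - rewrite -fM; case: eqVneq => [->|jl]; first by rewrite mul_delta_mx.
    by rewrite mul_delta_mx_0// f0.
  - rewrite -fS; congr f; apply/matrixP => p q; rewrite !mxE andbC.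
    by case: (_ && _); rewrite ?conjC1 ?conjC0.
  - exists ord0; rewrite -f0; apply/eqP => /fi /matrixP/(_ ord0 ord0)/eqP.
    by rewrite !mxE eqxx oner_eq0.
have fsum (M : 'M[R[i]]_k.+1) : f M = mcomb (fun i j => f (delta_mx i j)) M.
  rewrite {1}(matrix_sum_delta M) (big_morph f fD f0); apply: eq_bigr => i _.
  by rewrite (big_morph f fD f0); apply: eq_bigr => j _; rewrite fZ.
rewrite eqEsubset; split=> x /=.
  by case=> M _ <-; exists (fun i j => M i j); exact: fsum.
case=> c ->; exists (\matrix_(i, j) c i j) => //; rewrite fsum /mcomb.
by apply: eq_bigr => i _; apply: eq_bigr => j _; rewrite mxE.
Qed.

Lemma full_matrix_mxalg B : full_matrix_subalgebra B -> B 1 -> mxalg B.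
Proof.
move=> /full_matrix_munits[k [e [eP ->]]] B1; exists 'I_k.+1, e; split=> //.
by rewrite -[LHS]mulr1 mu_unit_l.
Qed.

Lemma mxalg_full_matrix B : mxalg B -> full_matrix_subalgebra B.
Proof.
case=> I [e [eP e1 ->]].
have [k kI] : exists k, #|I| = k.+1.
  case: eP => _ _ [i _]; exists #|I|.-1; rewrite prednK//.
  by apply/card_gt0P; exists i.
pose h (i : 'I_k.+1) : I := enum_val (cast_ord (esym kI) i).
pose g (i : I) : 'I_k.+1 := cast_ord kI (enum_rank i).
have hK : cancel h g by move=> i; rewrite /g /h enum_valK cast_ordKV.
have gK : cancel g h by move=> i; rewrite /g /h cast_ordK enum_rankK.
pose f (M : 'M[R[i]]_k.+1) := mcomb e (fun i j => M (g i) (g j)).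
exists k, f; split.
- move=> a M N; rewrite /f mcombZ mcombD; congr mcomb.
  by apply/funext => i; apply/funext => j; rewrite !mxE.
- move=> M N; rewrite /f mcombM//; congr mcomb.
  apply/funext => i; apply/funext => j; rewrite !mxE.
  by rewrite (reindex g)//; exists h => x _; rewrite ?gK ?hK.
- move=> M; rewrite /f mcomb_star//; congr mcomb.
  by apply/funext => i; apply/funext => j; rewrite !mxE.
- move=> M N /mcomb_inj H; apply/matrixP => i j.
  by have := H eP (h i) (h j); rewrite !hK.
- rewrite eqEsubset; split=> x /=; first by case=> M _ <-; eexists.
  case=> c ->; exists (\matrix_(i, j) c (h i) (h j)) => //; congr mcomb.
  by apply/funext => i; apply/funext => j; rewrite mxE !gK.
Qed.

Definition uhf_chain (B : nat -> set A) := [/\ forall n, mxalg (B n),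
  forall n m, (n <= m)%N -> B n `<=` B m &
  forall x (d : R), 0 < d -> exists n y, B n y /\ nm (x - y) < d].

Lemma chain_mono (B : nat -> set A) : (forall n, B n `<=` B n.+1) ->
  forall n m, (n <= m)%N -> B n `<=` B m.
Proof.
move=> h n m nm_; rewrite -(subnK nm_); elim: (m - n)%N => [//|k IH] x Bx.
by rewrite addSn; apply/h/IH.
Qed.

Lemma uhf_chainP : UHF_algebra A -> exists B : nat -> set A, uhf_chain B.
Proof.
case=> B [hB hm h1 hd]; exists B; have mB := chain_mono hm; split=> //.
  by move=> n; apply: full_matrix_mxalg (mB 0%N n _ _ _) => //.
move=> x d d0; have : closure (\bigcup_n B n) x by rewrite hd.
by move=> /closure_epsP/(_ d d0)[y [n _ Bny] xy]; exists n, y.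
Qed.

Lemma uhf_spanning (B : nat -> set A) : uhf_chain B -> spanning (\bigcup_n B n).
Proof.
move=> [_ _ h]; apply: dense_spanning; rewrite -subTset => x _.
apply/closure_epsP => d d0; have [n [y [By xy]]] := h x d d0.
by exists y => //; exists n.
Qed.

End MatrixAlgebras.

Lemma hom_munits (R : realType) (A B : cstarType R) (f : A -> B) (I : finType)
    (e : I -> I -> A) : star_hom f -> munits e -> \sum_i e i i = 1 ->
  munits (fun i j => f (e i j)) /\ \sum_i f (e i i) = 1.
Proof.
move=> fh eP e1; have s1 : \sum_i f (e i i) = 1 by rewrite -hom_sum// e1 hom1.
split=> //; split=> [i j k l|i j|].
- by rewrite -homM// mu_mul//; case: eqP => // _; rewrite hom0.
- by rewrite -homS// mu_star.
- apply: contrapT => h; have := oner_neq0 B; rewrite -s1 big1 ?eqxx// => i _.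
  by apply: contrapT => h'; apply: h; exists i; apply/eqP.
Qed.

Lemma hom_mcomb (R : realType) (A B : cstarType R) (f : A -> B) (I : finType)
    (e : I -> I -> A) c : star_hom f -> f (mcomb e c) = mcomb (fun i j => f (e i j)) c.
Proof.
move=> fh; rewrite /mcomb hom_sum//; apply: eq_bigr => i _.
by rewrite hom_sum//; apply: eq_bigr => j _; rewrite homZ.
Qed.

(** On a matrix subalgebra the images of the matrix units are again matrix units and [munits_nm_le]
    applies; contractivity extends the equality of norms to the closure. *)
Lemma uhf_hom_isometric (R : realType) (A D : cstarType R) (B : nat -> set A) (f : A -> D) :
  uhf_chain B -> star_hom f -> forall x, nm (f x) = nm x.
Proof.
move=> [hB _ hd] fh x; apply/eqP; rewrite eq_le hom_le//=.
rewrite leNgt; apply/negP => lt; set d := (nm x - nm (f x)) / 3.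
have d0 : 0 < d by rewrite /d; lra.
have [n [y [By xy]]] := hd x d d0.
have hy : nm y <= nm (f y).
  have [I [e [eP e1 E]]] := hB n; move: By; rewrite E => -[c ->].
  have [fP _] := hom_munits fh eP e1.
  by rewrite hom_mcomb//; apply: munits_nm_le.
have := nm_le_add x y; have := nm_le_add (f y) (f x); rewrite -homB//.
have := hom_le fh (y - x); rewrite (nmBC y).
by move: xy; rewrite /d; lra.
Qed.

(** * Projections and unitary equivalence in UHF algebras *)

Section MatrixProjections.
Variables (C : numClosedFieldType) (n : nat).
Implicit Types P Q U : 'M[C]_n.

Lemma trmxC_mul m k l (M : 'M[C]_(m, k)) (N : 'M[C]_(k, l)) :
  (M *m N)^t* = N^t* *m M^t*.
Proof. by rewrite trmx_mul map_mxM. Qed.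

Lemma projmx_diag P : P^t* = P -> P *m P = P -> exists U (J : {set 'I_n}),
  [/\ U *m U^t* = 1%:M, U^t* *m U = 1%:M &
      P = U^t* *m diag_mx (\row_i (i \in J)%:R) *m U].
Proof.
move=> hP PP; have nP : P \is normalmx by apply/normalmxP; rewrite hP.
have /orthomx_spectralP e := nP.
set U := spectralmx P in e; set d := spectral_diag P in e.
have uU : U \is unitarymx by apply: spectral_unitarymx.
have UU : U *m U^t* = 1%:M by apply/unitarymxP.
have UU' : U^t* *m U = 1%:M by rewrite -(mulmx1C UU).
rewrite invmx_unitary// in e.
have dd : diag_mx d *m diag_mx d = diag_mx d.
  have -> : diag_mx d = U *m P *m U^t*.
    by rewrite {1}e !mulmxA UU mul1mx -mulmxA UU mulmx1.
  by rewrite !mulmxA -(mulmxA (U *m P) (U^t*) U) UU' mulmx1 -(mulmxA U P P) PP.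
have d01 i : d 0 i = (d 0 i == 1)%:R.
  have := congr1 (fun M : 'M[C]_n => M i i) dd.
  rewrite mulmx_diag !mxE eqxx !mulr1n => /eqP.
  rewrite -subr_eq0 -{3}(mulr1 (d 0 i)) -mulrBr mulf_eq0 subr_eq0.
  by case/orP => /eqP->; rewrite ?eqxx// eq_sym oner_eq0.
exists U, [set i | d 0 i == 1]%SET; split=> //.
rewrite {1}e; congr (_ *m diag_mx _ *m _); apply/rowP => i; rewrite !mxE inE.
exact: d01.
Qed.

(** Comparison of projections in a matrix algebra: once both are diagonal, the one of smaller rank
    is carried under the other by a partial permutation of the basis. *)
Lemma projmx_compare P Q : P^t* = P -> P *m P = P -> Q^t* = Q -> Q *m Q = Q ->
  exists Y : 'M[C]_n, (Y^t* *m Y = P /\ Q *m Y = Y) \/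
                      (Y^t* *m Y = Q /\ P *m Y = Y).
Proof.
move=> hP PP hQ QQ.
have [U [J [U1 U2 ->]]] := projmx_diag hP PP.
have [V [K [V1 V2 ->]]] := projmx_diag hQ QQ.
suff H (U' V' : 'M[C]_n) (J' K' : {set 'I_n}) : (#|J'| <= #|K'|)%N ->
    U' *m U'^t* = 1%:M -> V' *m V'^t* = 1%:M ->
    exists Y : 'M[C]_n, Y^t* *m Y = U'^t* *m diag_mx (\row_i (i \in J')%:R) *m U' /\
      (V'^t* *m diag_mx (\row_i (i \in K')%:R) *m V') *m Y = Y.
  have [JK|/ltnW JK] := leqP #|J| #|K|.
    by have [Y hY] := H _ _ _ _ JK U1 V1; exists Y; left.
  by have [Y hY] := H _ _ _ _ JK V1 U1; exists Y; right.
(* [phi] sends the k-th element of J' to the k-th element of K'; the default i of [nth] is never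
   reached on J', as J' has at most as many elements as K'. *)
move=> JK hU hV; pose phi (i : 'I_n) := nth i (enum K') (index i (enum J')).
have idx i : i \in J' -> (index i (enum J') < size (enum K'))%N.
  by move=> iJ; rewrite -cardE (leq_trans _ JK)// cardE index_mem mem_enum.
have phiK i : i \in J' -> phi i \in K'.
  by move=> iJ; rewrite -mem_enum mem_nth ?idx.
have phi_inj i j : i \in J' -> j \in J' -> phi i = phi j -> i = j.
  move=> iJ jJ; rewrite /phi (set_nth_default i j)//; last exact: idx.
  move/eqP; rewrite nth_uniq ?idx ?enum_uniq// => /eqP h.
  by rewrite -(nth_index i (s := enum J') (x := i)) ?mem_enum// h nth_index ?mem_enum.
pose Z : 'M[C]_n := \matrix_(k, i) ((i \in J') && (k == phi i))%:R.
have ZZ : Z^t* *m Z = diag_mx (\row_i (i \in J')%:R).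
  apply/matrixP => i j; rewrite !mxE; under eq_bigr do rewrite !mxE.
  case iJ: (i \in J'); last first.
    by rewrite mul0rn big1// => k _; rewrite conjC0 mul0r.
  rewrite (@sum_only _ _ (phi i)) => [|k /negbTE ki]; last first.
    by rewrite ki conjC0 mul0r.
  rewrite eqxx conjC1 mul1r; case jJ: (j \in J') => /=.
    by case: (eqVneq i j) => [->|ij]; rewrite ?eqxx//; case: eqP => // /phi_inj-/(_ iJ jJ)/eqP; rewrite (negbTE ij).
  by case: eqP => // ij; rewrite -ij iJ in jJ.
have KZ : diag_mx (\row_i (i \in K')%:R) *m Z = Z.
  apply/matrixP => k i; rewrite mul_diag_mx !mxE.
  case iJ: (i \in J') => /=; last by rewrite mulr0.
  by case: eqP => [->|_]; rewrite ?mulr0// phiK// mulr1.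
exists (V'^t* *m Z *m U'); split.
  rewrite !trmxC_mul trmxCK !mulmxA -(mulmxA _ V' (V'^t*)) hV mulmx1.
  by rewrite -(mulmxA _ _ Z) ZZ.
by rewrite !mulmxA -(mulmxA _ V' (V'^t*)) hV mulmx1 -(mulmxA _ _ Z) KZ.
Qed.

End MatrixProjections.

Section UHFUnitaries.
Variables (R : realType) (A : cstarType R).
Implicit Types (x y z p q v w : A).

Lemma mxalgP (B : set A) : mxalg B -> exists k (f : 'M[R[i]]_k.+1 -> A),
  [/\ {morph f : M N / M *m N >-> M * N}, f 0 = 0,
      (forall M, f (M^t*) = star (f M)), injective f & f 1%:M = 1 /\ range f = B].
Proof.
move=> hB; have [k [f [fl fM fS fi fB]]] := mxalg_full_matrix hB.
exists k, f; split=> //.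
  have := fl 1 0 0; rewrite !scale1r addr0 => /(congr1 (+%R^~ (- f 0))).
  by rewrite addrK subrr.
split=> //; have : B 1 by apply: mxalg1.
by rewrite -fB => -[M _ M1]; rewrite -[LHS]mulr1 -M1 -fM mul1mx.
Qed.

(** The left inverse y may lie outside B. It still kills the cokernel of the matrix of x, which is
    therefore invertible inside B, and y must be that inverse. *)
Lemma mxalg_left_inv (B : set A) x y : mxalg B -> B x -> y * x = 1 -> x * y = 1.
Proof.
move=> hB; have [k [f [fM f0 _ fi [f1 <-]]]] := mxalgP hB => -[M _ <-] h.
have /eqP uM : cokermx M == 0.
  by apply/eqP/fi; rewrite -[LHS]mul1r -h -mulrA -fM mulmx_coker f0 mulr0.
have Mu : M \in unitmx by rewrite -row_full_unit -cokermx_eq0 uM.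
have e : f M * f (invmx M) = 1 by rewrite -fM mulmxV.
suff -> : y = f (invmx M) by [].
by rewrite -[LHS]mulr1 -e mulrA h mul1r.
Qed.

(** Finiteness of the unit in the sense of Murray and von Neumann. *)
Definition finite_cstar := forall v, star v * v = 1 -> unitary v.

(** An isometry v is within 1/2 of some b in a matrix subalgebra. Then [star v * b] is invertible,
    so b has a left inverse and thus, by finite dimension, a right one; this gives v = b w with w
    the inverse of [star v * b], and v is unitary. *)
Lemma uhf_finite (B : nat -> set A) : uhf_chain B -> finite_cstar.
Proof.
move=> [hB _ hd] v vv; split=> //.
have nv : nm v = 1.
  have := nm_starM v; rewrite vv nm1 => /esym/eqP; rewrite sqrf_eq1.
  by move=> /orP[/eqP//|/eqP h]; have := nm_ge0 v; rewrite h; lra.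
have [n [b [Bb vb]]] := hd v 2^-1 ltac:(lra).
have [|u [_ u1 u2 _ _]] := @neumann _ _ (star v * (v - b)).
  by rewrite (le_trans (nmM _ _))// nm_star nv mul1r ltW.
have e : 1 - star v * (v - b) = star v * b by rewrite mulrBr vv opprB addrC subrK.
rewrite e in u1 u2; set w := 1 + u in u1 u2.
have bw : b * (w * star v) = 1 by apply: (mxalg_left_inv (hB n) Bb); rewrite -mulrA.
rewrite -[RHS]bw mulrA; congr (_ * _).
by rewrite -[LHS]mul1r -bw -!mulrA vv mulr1.
Qed.

Lemma isometry_nm_le v p : star v * v = p -> star p = p -> p * p = p -> nm v <= 1.
Proof.
move=> vv sp pp; have := nm_starM v; rewrite vv; have := nm_proj_le1 sp pp.
by have := nm_ge0 v; nra.
Qed.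

Lemma isometry_r v p : star v * v = p -> star p = p -> p * p = p -> v * p = v.
Proof.
move=> vv sp pp; apply/eqP; rewrite -subr_eq0; apply/eqP/nm_eq0/eqP.
rewrite -sqrf_eq0 -nm_starM starB starM sp mulrBl !mulrBr mulrA -(mulrA p) vv.
by rewrite mulrA -(mulrA p) vv !pp subrr nm0.
Qed.

Lemma half_add x : (2^-1 : R)%:C *: (x + x) = x.
Proof.
rewrite -mulr2n -(scaler_nat 2 x) scalerA (_ : _ * _ = 1) ?scale1r//.
by rewrite -(rmorph_nat (real_complex R)) -rmorphM/= mulVf ?rmorph1// pnatr_eq0.
Qed.

Lemma proj_symmetry p : p * p = p -> (p + p - 1) * (p + p - 1) = 1.
Proof.
by move=> pp; rewrite mulrBl mul1r mulrBr mulr1 mulrDr mulrDl pp addrK opprB addrC subrK.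
Qed.

(** With b made self-adjoint, t = 2b - 1 is within 2d of the symmetry 2p - 1, so t^2 is within 5d of
    1 and s = t (t^2)^(-1/2) is a symmetry in B; q = (1 + s)/2. The correction v has norm at most
    10d, and (2d + (1 + 2d) 10d)/2 <= 7d when d <= 1/32. *)
Lemma proj_near (B : set A) p b (d : R) : mxalg B -> star p = p -> p * p = p ->
  B b -> nm (p - b) <= d -> d <= 32^-1 ->
  exists q, [/\ B q, star q = q, q * q = q & nm (p - q) <= 7 * d].
Proof.
move=> hB sp pp Bb pb hd.
have [_ BD BZ _] := mxalg_csub hB; have BN x := csub_opp (x := x) (mxalg_csub hB).
have BM x y := mxalgM (x := x) (y := y) hB; have B1 := mxalg1 hB.
wlog sb : b Bb pb / star b = b.
  move=> H; apply: (H ((2^-1 : R)%:C *: (b + star b))).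
  - by apply: BZ; apply: BD => //; apply: mxalgS.
  - rewrite -{1}(half_add p) -scalerBr nmZR; last lra.
    rewrite opprD addrACA -[X in _ + (X - _)]sp -starB.
    by have := nmD (p - b) (star (p - b)); rewrite nm_star; lra.
  - by rewrite starZR starD starK addrC.
have d0 : 0 <= d by apply: le_trans pb; apply: nm_ge0.
pose r := p + p - 1; pose t := b + b - 1; pose x := 1 - t * t.
have rr : r * r = 1 := proj_symmetry pp.
have sr : star r = r by rewrite /r starB starD sp star1.
have nr : nm r = 1 by apply: unitary_nm; split; rewrite sr.
have nrt : nm (r - t) <= 2 * d.
  have -> : r - t = (p - b) + (p - b).
    by rewrite /r /t opprB addrA subrK opprD addrACA.
  by have := nmD (p - b) (p - b); lra.
have nt : nm t <= 1 + 2 * d by have := nm_le_add t r; rewrite nmBC; lra.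
have nx : nm x <= 5 * d.
  rewrite /x -rr; have := nm_mulB r r t t; rewrite nr.
  by have := nm_ge0 (r - t); have := nm_ge0 t; nra.
have st : star t = t by rewrite /t starB starD sb star1.
have sx : star x = x by rewrite /x starB starM st star1.
have [|v [nv sv gv ha]] := invsqrt_ex _ sx; first lra.
have [_ a1] := ha _ erefl; set a := 1 + v in a1.
have Bt : B t by apply: (BD (b + b) (-1)); [apply: (BD b b) | apply: BN].
have Bv : B v.
  by apply: gv => //; [exact: mxalg_csub | apply: BD => //; apply: BN; apply: BM].
have ct : t * a = a * t.
  rewrite /a mulrDr mulr1 (mulrDl 1 v t) mul1r; congr (_ + _).
  by apply: (gen_by_comm gv); rewrite /x mulrBr mulr1 (mulrBl t 1 (t * t)) mul1r mulrA.
pose s := t * a.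
have ss : s * s = 1.
  by rewrite -[RHS]a1 /x subKr {1}/s ct /s -!mulrA.
have s_s : star s = s by rewrite /s starM st /a starD star1 sv.
exists ((2^-1)%:C *: (1 + s)); split.
- by apply/BZ/BD => //; apply: BM => //; apply: BD.
- by rewrite starZR starD star1 s_s.
- rewrite -scalerAl -scalerAr mulrDl mul1r mulrDr mulr1 ss (addrC s 1).
  by rewrite half_add.
have -> : p = (2^-1 : R)%:C *: (1 + r) by rewrite /r addrC subrK half_add.
rewrite -scalerBr nmZR; last lra.
have -> : 1 + r - (1 + s) = (r - t) - t * v.
  by rewrite /s /a mulrDr mulr1 opprD addrACA subrr add0r opprD addrA.
have := nmB (r - t) (t * v); have := nmM t v.
by have := nm_ge0 v; have := nm_ge0 t; nra.
Qed.

Lemma proj_compare (B : set A) p q : mxalg B -> B p -> B q ->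
  star p = p -> p * p = p -> star q = q -> q * q = q ->
  exists y, (star y * y = p /\ q * y = y) \/ (star y * y = q /\ p * y = y).
Proof.
move=> hB; have [k [f [fM f0 fS fi [f1 <-]]]] := mxalgP hB.
move=> [P _ <-] [Q _ <-] sp pp sq qq.
have [||||Y hY] := @projmx_compare _ _ P Q.
- by apply: fi; rewrite fS.
- by apply: fi; rewrite fM.
- by apply: fi; rewrite fS.
- by apply: fi; rewrite fM.
exists (f Y); rewrite -fS -!fM.
by case: hY => -[-> ->]; [left | right].
Qed.

Definition intertwines (I : finType) (f g : I -> I -> A) w :=
  unitary w /\ forall i j, w * f i j = g i j * w.

Lemma intertwines_star (I : finType) (f g : I -> I -> A) w :
  intertwines f g w -> intertwines g f (star w).
Proof.
case=> uw h; split=> [|i j]; first exact: unitary_star.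
case: (uw) => w1 w2; rewrite -[LHS]mulr1 -w2 !mulrA -(mulrA _ _ w) -h.
by rewrite mulrA w1 mul1r.
Qed.

(** z is spread from the corner [i0] to the intertwiner w0, the sum of the [g i i0 * z * f i0 i].
    The defect of [star w0 * w0] from 1 sums [#|I|] terms, each at most 1/(2 #|I|), so it is at most
    1/2. As [star w0 * w0] commutes with f, the polar part of w0 still intertwines; it is an
    isometry, and unitary by finiteness. *)
Lemma near_isometry_intertwines (I : finType) (f g : I -> I -> A) i0 z :
  finite_cstar -> munits f -> \sum_i f i i = 1 -> munits g ->
  g i0 i0 * z = z -> z * f i0 i0 = z ->
  nm (f i0 i0 - star z * z) <= (2 * #|I|%:R)^-1 -> exists w, intertwines f g w.
Proof.
move=> fin fP f1 gP gz zf hz.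
pose w0 := \sum_i g i i0 * z * f i0 i.
have w0f i j : w0 * f i j = g i i0 * z * f i0 j.
  rewrite /w0 mulr_suml (@sum_only _ _ i) => [|k ki]; rewrite -mulrA.
    by rewrite mu_mulE.
  by rewrite mu_mul0// mulr0.
have gw0 i j : g i j * w0 = g i i0 * z * f i0 j.
  rewrite /w0 mulr_sumr (@sum_only _ _ j) => [|k kj]; rewrite !mulrA.
    by rewrite mu_mulE.
  by rewrite mu_mul0 ?mul0r// eq_sym.
have sw0 : star w0 = \sum_i f i i0 * star z * g i0 i.
  rewrite /w0 star_sum; apply: eq_bigr => i _.
  by rewrite !starM !mu_star// mulrA.
have ww : star w0 * w0 = \sum_i f i i0 * (star z * z) * f i0 i.
  rewrite sw0 mulr_suml; apply: eq_bigr => i _.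
  rewrite -mulrA gw0 !mulrA; congr (_ * _); rewrite -!mulrA gz; done.
pose x := 1 - star w0 * w0.
have xE : x = \sum_i f i i0 * (f i0 i0 - star z * z) * f i0 i.
  rewrite /x ww -f1 -sumrB; apply: eq_bigr => i _.
  by rewrite mulrBr mulrBl mu_mulE// mu_mulE.
have nI : 0 < #|I|%:R :> R by rewrite ltr0n; apply/card_gt0P; exists i0.
have nx : nm x <= 2^-1.
  rewrite xE (le_trans (nm_sum _ _ _))//.
  apply: (@le_trans _ _ (\sum_(i : I) (2 * #|I|%:R)^-1)).
    apply: ler_sum => i _; rewrite (le_trans (nmM3 _ _ _))//.
    by rewrite !mu_nm// mul1r mulr1.
  by rewrite sumr_const -[X in X <= _]mulr_natr -/(#|I|) invfM mulfVK// gt_eqF.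
have sx : star x = x by rewrite /x starB star1 starM starK.
have [v [nv sv gv ha]] := invsqrt_ex nx sx.
have [_ a1] := ha _ erefl; set a := 1 + v in a1.
have sa : star a = a by rewrite /a starD star1 sv.
have w0sf i j : star w0 * g i j = f i j * star w0.
  by rewrite -(mu_star gP) -starM gw0 -w0f starM mu_star.
have cf i j : f i j * a = a * f i j.
  rewrite /a mulrDl mulrDr mul1r mulr1; congr (_ + _).
  apply: (gen_by_comm gv); rewrite /x mulrBr mulrBl mulr1 mul1r; congr (_ - _).
  by rewrite -[RHS]mulrA w0f -gw0 !mulrA w0sf.
exists (w0 * a); split=> [|i j].
  apply: fin; rewrite starM sa mulrA -[RHS]a1; congr (_ * a).
  by rewrite -mulrA /x subKr.
by rewrite -mulrA -cf mulrA w0f -gw0 mulrA.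
Qed.

(* Murray-von Neumann comparison of [f i0 i0] and [g i0 i0] gives an isometry
   intertwining f and g in one direction, hence a unitary by finiteness. *)
Lemma uhf_intertwines (B : nat -> set A) (I : finType) (f g : I -> I -> A) n :
  uhf_chain B -> munits f -> \sum_i f i i = 1 -> B n = mspan f ->
  munits g -> \sum_i g i i = 1 -> exists w, intertwines f g w.
Proof.
move=> hc fP f1 Bf gP g1; have fin := uhf_finite hc.
have [i0 _] : exists i, f i i != 0 by case: fP.
have fi0 : B n (f i0 i0) by rewrite Bf; apply: mu_span.
have [hB mB hd] := hc.
set p := f i0 i0 in fi0; set p' := g i0 i0.
have sp : star p = p by rewrite mu_star. have pp : p * p = p by rewrite mu_mulE.
have sp' : star p' = p' by rewrite mu_star. have pp' : p' * p' = p' by rewrite mu_mulE.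
pose k : R := #|I|%:R.
have k1 : 1 <= k by rewrite ler1n; apply/card_gt0P; exists i0.
have [m [b [Bb pb]]] := hd p' (32 * k)^-1 ltac:(rewrite invr_gt0; lra).
have k32 : (32 * k)^-1 <= 32^-1 by rewrite lef_pV2 ?posrE; lra.
have [q [Bq sq qq pq]] := proj_near (hB _) sp' pp' Bb (ltW pb) k32.
have pq' : nm (p' - q) <= (2 * k)^-1.
  apply: (le_trans pq); rewrite -[X in X * _]invrK -invfM lef_pV2 ?posrE; last 2 first.
  - by lra.
  - by rewrite mulr_gt0//; lra.
  by lra.
have Bp' : B (maxn n m) p by apply: mB fi0; rewrite leq_maxl.
have Bq' : B (maxn n m) q by apply: mB Bq; rewrite leq_maxr.
have [y [[yy qy]|[yy py]]] := proj_compare (hB _) Bp' Bq' sp pp sq qq.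
  have yp := isometry_r yy sp pp; have ny := isometry_nm_le yy sp pp.
  apply: (@near_isometry_intertwines _ f g i0 (p' * y)) => //.
  - by rewrite -/p' mulrA pp'.
  - by rewrite -/p -mulrA yp.
  rewrite -/p starM sp' mulrA -(mulrA (star y) p' p') pp'.
  have -> : p - star y * p' * y = star y * (q - p') * y.
    by rewrite mulrBr mulrBl -(mulrA _ q) qy yy.
  rewrite (le_trans (nmM3 _ _ _))// nm_star nmBC.
  have := nm_ge0 y; have := nm_ge0 (p' - q); move: pq'; rewrite -/k.
  move: (nm y) (nm (p' - q)) ny => c e hc' h1 h2 h3.
  have : c * e <= e by rewrite ler_piMl.
  have : c * e * c <= c * e by rewrite ler_piMr// mulr_ge0.
  lra.
have np' := nm_proj_le1 sp' pp'.
(* Here q is the smaller projection, so the isometry runs from g to f; its adjoint is returned. *)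
have [w hw] : exists w, intertwines g f w.
  apply: (@near_isometry_intertwines _ g f i0 (y * p')) => //.
  - by rewrite -/p mulrA py.
  - by rewrite -/p' -mulrA pp'.
  rewrite -/p' starM sp' mulrA -(mulrA p' (star y) y) yy.
  have -> : p' - p' * q * p' = p' * (p' - q) * p' by rewrite mulrBr mulrBl !pp'.
  rewrite (le_trans (nmM3 _ _ _))//.
  have := nm_ge0 p'; have := nm_ge0 (p' - q); move: pq'; rewrite -/k.
  move: (nm p') (nm (p' - q)) np' => c e hc' h1 h2 h3.
  have : c * e <= e by rewrite ler_piMl.
  have : c * e * c <= c * e by rewrite ler_piMr// mulr_ge0.
  lra.
by exists (star w); apply: intertwines_star.
Qed.

End UHFUnitaries.

(** S0 o i maps [B n] to another unital copy of the same matrix algebra, and an inner automorphism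
    carries that copy back. The corrected isomorphism inverts i on [B n]. *)
Lemma uhf_fit_iso (R : realType) (A T : cstarType R) (B : nat -> set A) n
    (i : A -> T) (S0 : T -> A) : uhf_chain B -> star_hom i ->
  star_hom S0 -> bijective S0 ->
  exists S : T -> A, [/\ star_hom S, bijective S & forall x, B n x -> S (i x) = x].
Proof.
move=> hc ih sh bS; have [hB _ _] := hc.
have [I [f [fP f1 Bf]]] := hB n.
have [gP g1] := hom_munits (comp_hom sh ih) fP f1.
have [w [uw hw]] := uhf_intertwines hc fP f1 Bf gP g1.
have uw' := unitary_star uw.
exists (Ad (star w) \o S0); split.
- by apply: comp_hom => //; apply: Ad_hom.
- apply: bij_comp => //; exists (Ad w); first by move=> x; rewrite AdKV.
  by move=> x; rewrite AdK.
move=> x; rewrite Bf => -[c ->] /=.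
rewrite hom_mcomb// hom_mcomb// hom_mcomb; last exact: Ad_hom.
congr mcomb; apply/funext => a; apply/funext => b.
by rewrite /Ad starK -mulrA -hw /= mulrA; case: uw => -> _; rewrite mul1r.
Qed.

(** * Flip unitaries of almost invariant matrix algebras *)

Section Continuity.
Variables (R : realType) (A : cstarType R).
Implicit Types (f g : R -> A).

Lemma contM f g : continuous f -> continuous g -> continuous (fun t => f t * g t).
Proof.
move=> /continuousE hf /continuousE hg; apply/continuousE => t e e0.
have a0 := nm_ge0 (f t); have b0 := nm_ge0 (g t).
have c0 : 0 < nm (f t) + nm (g t) + 2 by lra.
pose d := Num.min 1 (e / (nm (f t) + nm (g t) + 2)).
have d0 : 0 < d by rewrite lt_min ltr01 divr_gt0.
have d1 : d <= 1 by rewrite ge_min lexx.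
have d2 : d * (nm (f t) + nm (g t) + 2) <= e.
  by rewrite -ler_pdivlMr// ge_min lexx orbT.
have [d3 d30 Hf] := hf t d d0; have [d4 d40 Hg] := hg t d d0.
exists (Num.min d3 d4) => [|s]; first by rewrite lt_min d30.
rewrite lt_min => /andP[/Hf h1 /Hg h2].
have h3 := nm_mulB (f s) (g s) (f t) (g t).
have h4 : nm (g s) <= nm (g t) + 1 by have := nm_le_add (g s) (g t); lra.
have h5 : nm (f s - f t) * nm (g s) <= d * (nm (g t) + 1).
  by apply: ler_pM => //; rewrite ?nm_ge0// ltW.
have h6 : nm (f t) * nm (g s - g t) <= nm (f t) * d by rewrite ler_wpM2l// ltW.
by lra.
Qed.

Lemma contD f g : continuous f -> continuous g -> continuous (fun t => f t + g t).
Proof. by move=> hf hg t; apply: cvgD; [apply: hf | apply: hg]. Qed.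

Lemma cont_cst (x : A) : continuous (fun _ : R => x).
Proof. by move=> t; apply: cvg_cst. Qed.

Lemma cont_sum I (r : seq I) (F : I -> R -> A) : (forall k, continuous (F k)) ->
  continuous (fun t => \sum_(k <- r) F k t).
Proof.
move=> h; elim: r => [|k r IH].
  by under eq_fun do rewrite big_nil; apply: cont_cst.
by under eq_fun do rewrite big_cons; apply: contD.
Qed.

Lemma cont_star f : continuous f -> continuous (fun t => star (f t)).
Proof.
move=> /continuousE h; apply/continuousE => t e /(h t)[d d0 H]; exists d => // s /H.
by rewrite -starB nm_star.
Qed.

Lemma cont_hom (B : cstarType R) (h : A -> B) f : star_hom h -> continuous f ->
  continuous (fun t => h (f t)).
Proof.
move=> hh /continuousE hf; apply/continuousE => t e /(hf t)[d d0 H].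
exists d => // s /H; apply: le_lt_trans.
by rewrite -(homB hh) hom_le.
Qed.

Lemma cont_nm f : continuous f -> continuous (fun t => nm (f t)).
Proof.
move=> /continuousE hf t; apply/cvgrPdist_lt => e /(hf t)[d d0 H].
apply/nbhs_ballP; exists d => //= s; rewrite /ball/= distrC => /H.
apply: le_lt_trans; rewrite ler_norml.
by have := nm_le_add (f s) (f t); have := nm_le_add (f t) (f s); rewrite (nmBC (f t)); lra.
Qed.

End Continuity.

(** Were g t > 1, the intermediate value theorem would produce a time between 0 and t at which g
    equals (c + 1)/2, inside the forbidden interval (c, 1]. *)
Lemma gap_path (R : realType) (g : R -> R) (c t : R) :
  continuous g -> g 0 = 0 -> 0 <= c -> c < 1 ->
  (forall s, `|s| <= 1 -> g s <= 1 -> g s <= c) -> `|t| <= 1 -> g t <= c.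
Proof.
move=> cg g0 c0 c1 gap t1; apply: (gap _ t1); rewrite leNgt; apply/negP => gt1.
pose v := (c + 1) / 2.
have [s hs gs] : exists2 s : R, `|s| <= 1 & g s = v.
  have hv : Num.min (g 0) (g t) <= v <= Num.max (g 0) (g t).
    by rewrite g0 ge_min le_max; apply/andP; split; apply/orP; [left|right]; rewrite /v; lra.
  have [t0|/ltW t0] := leP 0 t.
    have [s] := IVT t0 (continuous_subspaceT cg) hv.
    rewrite in_itv/= => /andP[s0 st] gs; exists s => //.
    by move: t1; rewrite !ger0_norm//; lra.
  rewrite minC maxC in hv.
  have [s] := IVT t0 (continuous_subspaceT cg) hv.
  rewrite in_itv/= => /andP[ts s0] gs; exists s => //.
  by move: t1; rewrite !ler0_norm//; lra.
have := gap s hs; rewrite gs /v => H.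
by have := H ltac:(lra); lra.
Qed.

(** * Averaging over the unitaries of a matrix algebra *)

Section Averaging.
Variables (R : realType) (A : cstarType R) (I : finType) (f : I -> I -> A).
Hypotheses (fP : munits f) (f1 : \sum_i f i i = 1).
Implicit Types (x y z : A) (s : {ffun I -> bool}).

Definition sgn s a : R[i] := (-1) ^+ (s a).

Lemma sgnM s a : sgn s a * sgn s a = 1.
Proof. by rewrite /sgn -expr2 sqrr_sign. Qed.

(** Changing the sign at a alone is an involution on sign vectors that negates every summand. *)
Lemma sum_sgn0 a b : a != b -> \sum_(s : {ffun I -> bool}) sgn s a * sgn s b = 0.
Proof.
move=> ab; pose phi s : {ffun I -> bool} := [ffun x => s x (+) (x == a)].
have phiK : involutive phi by move=> s; apply/ffunP => x; rewrite !ffunE addbK.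
set S := \sum_s _; have SN : S = - S.
  rewrite {1}/S (reindex_inj (inv_inj phiK)) -sumrN; apply: eq_bigr => s _.
  rewrite /sgn !ffunE eqxx eq_sym (negbTE ab) addbT addbF.
  by case: (s a); rewrite ?expr0 ?expr1 !(mulN1r, mul1r) ?opprK.
by apply/eqP; rewrite -eqNr -SN.
Qed.

(** Addition modulo the size of I. The permutations [sg c] form a Latin square, so for fixed a the
    index [sg c a] takes each value exactly once as c varies. *)
Lemma regular_action : exists sg : I -> I -> I,
  (forall c, bijective (sg c)) /\ (forall a, bijective (sg^~ a)).
Proof.
have [k kI] : exists k, #|I| = k.+1.
  case: fP => _ _ [i _]; exists #|I|.-1; rewrite prednK//.
  by apply/card_gt0P; exists i.
pose h (i : 'I_k.+1) : I := enum_val (cast_ord (esym kI) i).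
pose g (i : I) : 'I_k.+1 := cast_ord kI (enum_rank i).
have hK : cancel h g by move=> i; rewrite /g /h enum_valK cast_ordKV.
have gK : cancel g h by move=> i; rewrite /g /h cast_ordK enum_rankK.
exists (fun c a => h (g c + g a)); split=> c.
  exists (fun b => h (g b - g c)) => b; rewrite hK.
    by rewrite addrC addKr gK.
  by rewrite addrC subrK gK.
exists (fun b => h (g b - g c)) => b; rewrite hK ?addrK ?gK//.
by rewrite subrK gK.
Qed.

(** The conditional expectation onto the relative commutant of the matrix algebra spanned by f. *)
Definition avg y : A := (#|I|%:R^-1 : R)%:C *: \sum_a \sum_b f a b * y * f b a.

Lemma avg_comm y p q : f p q * avg y = avg y * f p q.
Proof.
rewrite /avg -scalerAr -scalerAl; congr (_ *: _).
rewrite mulr_sumr mulr_suml (@sum_only _ _ q) => [|a aq]; last first.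
  rewrite mulr_sumr big1// => b _; rewrite mulrA mulrA mu_mul0 ?mul0r//.
  by rewrite eq_sym.
transitivity (\sum_b f p b * y * f b q).
  by rewrite mulr_sumr; apply: eq_bigr => b _; rewrite !mulrA mu_mulE.
rewrite [RHS](@sum_only _ _ p) => [|a ap].
  by rewrite mulr_suml; apply: eq_bigr => b _; rewrite -[RHS]mulrA (mu_mulE fP).
rewrite mulr_suml big1// => b _.
by rewrite -(mulrA _ (f b a)) (mu_mul0 fP) ?mulr0.
Qed.

Lemma avg_comm_with y z : (forall a b, z * f a b = f a b * z) -> z * y = y * z ->
  z * avg y = avg y * z.
Proof.
move=> zf zy; rewrite /avg -scalerAr -scalerAl mulr_sumr mulr_suml; congr (_ *: _).
apply: eq_bigr => a _; rewrite mulr_sumr mulr_suml; apply: eq_bigr => b _.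
by rewrite !mulrA zf -(mulrA _ z y) zy -!mulrA zf.
Qed.

(* Signed permutations make [avg] an average over unitaries of the matrix algebra. *)
Lemma avg_unitaries : exists (J : finType) (W : J -> A),
  [/\ (0 < #|J|)%N, forall j, unitary (W j), forall j, mspan f (W j) &
    forall y, avg y = (#|J|%:R^-1 : R)%:C *: \sum_j Ad (W j) y].
Proof.
have [sg [sb1 sb2]] := regular_action.
pose W (j : I * {ffun I -> bool}) := \sum_a sgn j.2 a *: f (sg j.1 a) a.
have nI : (0 < #|I|)%N by case: fP => _ _ [i _]; apply/card_gt0P; exists i.
have Wst j : star (W j) = \sum_a sgn j.2 a *: f a (sg j.1 a).
  rewrite /W star_sum; apply: eq_bigr => a _.
  by rewrite starZ mu_star// /sgn rmorphXn/= rmorphN1.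
exists (I * {ffun I -> bool})%type, W; split.
- by rewrite card_prod muln_gt0 nI card_ffun card_bool expn_gt0.
- move=> [c s]; have [sgi sgK sgiK] := sb1 c; split; rewrite Wst/= /W/=.
    rewrite -[RHS]f1 mulr_suml; apply: eq_bigr => a _.
    rewrite mulr_sumr (@sum_only _ _ a) => [|b ba].
      rewrite -scalerAl -scalerAr scalerA.
    by rewrite sgnM scale1r mu_mulE.
    rewrite -scalerAl -scalerAr mu_mul0 ?scaler0//.
    by apply: contra_neq ba => /(can_inj sgK).
  rewrite -[RHS]f1 [RHS](reindex (sg c))/=; last by exists sgi => x _; rewrite ?sgK ?sgiK.
  rewrite mulr_suml; apply: eq_bigr => a _.
  rewrite mulr_sumr (@sum_only _ _ a) => [|b ba].
    by rewrite -scalerAl -scalerAr scalerA sgnM scale1r mu_mulE.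
  by rewrite -scalerAl -scalerAr mu_mul0 ?scaler0// eq_sym.
- move=> [c s]; apply: (csub_sum _ (csub_mspan fP)) => a _ /=.
  by case: (csub_mspan fP) => _ _ SZ _; apply: SZ; apply: mu_span.
move=> y; rewrite -(pair_bigA _ (fun c s => Ad (W (c, s)) y))/=.
have -> : \sum_c \sum_s Ad (W (c, s)) y =
    #|{ffun I -> bool}|%:R *: \sum_a \sum_b f a b * y * f b a.
  have E c s : Ad (W (c, s)) y =
      \sum_a \sum_b (sgn s a * sgn s b) *: (f (sg c a) a * y * f b (sg c b)).
    rewrite /Ad Wst /W/= mulr_suml mulr_suml; apply: eq_bigr => a _.
    rewrite mulr_sumr; apply: eq_bigr => b _.
    by rewrite -!scalerAl -scalerAr scalerA.
  (* Summing over the signs kills the terms with a != b; summing over c afterwards lets [sg c a] run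
     through all of I. *)
  have E2 c : \sum_s Ad (W (c, s)) y =
      #|{ffun I -> bool}|%:R *: \sum_a f (sg c a) a * y * f a (sg c a).
    under eq_bigr do rewrite E.
    rewrite exchange_big/= scaler_sumr; apply: eq_bigr => a _.
    rewrite exchange_big/= (@sum_only _ _ a) => [|b ba]; rewrite -scaler_suml.
      by under eq_bigr do rewrite sgnM; rewrite sumr_const.
    by rewrite sum_sgn0 ?scale0r// eq_sym.
  under eq_bigr do rewrite E2.
  rewrite -scaler_sumr; congr (_ *: _).
  rewrite exchange_big/= [RHS]exchange_big/=; apply: eq_bigr => a _.
  have [sgi sgK sgiK] := sb2 a.
  by rewrite [RHS](reindex (sg^~ a))//; exists sgi => x _; rewrite ?sgK ?sgiK.
rewrite /avg scalerA; congr (_ *: _).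
have n0 : #|{ffun I -> bool}|%:R != 0 :> R.
  by rewrite card_ffun card_bool pnatr_eq0 -lt0n expn_gt0.
rewrite -(rmorph_nat (real_complex R)) -rmorphM/= card_prod natrM invfM.
by rewrite -mulrA mulVf ?mulr1.
Qed.

Lemma avg_nm_le (b : R) y : (forall w, mspan f w -> unitary w -> nm (Ad w y) <= b) ->
  nm (avg y) <= b.
Proof.
have [J [W [J0 uW sW E]]] := avg_unitaries => h; rewrite E nmZR ?invr_ge0//.
have n0 : 0 < #|J|%:R :> R by rewrite ltr0n.
rewrite mulrC ler_pdivrMr// (le_trans (nm_sum _ _ _))//.
apply: (@le_trans _ _ (\sum_(j : J) b)); first by apply: ler_sum => j _; apply: h.
by rewrite sumr_const mulr_natr.
Qed.

(** [avg y - y] is a mean of terms [W, y] [star W] with W unitary in the span, so the bound on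
    commutators passes to it whatever the size of I. *)
Lemma avg_near (d : R) y :
  (forall x, mspan f x -> nm (x * y - y * x) <= d * nm x) -> nm (avg y - y) <= d.
Proof.
move=> h; have [J [W [J0 uW sW E]]] := avg_unitaries.
have n0 : 0 < #|J|%:R :> R by rewrite ltr0n.
have -> : avg y - y = (#|J|%:R^-1 : R)%:C *: \sum_j (Ad (W j) y - y).
  rewrite sumrB scalerBr -E; congr (_ - _).
  rewrite sumr_const -[y *+ _]scaler_nat scalerA -(rmorph_nat (real_complex R)) -rmorphM/=.
  by rewrite mulVf ?scale1r// gt_eqF.
rewrite nmZR ?invr_ge0// mulrC ler_pdivrMr// (le_trans (nm_sum _ _ _))//.
apply: (@le_trans _ _ (\sum_(j : J) d)); last by rewrite sumr_const mulr_natr.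
apply: ler_sum => j _; have -> : Ad (W j) y - y = (W j * y - y * W j) * star (W j).
  by rewrite /Ad mulrBl -(mulrA y); case: (uW j) => _ ->; rewrite mulr1.
rewrite nm_ur; last exact: unitary_star.
by rewrite (le_trans (h _ (sW j)))// unitary_nm// mulr1.
Qed.

Lemma avg_contract y : nm (avg y) <= nm y.
Proof. by apply: avg_nm_le => w _ uw; rewrite nm_Ad. Qed.

Lemma avgB y z : avg (y - z) = avg y - avg z.
Proof.
rewrite /avg -scalerBr -sumrB; congr (_ *: _); apply: eq_bigr => a _.
by rewrite -sumrB; apply: eq_bigr => b _; rewrite mulrBr mulrBl.
Qed.

End Averaging.

(** * The flip, its dimension-free estimates and its path under a flow *)

Section Flip.
Variables (R : realType) (A D : cstarType R) (i j : A -> D) (I : finType).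
Hypotheses (ih : star_hom i) (jh : star_hom j).
Hypothesis ij : forall a b, i a * j b = j b * i a.
Implicit Types (e : I -> I -> A).

(** The flip of the tensor square of a matrix algebra, with the two tensor factors realised by the
    commuting embeddings i and j. *)
Definition flip e : D := \sum_a \sum_b i (e a b) * j (e b a).

Lemma flip_star e : munits e -> star (flip e) = flip e.
Proof.
move=> eP; rewrite /flip star_sum [RHS]exchange_big/=; apply: eq_bigr => a _.
rewrite star_sum; apply: eq_bigr => b _.
by rewrite starM -!homS// !mu_star// ij.
Qed.

Lemma flip_mul_i0 e c d : munits e -> flip e * i (e c d) = \sum_a i (e a d) * j (e c a).
Proof.
move=> eP; rewrite /flip mulr_suml; apply: eq_bigr => a _.
rewrite mulr_suml (@sum_only _ _ c) => [|b bc].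
  by rewrite -mulrA -ij mulrA -homM// mu_mulE.
by rewrite -mulrA -ij mulrA -homM// mu_mul0// hom0// mul0r.
Qed.

Lemma flip_i e x : munits e -> mspan e x -> flip e * i x = j x * flip e.
Proof.
move=> eP [c ->]; rewrite (hom_mcomb _ _ ih) (hom_mcomb _ _ jh) /mcomb mulr_sumr mulr_suml.
apply: eq_bigr => p _; rewrite mulr_sumr mulr_suml; apply: eq_bigr => q _.
rewrite -scalerAr -scalerAl flip_mul_i0//; congr (_ *: _).
rewrite /flip mulr_sumr; apply: eq_bigr => a _.
rewrite mulr_sumr (@sum_only _ _ q) => [|b bq].
  by rewrite mulrA -ij -mulrA -homM// mu_mulE.
by rewrite mulrA -ij -mulrA -homM// mu_mul0 1?eq_sym// (hom0 jh) mulr0.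
Qed.

Lemma flip_j e x : munits e -> mspan e x -> flip e * j x = i x * flip e.
Proof.
move=> eP ex; have := flip_i eP (mspan_star eP ex) => /(congr1 (@star R D)).
by rewrite !starM flip_star// -!homS// !starK => ->.
Qed.

Lemma flip_sq e : munits e -> \sum_a e a a = 1 -> flip e * flip e = 1.
Proof.
move=> eP e1; rewrite {2}/flip mulr_sumr.
transitivity (\sum_a \sum_b i (e b b) * j (e a a)).
  apply: eq_bigr => a _; rewrite mulr_sumr; apply: eq_bigr => b _.
  rewrite mulrA flip_mul_i0// mulr_suml (@sum_only _ _ b) => [|c cb].
    by rewrite -mulrA -homM// mu_mulE.
  by rewrite -mulrA -homM// mu_mul0// hom0// mulr0.
under eq_bigr do rewrite -mulr_suml -hom_sum// e1 hom1// mul1r.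
by rewrite -hom_sum// e1 hom1.
Qed.

Lemma flip_unitary e : munits e -> \sum_a e a a = 1 -> unitary (flip e).
Proof. by move=> eP e1; split; rewrite flip_star// flip_sq. Qed.

End Flip.

Section FlipNear.
Variables (R : realType) (A D : cstarType R) (i j : A -> D) (I : finType).
Hypotheses (ih : star_hom i) (jh : star_hom j).
Hypothesis ij : forall a b, i a * j b = j b * i a.
Variables (e e' : I -> I -> A).
Hypotheses (eP : munits e) (e1 : \sum_a e a a = 1).
Hypotheses (eP' : munits e') (e1' : \sum_a e' a a = 1).
Variable d : R.
Hypothesis near : eps_subset d (mspan e) (mspan e').

Lemma nm_near x : mspan e x -> exists2 x', mspan e' x' & nm (x - x') <= d * nm x.
Proof.
by move=> /near[x' ex']; rewrite !nmE -rmorphM/= lecR => h; exists x'.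
Qed.

(** The flip of e' carries i to j on the span of e', and the flip of e carries j back to i on the
    span of e. Passing x through both requires one exchange with its approximant x' on each leg,
    each costing d. *)
Lemma flips_almost_comm_i x : mspan (fun a b => i (e a b)) x ->
  nm (x * (flip i j e * flip i j e') - flip i j e * flip i j e' * x) <= 2 * d * nm x.
Proof.
set F := flip i j e; set F' := flip i j e'; move=> [c ->].
have uF : unitary F by apply: flip_unitary.
have uF' : unitary F' by apply: flip_unitary.
have [ieP _] := hom_munits ih eP e1.
have := @munits_nm_le _ _ _ _ e (fun a b => i (e a b)) c eP ieP.
rewrite -hom_mcomb//; set x0 := mcomb e c => hx.
have ex : mspan e x0 by exists c.
have [x' ex' xx'] := nm_near ex.
have d0 : d * nm x0 <= d * nm (i x0).
  have [h|h] := leP 0 d; first by rewrite ler_wpM2l.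
  have := le_trans (nm_ge0 _) xx'; have := nm_ge0 x0; have := hom_le ih x0.
  by move=> h1 h2 h3; have -> : nm x0 = nm (i x0) by apply: le_anti; rewrite hx h1.
have -> : i x0 * (F * F') - F * F' * i x0 =
    - (F * F' * i (x0 - x') + F * j (x' - x0) * F').
  have e2 : F * F' * i x' = F * j x' * F' by rewrite -mulrA (flip_i ih jh ij eP' ex') mulrA.
  have e3 : F * j x0 * F' = i x0 * F * F' by rewrite (flip_j ih jh ij eP ex).
  rewrite (homB ih) (homB jh) !mulrBr mulrBl e2 e3 addrA subrK -mulrA opprB//.
  by rewrite (mulrA (i x0)).
rewrite nmN (le_trans (nmD _ _))// -mulrA nm_ul// nm_ul// nm_ur// nm_ul//.
have := hom_le ih (x0 - x'); have := hom_le jh (x' - x0); rewrite (nmBC x').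
by lra.
Qed.

End FlipNear.

Section FlipPath.
Variables (R : realType) (A D : cstarType R) (i j : A -> D) (I : finType).
Hypotheses (ih : star_hom i) (jh : star_hom j).
Hypothesis ij : forall a b, i a * j b = j b * i a.

Lemma flip_sym (e : I -> I -> A) : flip j i e = flip i j e.
Proof.
rewrite /flip exchange_big/=; apply: eq_bigr => a _; apply: eq_bigr => b _.
by rewrite ij.
Qed.

(** y almost commutes with both legs, so averaging over both gives y0 within 4d of y that commutes
    with F, the flip of e. Since F y F' = 1, the defect y^2 - 1 equals -[F, y] F', of norm at most 2
    * 4d. *)
Lemma flips_almost_invol (e e' : I -> I -> A) (d : R) :
  munits e -> \sum_a e a a = 1 -> munits e' -> \sum_a e' a a = 1 ->
  eps_subset d (mspan e) (mspan e') ->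
  nm (flip i j e * flip i j e' * (flip i j e * flip i j e') - 1) <= 8 * d.
Proof.
move=> eP e1 eP' e1' near; set y := flip i j e * flip i j e'.
have [ieP ie1] := hom_munits ih eP e1; have [jeP je1] := hom_munits jh eP e1.
set F := flip i j e in y *; set F' := flip i j e' in y *.
have uF : unitary F by apply: flip_unitary.
have FF : F * F = 1 by apply: flip_sq.
have FF' : F' * F' = 1 by apply: flip_sq.
have uF' : unitary F' by apply: flip_unitary.
pose yi := avg (fun a b => i (e a b)) y; pose yj := avg (fun a b => j (e a b)).
have hi : nm (yi - y) <= 2 * d.
  by apply: avg_near => // x; apply: flips_almost_comm_i.
have hj : nm (yj y - y) <= 2 * d.
  apply: avg_near => // x hx.
  have := @flips_almost_comm_i _ _ _ _ _ _ jh ih (fun a b => esym (ij b a)) _ _ eP e1 eP' e1' _ near x hx.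
  by rewrite !flip_sym.
pose y0 := yj yi.
have hy0 : nm (y - y0) <= 4 * d.
  have := nm_tri (yj y) y0 y; rewrite -avgB (nmBC y).
  by have := avg_contract jeP je1 (yi - y); rewrite -/(yj _) /y0; lra.
have cF : F * y0 = y0 * F.
  rewrite /F /flip mulr_suml mulr_sumr; apply: eq_bigr => a _.
  rewrite mulr_suml mulr_sumr; apply: eq_bigr => b _.
  rewrite -mulrA (avg_comm jeP).
  rewrite !mulrA; congr (_ * _).
  apply: avg_comm_with => [p q|]; first exact: ij.
  exact: avg_comm.
have -> : y * y - 1 = - ((F * y - y * F) * F').
  have FyF : F * y * F' = 1 by rewrite /y mulrA FF mul1r FF'.
  by rewrite mulrBl FyF opprB -(mulrA y).
rewrite nmN nm_ur//.
have -> : F * y - y * F = F * (y - y0) - (y - y0) * F.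
  by rewrite mulrBr mulrBl cF opprB addrA subrK.
have := nmB (F * (y - y0)) ((y - y0) * F); rewrite nm_ul// nm_ur//.
by lra.
Qed.

(* Along the path t |-> F F_t from 1, [nm (F F_t - 1)] never enters (8d, 1]. *)
Lemma flip_path_near (al : flow A) (e : I -> I -> A) (d : R) :
  munits e -> \sum_a e a a = 1 -> 0 <= d -> 8 * d < 1 ->
  (forall t : R, `|t| <= 1 -> eps_subset d (mspan e) (al t @` mspan e)) ->
  forall t : R, `|t| <= 1 ->
    nm (flip i j (fun a b => al t (e a b)) - flip i j e) <= 8 * d.
Proof.
move=> eP e1 d0 d1 near t t1.
have Hal s := hom_munits (flow_hom al s) eP e1.
pose F s := flip i j (fun a b => al s (e a b)).
have F0 : F 0 = flip i j e.
  by rewrite /F /flip; do 2 (apply: eq_bigr => ? _); rewrite !flow0.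
have uF : unitary (F 0) by rewrite F0; apply: flip_unitary.
have FF : F 0 * F 0 = 1 by rewrite F0; apply: flip_sq.
pose g s := nm (F 0 * F s - 1).
have gE s : g s = nm (F s - F 0).
  by rewrite /g -FF -mulrBr nm_ul.
have gap s : `|s| <= 1 -> g s <= 1 -> g s <= 8 * d.
  move=> s1 gs1; have [sP sQ] := Hal s.
  have sp : al s @` mspan e = mspan (fun a b => al s (e a b)).
    rewrite eqEsubset; split=> x /=.
      by case=> _ [c ->] <-; exists c; apply: hom_mcomb; apply: flow_hom.
    case=> c ->; exists (mcomb e c); first by exists c.
    by apply: hom_mcomb; apply: flow_hom.
  have ns := near s s1; rewrite sp in ns.
  have := flips_almost_invol eP e1 sP sQ ns; rewrite -F0 -/(F s) /=.
  set y := F 0 * F s => hy.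
  (* This identity gives 2 g <= 8d + g^2 for g = [g s], and g <= 1 turns it into g <= 8d. *)
  have yE : (y - 1) + (y - 1) = (y * y - 1) - (y - 1) * (y - 1).
    rewrite mulrBr mulr1 (mulrBl y y 1) mul1r opprB (opprB (y * y)) [RHS]addrCA.
    by congr (_ + _); rewrite addrC addrA subrK.
  have := nmB (y * y - 1) ((y - 1) * (y - 1)); rewrite -yE.
  have -> : nm (y - 1 + (y - 1)) = 2 * nm (y - 1).
    by rewrite -mulr2n -[_ *+ 2]scaler_nat -(rmorph_nat (real_complex R)) nmZR.
  have := nmM (y - 1) (y - 1); rewrite -/(g s).
  have : 0 <= g s by apply: nm_ge0.
  by nra.
have cg : continuous g.
  apply: cont_nm; apply: contD; last exact: cont_cst.
  apply: contM; first exact: cont_cst.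
  do 2 (apply: cont_sum => ?).
  by apply: contM; apply: cont_hom => //; apply: flow_continuous.
by rewrite -F0 -[X in nm (X - _)]/(F t) -gE; apply: gap_path => //; rewrite ?gE ?subrr ?nm0// mulr_ge0.
Qed.

End FlipPath.

(** * Exponentials *)

Section CauchyProduct.
Variable S : pzRingType.

(** Stated over a ring because it serves twice: for the exponential series in A and for the real
    series that dominates it. *)
Lemma cauchy_product (p q r : nat -> S) n :
  (forall k, r k = \sum_(i < k.+1) p i * q (k - i)%N) ->
  (\sum_(i < n) p i) * (\sum_(j < n) q j) - \sum_(k < n) r k =
  \sum_(i < n) \sum_(j < n | (n <= i + j)%N) p i * q j.
Proof.
move=> hr; have hk k : (k < n)%N ->
    r k = \sum_(i < n) \sum_(j < n | (i + j == k)%N) p i * q j.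
  move=> kn; rewrite hr (big_ord_widen n (fun i => p i * q (k - i)%N))//.
  rewrite big_mkcond/=; apply: eq_bigr => i _; case: ifPn => [ik|]; last first.
    rewrite -leqNgt => ki; rewrite big1// => j /eqP ijk.
    by move: ki; rewrite -ijk ltnNge leq_addr.
  have jn : (k - i < n)%N by rewrite (leq_ltn_trans _ kn)// leq_subr.
  rewrite (big_pred1 (Ordinal jn))// => j /=.
  apply/eqP/eqP => [e|->/=]; last by rewrite subnKC.
  by apply/val_inj; rewrite /= -e addKn.
under [X in _ - X]eq_bigr => k _ do rewrite hk//.
rewrite exchange_big/= mulr_suml -sumrB; apply: eq_bigr => i _.
rewrite mulr_sumr; under [X in _ - X]eq_bigr do rewrite big_mkcond/=.
rewrite exchange_big/= -sumrB [RHS]big_mkcond/=; apply: eq_bigr => j _.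
case: leqP => nij; first by rewrite big1 ?subr0// => k _; case: eqP => // e; move: nij; rewrite e leqNgt ltn_ord.
rewrite (@sum_only _ _ (Ordinal nij)) => [|k]; first by rewrite eqxx subrr.
by rewrite -val_eqE/= eq_sym => /negbTE->.
Qed.

End CauchyProduct.

Section Exponential.
Variables (R : realType).

Definition rexp_sum (a : R) n := \sum_(k < n) a ^+ k / k`!%:R.

Lemma rexp_sumE a n : rexp_sum a n = series (exp_coeff a) n.
Proof. by rewrite /rexp_sum seriesEord. Qed.

Lemma rexp_sum_le a n : 0 <= a -> rexp_sum a n <= expR a.
Proof.
move=> a0; rewrite rexp_sumE /expR; apply: nondecreasing_cvgn_le.
  apply/nondecreasing_seqP => k; rewrite -!rexp_sumE /rexp_sum big_ord_recr/=.
  by rewrite lerDl divr_ge0// exprn_ge0.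
exact: is_cvg_series_exp_coeff.
Qed.

Lemma rexp_sum_cvg a e : 0 < e -> exists N, forall n, (N <= n)%N -> `|rexp_sum a n - expR a| < e.
Proof.
move=> e0; have /cvgrPdist_lt/(_ e e0)[N _ HN] := @is_cvg_series_exp_coeff R a.
by exists N => n /HN /=; rewrite rexp_sumE distrC.
Qed.

Lemma rexp_sumD a b n : 0 <= a -> 0 <= b ->
  \sum_(i < n) \sum_(j < n | (n <= i + j)%N) (a ^+ i / i`!%:R) * (b ^+ j / j`!%:R) =
  rexp_sum a n * rexp_sum b n - rexp_sum (a + b) n.
Proof.
move=> a0 b0; rewrite -(@cauchy_product R (fun k => a ^+ k / k`!%:R)
  (fun k => b ^+ k / k`!%:R) (fun k => (a + b) ^+ k / k`!%:R))// => k.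
rewrite addrC exprDn mulr_suml; apply: eq_bigr => i _.
have ik : (i <= k)%N by rewrite -ltnS.
rewrite -(bin_fact ik) -mulr_natr !natrM; field.
rewrite !pnatr_eq0 -!lt0n !fact_gt0 bin_gt0 ik//.
Qed.

Variable A : cstarType R.
Implicit Types (x y z h : A).

Definition exp_sum x n : A := \sum_(k < n) (k`!%:R^-1 : R)%:C *: x ^+ k.

Lemma fact_ge0 k : 0 <= k`!%:R^-1 :> R.
Proof. by rewrite invr_ge0. Qed.

Lemma exp_term_le x k : nm ((k`!%:R^-1 : R)%:C *: x ^+ k) <= nm x ^+ k / k`!%:R.
Proof. by rewrite nmZR// mulrC ler_wpM2r// nmX. Qed.

Lemma exp_sum_dist x n m : (n <= m)%N ->
  nm (exp_sum x m - exp_sum x n) <= rexp_sum (nm x) m - rexp_sum (nm x) n.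
Proof.
move=> nm_; rewrite /exp_sum /rexp_sum.
rewrite -!(big_mkord xpredT (fun k => (k`!%:R^-1 : R)%:C *: x ^+ k)).
rewrite -!(big_mkord xpredT (fun k => nm x ^+ k / k`!%:R)).
rewrite (big_cat_nat (leq0n n) nm_)//= [X in X - _]addrC addrK.
rewrite [X in _ <= X - _](big_cat_nat (leq0n n) nm_)//= [X in _ <= X - _]addrC addrK.
by apply: (le_trans (nm_sum _ _ _)); apply: ler_sum => k _; apply: exp_term_le.
Qed.

Lemma exp_tends x : tends (exp_sum x) (cstar_exp x).
Proof.
have [l hl] : exists l, tends (exp_sum x) l.
  apply: cauchy_tends => e e0.
  have [N HN] := rexp_sum_cvg (nm x) (ltac:(lra) : 0 < e / 4).
  have H n m : (N <= n)%N -> (n <= m)%N -> nm (exp_sum x m - exp_sum x n) < e / 2.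
    move=> Nn nm_; have := exp_sum_dist x nm_.
    have := HN n Nn; have := HN m (leq_trans Nn nm_).
    by rewrite !ltr_norml => /andP[a1 a2] /andP[a3 a4]; lra.
  exists N => n m Nn Nm; have [h|/ltnW h] := leqP n m.
    by rewrite nmBC; have := H _ _ Nn h; lra.
  by have := H _ _ Nm h; lra.
suff -> : cstar_exp x = l by [].
have hl' : series (fun k => (k`!%:R^-1 : R[i]) *: x ^+ k) @ \oo --> l.
  have -> : series (fun k => (k`!%:R^-1 : R[i]) *: x ^+ k) = exp_sum x.
    apply/funext => n; rewrite seriesEord /exp_sum; apply: eq_bigr => k _.
    by rewrite fmorphV/= rmorph_nat.
  exact/cvg_tends.
exact: cvg_lim hl'.
Qed.

Lemma exp_mem (S : set A) x : csub S -> S 1 ->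
  (forall a b, S a -> S b -> S (a * b)) -> S x -> S (cstar_exp x).
Proof.
move=> cS S1 SM Sx; apply: (csub_tends cS _ (exp_tends x)) => n.
apply: csub_sum => // k _; case: (cS) => _ _ SZ _; apply: SZ.
by elim: (k : nat) => [|m IH]; rewrite ?expr0// exprS; apply: SM.
Qed.

Lemma exp0 : cstar_exp (0 : A) = 1.
Proof.
apply: (tends_unique (tends_shift 1 (exp_tends 0))).
apply: tends_ext (tends_cst 1) _ => n; rewrite addn1 /exp_sum big_ord_recl/= expr0.
rewrite fact0 invr1 scale1r big1 ?addr0// => k _.
by rewrite exprS mul0r scaler0.
Qed.

Lemma exp_star x : star (cstar_exp x) = cstar_exp (star x).
Proof.
apply: (tends_unique (tends_star (exp_tends x))).
apply: tends_ext (exp_tends _) _ => n; rewrite /exp_sum star_sum; apply: eq_bigr => k _.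
by rewrite starZR starX.
Qed.

(** The remainder of the Cauchy product in A is dominated term by term by the same remainder for the
    real exponentials of the norms, which tends to 0. *)
Lemma exp_sum_prod x y n : GRing.comm x y ->
  nm (exp_sum x n * exp_sum y n - exp_sum (x + y) n) <=
  rexp_sum (nm x) n * rexp_sum (nm y) n - rexp_sum (nm x + nm y) n.
Proof.
move=> cxy; rewrite -rexp_sumD ?nm_ge0// /exp_sum.
rewrite (@cauchy_product A (fun k => (k`!%:R^-1 : R)%:C *: x ^+ k)
  (fun k => (k`!%:R^-1 : R)%:C *: y ^+ k) (fun k => (k`!%:R^-1 : R)%:C *: (x + y) ^+ k)).
  apply: (le_trans (nm_sum _ _ _)); apply: ler_sum => i _.
  apply: (le_trans (nm_sum _ _ _)); apply: ler_sum => j _.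
  apply: (le_trans (nmM _ _)).
  by apply: ler_pM; rewrite ?nm_ge0//; apply: exp_term_le.
move=> k; rewrite addrC exprDn_comm; last exact: commr_sym.
rewrite scaler_sumr; apply: eq_bigr => i _.
have ik : (i <= k)%N by rewrite -ltnS.
rewrite -(commrX _ (commr_sym (commrX _ (commr_sym cxy)))).
rewrite -[X in _ *: X]scaler_nat -scalerAl -scalerAr !scalerA; congr (_ *: _).
rewrite -(rmorph_nat (real_complex R)) -!rmorphM/=; congr (_%:C).
rewrite -(bin_fact ik) !natrM; field.
by rewrite !pnatr_eq0 -!lt0n !fact_gt0 bin_gt0 ik.
Qed.

Lemma expD x y : GRing.comm x y -> cstar_exp (x + y) = cstar_exp x * cstar_exp y.
Proof.
move=> cxy; have t1 := tendsM (exp_tends x) (exp_tends y).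
apply: (tends_unique (exp_tends (x + y))) => e e0.
have a0 := nm_ge0 x; have b0 := nm_ge0 y.
set a := nm x in a0; set b := nm y in b0.
have ea := expR_gt0 a; have eb := expR_gt0 b.
pose d := Num.min 1 (e / (2 * (expR a + expR b + 2))).
have c0 : 0 < 2 * (expR a + expR b + 2) by lra.
have d0 : 0 < d by rewrite lt_min ltr01 divr_gt0.
have d2 : d * (2 * (expR a + expR b + 2)) <= e by rewrite -ler_pdivlMr// ge_min lexx orbT.
have [N1 H1] := t1 (e / 2) ltac:(lra).
have [N2 H2] := rexp_sum_cvg (a + b) d0.
exists (maxn N1 N2) => n; rewrite geq_max => /andP[n1 n2].
have := nm_tri (exp_sum x n * exp_sum y n) (exp_sum (x + y) n) (cstar_exp x * cstar_exp y).
have := H1 n n1; have := exp_sum_prod n cxy.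
rewrite (nmBC (exp_sum x n * exp_sum y n) (exp_sum (x + y) n)) -/a -/b.
have : rexp_sum a n * rexp_sum b n <= expR a * expR b.
  apply: ler_pM; rewrite ?rexp_sum_le//;
    by apply: sumr_ge0 => k _; rewrite divr_ge0// exprn_ge0.
rewrite -expRD; have := H2 n n2; rewrite ltr_norml => /andP[h1 h2] h3 h4 h5 h6.
have : d * 2 <= d * (2 * (expR a + expR b + 2)) by rewrite ler_wpM2l ?ltW//; lra.
by lra.
Qed.

Lemma expr_dist x y (M : R) k : nm x <= M -> nm y <= M ->
  nm (x ^+ k.+1 - y ^+ k.+1) <= k.+1%:R * M ^+ k * nm (x - y).
Proof.
move=> hx hy; have M0 : 0 <= M := le_trans (nm_ge0 _) hx.
elim: k => [|k IH]; first by rewrite !expr1 expr0 !mul1r.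
rewrite (exprS x) (exprS y); have := nm_mulB x (x ^+ k.+1) y (y ^+ k.+1).
have h1 : nm (x ^+ k.+1) <= M ^+ k.+1.
  by rewrite (le_trans (nmX _ _))// lerXn2r// ?nnegrE ?nm_ge0.
have h2 : nm (x - y) * nm (x ^+ k.+1) <= nm (x - y) * M ^+ k.+1 by rewrite ler_wpM2l ?nm_ge0.
have h3 : nm y * nm (x ^+ k.+1 - y ^+ k.+1) <= M * (k.+1%:R * M ^+ k * nm (x - y)).
  by apply: ler_pM; rewrite ?nm_ge0.
have e : k.+2%:R * M ^+ k.+1 * nm (x - y) =
    nm (x - y) * M ^+ k.+1 + M * (k.+1%:R * M ^+ k * nm (x - y)).
  by rewrite -(natr1 k.+1) exprS; ring.
by rewrite e; lra.
Qed.

Lemma exp_dist x y (M : R) : nm x <= M -> nm y <= M ->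
  nm (cstar_exp x - cstar_exp y) <= expR M * nm (x - y).
Proof.
move=> hx hy; have M0 : 0 <= M := le_trans (nm_ge0 _) hx.
have t1 : tends (fun n => exp_sum x (n + 1) - exp_sum y (n + 1)) (cstar_exp x - cstar_exp y).
  apply: tendsD; first exact/tends_shift/exp_tends.
  have := tendsZ (-1) (tends_shift 1 (exp_tends y)).
  by rewrite scaleN1r => h; apply: tends_ext h _ => n; rewrite scaleN1r.
apply: (tends_bound t1) => n; rewrite addn1 /exp_sum !big_ord_recl/= !expr0.
rewrite opprD addrACA subrr add0r -sumrB.
apply: (@le_trans _ _ (rexp_sum M n * nm (x - y))); last first.
  by rewrite ler_wpM2r ?nm_ge0// rexp_sum_le.
apply: (le_trans (nm_sum _ _ _)); rewrite /rexp_sum mulr_suml.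
apply: ler_sum => k _; rewrite -scalerBr nmZR// /bump/= add1n.
apply: (le_trans (ler_wpM2l (fact_ge0 _) (expr_dist k hx hy))).
rewrite factS natrM invfM le_eqVlt; apply/orP; left; apply/eqP.
have : (k.+1%:R : R) != 0 by rewrite pnatr_eq0.
have : (k`!%:R : R) != 0 by rewrite pnatr_eq0 -lt0n fact_gt0.
by move: (k.+1%:R : R) (k`!%:R : R) => p q q0 p0; field; rewrite p0 q0.
Qed.

Definition ug h (t : R) : A := cstar_exp (('i * t%:C) *: h).

Lemma ug0 h : ug h 0 = 1.
Proof. by rewrite /ug mulr0 scale0r exp0. Qed.

Lemma ugD h s t : ug h (s + t) = ug h s * ug h t.
Proof.
rewrite /ug rmorphD/= mulrDr scalerDl expD// /GRing.comm.
by rewrite -!scalerAl -!scalerAr !scalerA mulrC.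
Qed.

Lemma ug_star h t : star h = h -> star (ug h t) = ug h (- t).
Proof.
move=> sh; rewrite /ug exp_star starZ sh rmorphM/= conjCi conjR rmorphN/=.
by rewrite mulrN mulNr.
Qed.

Lemma ug_unitary h t : star h = h -> unitary (ug h t).
Proof. by move=> sh; split; rewrite ug_star// -ugD ?addNr ?subrr ug0. Qed.

Lemma cm_it (t : R) : cm ('i * t%:C) = `|t|.
Proof. by rewrite cmM cmR /cm normCi/= mul1r. Qed.

Lemma ug_dist h h' s t (M : R) : `|s| * nm h <= M -> `|t| * nm h' <= M ->
  nm (ug h s - ug h' t) <= expR M * nm (('i * s%:C) *: h - ('i * t%:C) *: h').
Proof. by move=> h1 h2; apply: exp_dist; rewrite nmZ cm_it. Qed.

Lemma ug_cont h : continuous (ug h).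
Proof.
apply/continuousE => t e e0; pose M := (`|t| + 1) * nm h.
have h0 := nm_ge0 h; have eM := expR_gt0 M.
have c0 : 0 < expR M * (nm h + 1) by rewrite mulr_gt0//; lra.
exists (Num.min 1 (e / (expR M * (nm h + 1)))) => [|s].
  by rewrite lt_min ltr01 divr_gt0.
rewrite lt_min ltr_pdivlMr// => /andP[s1 s2].
have hs : `|s| <= `|t| + 1 by have := ler_normD (s - t) t; rewrite subrK; lra.
apply: (le_lt_trans (@ug_dist h h s t M _ _)); rewrite ?ler_wpM2r//; first lra.
rewrite -scalerBl -mulrBr -rmorphB/= nmZ cm_it.
apply: le_lt_trans s2; rewrite mulrCA ler_wpM2l// ler_wpM2l ?ltW//; lra.
Qed.

Lemma ug_mem (S : set A) h t : csub S -> S 1 ->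
  (forall a b, S a -> S b -> S (a * b)) -> S h -> S (ug h t).
Proof. by move=> cS S1 SM Sh; apply: exp_mem => //; case: (cS) => _ _ SZ _; apply: SZ. Qed.

Lemma ug_near h (e : R) : 0 < e -> exists2 d : R, 0 < d & forall h', nm (h - h') < d ->
  forall t, `|t| <= 1 -> nm (ug h t - ug h' t) <= e.
Proof.
move=> e0; pose M := nm h + 1; have eM := expR_gt0 M; have h0 := nm_ge0 h.
exists (Num.min 1 (e / expR M)) => [|h']; first by rewrite lt_min ltr01 divr_gt0.
rewrite lt_min ltr_pdivlMr// => /andP[d1 d2] t t1.
have nh' : nm h' <= M by have := nm_le_add h' h; rewrite nmBC /M; lra.
have t0 : 0 <= `|t| by [].
apply: (le_trans (@ug_dist h h' t t M _ _)).
- by rewrite (le_trans (ler_piMl _ t1))// /M; lra.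
- by rewrite (le_trans (ler_piMl (nm_ge0 _) t1)).
rewrite -scalerBr nmZ cm_it mulrC; apply: le_trans (ltW d2).
by rewrite ler_wpM2r ?(ltW eM)// ler_piMl// nm_ge0.
Qed.

End Exponential.

(** * Closed spans *)

Section Spans.
Variable R : realType.

Definition bounded_linear (A B : cstarType R) (f : A -> B) := [/\
  forall x y, f (x + y) = f x + f y, forall c x, f (c *: x) = c *: f x &
  exists C : R, forall x, nm (f x) <= C * nm x].

(** Allows the induction principle [spanning] to be applied to one variable of a product at a
    time. *)
Lemma csub_preimage (A B : cstarType R) (f : A -> B) (S : set B) :
  bounded_linear f -> csub S -> csub [set x | S (f x)].
Proof.
move=> [fD fZ [C hC]] [S0 SD SZ Sc]; split=> /= [|x y hx hy|c x hx|x hx].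
- by rewrite -(scale0r (0 : A)) fZ scale0r.
- by rewrite fD; apply: SD.
- by rewrite fZ; apply: SZ.
- apply: Sc => e e0; have c0 : 0 < `|C| + 1 by have := normr_ge0 C; lra.
  have [y Sy xy] := hx (e / (`|C| + 1)) (divr_gt0 e0 c0).
  exists (f y) => //; have -> : f x - f y = f (x - y).
    by rewrite fD -[- y]scaleN1r fZ scaleN1r.
  apply: (le_lt_trans (hC _)); move: xy; rewrite ltr_pdivlMr//.
  have := nm_ge0 (x - y); have := ler_norm C.
  move: (nm (x - y)) (`|C|) => p q h1 p0 h2.
  have : C * p <= q * p by rewrite ler_wpM2r.
  by lra.
Qed.

Lemma bounded_linear_comp (A B C : cstarType R) (f : A -> B) (g : B -> C) :
  bounded_linear f -> bounded_linear g -> bounded_linear (g \o f).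
Proof.
move=> [fD fZ [C1 h1]] [gD gZ [C2 h2]]; split=> [x y|c x|] /=.
- by rewrite fD gD.
- by rewrite fZ gZ.
exists (`|C2| * `|C1|) => x; have c1 := normr_ge0 C1; have c2 := normr_ge0 C2.
have h3 := le_trans (h1 x) (ler_wpM2r (nm_ge0 x) (ler_norm C1)).
have h4 := le_trans (h2 (f x)) (ler_wpM2r (nm_ge0 (f x)) (ler_norm C2)).
by rewrite (le_trans h4)// -mulrA ler_wpM2l.
Qed.

Lemma bounded_linear_hom (A B : cstarType R) (f : A -> B) : star_hom f -> bounded_linear f.
Proof.
move=> fh; split=> [x y|c x|]; [exact: homD|exact: homZ|].
by exists 1 => x; rewrite mul1r hom_le.
Qed.

Lemma bounded_linear_mull (A : cstarType R) (a : A) : bounded_linear (fun x : A => a * x).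
Proof.
split=> [x y|c x|]; [exact: mulrDr|by rewrite scalerAr|].
by exists (nm a) => x; apply: nmM.
Qed.

Lemma bounded_linear_mulr (A : cstarType R) (a : A) : bounded_linear (fun x : A => x * a).
Proof.
split=> [x y|c x|]; [exact: mulrDl|by rewrite scalerAl|].
by exists (nm a) => x; rewrite mulrC nmM.
Qed.

Variable A : cstarType R.
Implicit Types (X Y V : set A).

Definition lin_space V :=
  [/\ V 0, forall x y, V x -> V y -> V (x + y) & forall c x, V x -> V (c *: x)].

Lemma csub_lin V : csub V -> lin_space V.
Proof. by case. Qed.

Lemma closure_csub V : lin_space V ->
  csub [set x | forall e : R, 0 < e -> exists2 y, V y & nm (x - y) < e].
Proof.
case=> V0 VD VZ; split=> /= [e e0|x y hx hy e e0|c x hx e e0|x hx e e0].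
- by exists 0 => //; rewrite subrr nm0.
- have [x' Vx' h1] := hx (e / 2) ltac:(lra); have [y' Vy' h2] := hy (e / 2) ltac:(lra).
  exists (x' + y'); first exact: VD.
  by rewrite opprD addrACA; have := nmD (x - x') (y - y'); lra.
- have c0 : 0 < cm c + 1 by have := cm_ge0 c; lra.
  have [y Vy h] := hx (e / (cm c + 1)) (divr_gt0 e0 c0).
  exists (c *: y); first exact: VZ.
  rewrite -scalerBr nmZ; move: h; rewrite ltr_pdivlMr//.
  by have := nm_ge0 (x - y); lra.
- have [y hy h1] := hx (e / 2) ltac:(lra); have [z Vz h2] := hy (e / 2) ltac:(lra).
  by exists z => //; have := nm_tri y x z; lra.
Qed.

Lemma incr_lin (V : nat -> set A) : (forall n, lin_space (V n)) ->
  (forall n m, (n <= m)%N -> V n `<=` V m) -> lin_space (\bigcup_n V n).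
Proof.
move=> lV mV; split.
- by exists 0%N => //; case: (lV 0%N).
- move=> x y [n _ Vx] [m _ Vy]; exists (maxn n m) => //.
  case: (lV (maxn n m)) => _ VD _; apply: VD.
    by apply: mV Vx; rewrite leq_maxl.
  by apply: mV Vy; rewrite leq_maxr.
- by move=> c x [n _ Vx]; exists n => //; case: (lV n) => _ _ VZ; apply: VZ.
Qed.

Lemma incr_dense (V : nat -> set A) (G : set A) : (forall n, lin_space (V n)) ->
  (forall n m, (n <= m)%N -> V n `<=` V m) -> spanning G ->
  (forall x, G x -> forall e : R, 0 < e -> exists n y, V n y /\ nm (x - y) < e) ->
  forall x e, 0 < e -> exists n y, V n y /\ nm (x - y) < e.
Proof.
move=> lV mV sG h x e e0.
have := sG _ (closure_csub (incr_lin lV mV)).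
case/(_ _ x e e0)=> [z Gz d d0|y [n _ Vy] xy]; last by exists n, y.
by have [n [y [Vy zy]]] := h z Gz d d0; exists y => //; exists n.
Qed.

Definition prodset X Y : set A := [set z | exists s : seq (A * A),
  (forall p, p \in s -> X p.1 /\ Y p.2) /\ z = \sum_(p <- s) p.1 * p.2].

Lemma prodsetM X Y x y : X x -> Y y -> prodset X Y (x * y).
Proof.
move=> Xx Yy; exists [:: (x, y)]; rewrite big_seq1; split=> // p.
by rewrite inE => /eqP->.
Qed.

Lemma prodset_lin X Y : lin_space X -> lin_space (prodset X Y).
Proof.
case=> _ _ XZ; split.
- by exists [::]; rewrite big_nil; split.
- move=> _ _ [s [hs ->]] [t [ht ->]]; exists (s ++ t); rewrite big_cat; split=> // p.
  by rewrite mem_cat => /orP[/hs|/ht].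
- move=> c _ [s [hs ->]]; exists [seq (c *: p.1, p.2) | p <- s]; split.
    by move=> _ /mapP[p /hs[Xp Yp] ->]; split=> //; apply: XZ.
  by rewrite big_map scaler_sumr; apply: eq_bigr => p _; rewrite scalerAl.
Qed.

Lemma prodset_sub X Y V : lin_space V -> (forall x y, X x -> Y y -> V (x * y)) ->
  prodset X Y `<=` V.
Proof.
case=> V0 VD _ h _ [s [hs ->]]; rewrite big_seq; apply: big_ind => // p /hs[].
exact: h.
Qed.

Lemma prodset_mono X Y X' Y' : X `<=` X' -> Y `<=` Y' -> prodset X Y `<=` prodset X' Y'.
Proof. by move=> hX hY _ [s [hs ->]]; exists s; split=> // p /hs[/hX ? /hY]. Qed.

Lemma mxalg_prodset X Y : mxalg X -> mxalg Y ->
  (forall x y, X x -> Y y -> x * y = y * x) -> mxalg (prodset X Y).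
Proof.
move=> mX mY cXY; have lX := csub_lin (mxalg_csub mX).
case: (mX) (mY) => I [e [eP e1 EX]] [J [f [fP f1 EY]]].
have Xe i j : X (e i j) by rewrite EX; apply: mu_span.
have Yf i j : Y (f i j) by rewrite EY; apply: mu_span.
pose g (p q : I * J) := e p.1 q.1 * f p.2 q.2.
have gP : munits g.
  split=> [[i j] [k l] [i' j'] [k' l']|[i j] [k l]|].
  - rewrite /g/= -mulrA (mulrA (f j l)) -(cXY _ _ (Xe _ _) (Yf _ _)) mulrA mulrA.
    rewrite -mulrA !mu_mul// xpair_eqE.
    by case: eqP => //= _; rewrite ?mul0r//; case: eqP => //; rewrite mulr0.
  - by rewrite /g/= starM !mu_star// -cXY.
  (* If [e i i * f j j] vanished, moving j to k with the units [f k j] and [f j k] would give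
     [e i i * f k k] = 0 for all k, and [e i i] = 0 after summation. *)
  - case: (eP) (fP) => _ _ [i i0] [_ _ [j j0]]; exists (i, j); rewrite /g/=.
    apply: contra_neq i0 => h; rewrite -[LHS]mulr1 -f1 mulr_sumr big1// => k _.
    rewrite -(mu_mulE fP k j k) -(mu_mulE fP j j k) mulrA.
    rewrite [e i i * f k j](cXY _ _ (Xe _ _) (Yf _ _)) -mulrA (mulrA (e i i)) h.
    by rewrite mul0r mulr0.
have g1 : \sum_p g p p = 1.
  rewrite -(pair_bigA _ (fun i j => e i i * f j j))/= -[RHS]e1.
  by apply: eq_bigr => i _; rewrite -mulr_sumr f1 mulr1.
exists (I * J)%type, g; split=> //.
have cg := csub_mspan gP; have [g0 gD gZ _] := cg.
rewrite eqEsubset; split.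
  apply: prodset_sub; first exact: csub_lin.
  rewrite EX EY => _ _ [c ->] [d ->]; rewrite /mcomb mulr_suml.
  apply: csub_sum => // i _; rewrite mulr_suml; apply: csub_sum => // j _.
  rewrite -scalerAl; apply: (gZ _ _); rewrite mulr_sumr; apply: csub_sum => // k _.
  rewrite mulr_sumr; apply: csub_sum => // l _; rewrite -scalerAr; apply: (gZ _ _).
  exact: (mu_span g (i, k) (j, l)).
move=> _ [c ->]; have [p0 pD pZ] := prodset_lin Y lX; rewrite /mcomb.
apply: big_ind => // p _; apply: big_ind => // q _; apply: pZ.
exact: prodsetM.
Qed.

Lemma mxalg_scalars : mxalg [set x : A | exists c : R[i], x = c *: 1].
Proof.
exists unit, (fun _ _ => 1); split.
- split=> [[] [] [] []|_ _|]; rewrite ?eqxx ?mulr1 ?star1//.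
  by exists tt; apply: oner_neq0.
- by rewrite (@sum_only _ _ tt)// => -[].
have E c : mcomb (fun _ _ : unit => 1 : A) c = c tt tt *: 1.
  by rewrite /mcomb (@sum_only _ _ tt) => [|[]]//; rewrite (@sum_only _ _ tt)// => -[].
rewrite eqEsubset; split=> [_ [c ->]|_ [c ->]] /=.
  by exists (fun _ _ => c); rewrite E.
by exists (c tt tt); rewrite E.
Qed.

(** Separability in the form that step-by-step constructions consume: increasing finite lists of
    matrix units of the algebras of the chain. *)
Lemma uhf_lists (B : nat -> set A) : uhf_chain B -> exists L : nat -> seq A,
  (forall n m, (n <= m)%N -> {subset L n <= L m}) /\
  spanning [set x | exists n, x \in L n].
Proof.
move=> hc; have [hB _ _] := hc.
have /choice[l hl] n : exists l : seq A, forall S, csub S -> (forall x, x \in l -> S x) -> B n `<=` S.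
  have [I [e [eP _ ->]]] := hB n; exists [seq e p.1 p.2 | p : I * I] => S cS h _ [c ->].
  apply: csub_sum => // i _; apply: csub_sum => // j _; case: (cS) => _ _ SZ _.
  by apply/SZ/h; apply/mapP; exists (i, j); rewrite // mem_enum.
exists (fun n => flatten [seq l k | k <- iota 0 n.+1]); split.
  move=> n m nm_ x /flatten_mapP[k]; rewrite mem_iota => /andP[_ kn] xk.
  apply/(@flatten_mapP _ A l); exists k => //; rewrite mem_iota/=.
  by rewrite add0n in kn *; apply: leq_trans kn _.
move=> S cS h; apply: (uhf_spanning hc) => // x [n _ Bx].
apply: (hl n) Bx => // y yl; apply: h; exists n.
by apply/(@flatten_mapP _ A l); exists n => //; rewrite mem_iota/= add0n ltnSn.
Qed.

End Spans.

Lemma mxalg_hom (R : realType) (A D : cstarType R) (f : A -> D) (B : set A) :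
  star_hom f -> mxalg B -> mxalg (f @` B).
Proof.
move=> fh [I [e [eP e1 ->]]]; have [fP f1] := hom_munits fh eP e1.
exists I, (fun i j => f (e i j)); split=> //.
rewrite eqEsubset; split=> [_ [_ [c ->] <-]|_ [c ->]] /=.
  by exists c; apply: hom_mcomb.
by exists (mcomb e c); [exists c | apply: hom_mcomb].
Qed.

(** * Commuting copies of a UHF algebra inside itself *)

Section TowerOfCopies.
Variables (R : realType) (A T : cstarType R) (B : nat -> set A).
Hypothesis hc : uhf_chain B.
Variables (tl tr : A -> T).
Hypotheses (tlh : star_hom tl) (trh : star_hom tr).
Hypothesis tlr : forall a b, tl a * tr b = tr b * tl a.
Hypothesis tsp : spanning [set x | exists a b, x = tl a * tr b].
Variable S0 : T -> A.
Hypotheses (S0h : star_hom S0) (S0b : bijective S0).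

(* A stage of the construction: [r] embeds the part of A not used yet, and [D m]
   is the matrix algebra generated by the copies of [B m] already chosen. *)
Definition stage_inv (st : (A -> A) * (nat -> set A)) := [/\ star_hom st.1,
  forall m, mxalg (st.2 m), forall n m, (n <= m)%N -> st.2 n `<=` st.2 m,
  forall m d a, st.2 m d -> d * st.1 a = st.1 a * d &
  spanning [set x | exists m d a, st.2 m d /\ x = d * st.1 a]].

Definition copy (st : (A -> A) * (nat -> set A)) (S : T -> A) (a : A) := st.1 (S (tl a)).

Definition next_stage (st : (A -> A) * (nat -> set A)) (S : T -> A) :=
  (fun a => st.1 (S (tr a)), fun m => prodset (st.2 m) (copy st S @` B m)).

Lemma copy_hom st S : stage_inv st -> star_hom S -> star_hom (copy st S).
Proof.
by move=> [rh _ _ _ _] Sh; apply: (comp_hom rh (comp_hom Sh tlh)).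
Qed.

Lemma copy_sub st S m x : stage_inv st -> star_hom S -> st.2 m x -> (next_stage st S).2 m x.
Proof.
move=> ist Sh Dx; rewrite -[x]mulr1 -(hom1 (copy_hom ist Sh)).
by apply: prodsetM => //; exists 1 => //; apply: mxalg1; case: hc.
Qed.

Lemma next_stage_inv st S : stage_inv st -> star_hom S -> bijective S ->
  stage_inv (next_stage st S).
Proof.
move=> ist Sh Sb; have ch := copy_hom ist Sh.
have [hB mB _] := hc; have [rh mD monoD cD spD] := ist; split => /=.
- exact: (comp_hom rh (comp_hom Sh trh)).
- move=> m; apply: mxalg_prodset => //; first exact: mxalg_hom.
  by move=> d _ Dd [b _ <-]; apply: cD Dd.
- move=> n m nm_; apply: prodset_mono; first exact: monoD.
  by move=> _ [b Bb <-]; exists b => //; apply: mB Bb.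
- move=> m d a Dd0; apply/esym.
  apply: (prodset_sub (csub_lin (csub_commutant (st.1 (S (tr a))))) _ Dd0).
  move=> {Dd0}d _ Dd [b _ <-] /=; apply/esym.
  rewrite -mulrA /copy -(homM rh) -(homM Sh) tlr (homM Sh) (homM rh) !mulrA.
  by congr (_ * _); apply: cD Dd.
- move=> V cV h; apply: (spD V cV) => _ [m [d [a [Dd ->]]]].
  have [t ->] : exists t, a = S t by case: Sb => S' SK S'K; exists (S' a).
  apply: (tsp (csub_preimage (bounded_linear_comp (bounded_linear_hom Sh)
    (bounded_linear_comp (bounded_linear_hom rh) (bounded_linear_mull d))) cV)).
  move=> _ [b [c ->]] /=.
  apply: (uhf_spanning hc (csub_preimage (bounded_linear_comp (bounded_linear_hom tlh)
    (bounded_linear_comp (bounded_linear_mulr (tr c)) (bounded_linear_comp (bounded_linear_hom Sh)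
    (bounded_linear_comp (bounded_linear_hom rh) (bounded_linear_mull d))))) cV)).
  move=> x [n _ Bx] /=; apply: h; exists (maxn n m), (d * copy st S x), c; split.
    apply: prodsetM; first by apply: monoD Dd; rewrite leq_maxr.
    by exists x => //; apply: mB Bx; rewrite leq_maxl.
  by rewrite (homM Sh) (homM rh) mulrA.
Qed.

Definition catches st S (l : seq A) (d : R) := forall x, x \in l ->
  exists M z, (next_stage st S).2 M z /\ nm (x - z) < d.

(** For M large, l lies near the algebra generated by [st.2 M] and the image under [st.1] of [B M].
    By [uhf_fit_iso], S can be taken inverse to [tl] on [B M]; the new copy of [B M] is then exactly
    that image, so the next stage already contains what l needs. *)
Lemma catches_ex st (l : seq A) (d : R) : stage_inv st -> 0 < d ->
  exists S, [/\ star_hom S, bijective S & catches st S l d].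
Proof.
move=> ist d0; have [hB mB _] := hc; have [rh mD monoD cD spD] := ist.
pose V m := prodset (st.2 m) (st.1 @` B m).
have mV m : mxalg (V m).
  apply: mxalg_prodset => //; first exact: mxalg_hom.
  by move=> x _ Dx [b _ <-]; apply: cD Dx.
have monoV n m : (n <= m)%N -> V n `<=` V m.
  move=> nm_; apply: prodset_mono; first exact: monoD.
  by move=> _ [b Bb <-]; exists b => //; apply: mB Bb.
have spV : spanning (\bigcup_m V m).
  move=> W cW h; apply: (spD W cW) => _ [m [x [a [Dx ->]]]].
  apply: (uhf_spanning hc (csub_preimage (bounded_linear_comp (bounded_linear_hom rh)
    (bounded_linear_mull x)) cW)) => y [n _ By] /=.
  apply: h; exists (maxn n m) => //; apply: prodsetM.
    by apply: monoD Dx; rewrite leq_maxr.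
  by exists y => //; apply: mB By; rewrite leq_maxl.
have dV x e : 0 < e -> exists n y, V n y /\ nm (x - y) < e.
  apply: (incr_dense (fun n => csub_lin (mxalg_csub (mV n))) monoV spV).
  by move=> z [n _ Vz] e' e'0; exists n, z; rewrite subrr nm0.
have [M HM] : exists M, forall x, x \in l -> exists z, V M z /\ nm (x - z) < d.
  elim: l => [|x l [M HM]]; first by exists 0%N.
  have [n [y [Vy xy]]] := dV x d d0.
  exists (maxn n M) => z; rewrite inE => /orP[/eqP->|/HM[w [Vw zw]]].
    by exists y; split=> //; apply: monoV Vy; rewrite leq_maxl.
  by exists w; split=> //; apply: monoV Vw; rewrite leq_maxr.
have [S [Sh Sb SE]] := uhf_fit_iso M hc tlh S0h S0b.
exists S; split=> // x /HM[z [Vz xz]]; exists M, z; split=> //.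
apply: prodset_mono Vz => // _ [b Bb <-]; exists b => //.
by rewrite /copy SE.
Qed.

Lemma tower_ex : exists (st : nat -> (A -> A) * (nat -> set A)) (S : nat -> T -> A),
  [/\ forall n, stage_inv (st n), forall n, star_hom (S n),
      forall n, st n.+1 = next_stage (st n) (S n),
      forall n, (st 0%N).2 n = [set x | exists c : R[i], x = c *: 1] &
      forall x (d : R), 0 < d -> exists n z, (st n).2 n z /\ nm (x - z) < d].
Proof.
have [L [monoL spL]] := uhf_lists hc.
(* A choice function must be total: [S0] is the default at pairs violating the invariant, which no
   stage of the tower does. *)
have /choice[G hG] (p : nat * ((A -> A) * (nat -> set A))) :
    exists S, stage_inv p.2 -> [/\ star_hom S, bijective S & catches p.2 S (L p.1) (2^-1 ^+ p.1)].
  have [ist|nist] := pselect (stage_inv p.2); last by exists S0.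
  by have [S hS] := catches_ex (L p.1) ist (exprn_gt0 p.1 (ltac:(lra) : 0 < 2^-1 :> R)); exists S.
pose st0 : (A -> A) * (nat -> set A) :=
  (id, fun=> [set x | exists c : R[i], x = c *: 1]).
have ist0 : stage_inv st0.
  split.
  - exact: id_hom.
  - by move=> m; exact: mxalg_scalars.
  - by move=> n m _ x.
  - move=> m _ a [c ->] /=; by rewrite -scalerAl -scalerAr mul1r mulr1.
  - move=> V cV h x; apply: h; exists 0%N, 1, x; rewrite mul1r; split=> //.
    by exists 1; rewrite scale1r.
pose st := fix st n := if n is n'.+1 then next_stage (st n') (G (n', st n')) else st0.
have ist n : stage_inv (st n).
  elim: n => [//|n IH] /=; have [Sh Sb _] := hG (n, st n) IH.
  exact: next_stage_inv.
have monoD n m k l : (n <= m)%N -> (k <= l)%N -> (st n).2 k `<=` (st m).2 l.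
  move=> nm_ kl x Dx; have : (st n).2 l x by have [_ _ mono _ _] := ist n; apply: mono Dx.
  rewrite -(subnK nm_); elim: (m - n)%N => [//|j IH] /IH h.
  by rewrite addSn /=; apply: copy_sub => //; have [] := hG ((j + n)%N, st (j + n)%N) (ist _).
exists st, (fun n => G (n, st n)); split=> //.
  by move=> n; have [] := hG (n, st n) (ist n).
apply: (@incr_dense _ _ (fun n => (st n).2 n) [set x | exists n, x \in L n]) => //.
- by move=> n; have [_ mD _ _ _] := ist n; apply/csub_lin/mxalg_csub.
- by move=> n m nm_; apply: monoD.
move=> x [k xk] d d0; have [N HN] := half_lt 1 d0.
have := HN (maxn k N) (leq_maxr _ _); rewrite mul1r => lt.
have [_ _ ca] := hG (maxn k N, st (maxn k N)) (ist _).
have [|M [z [Dz xz]]] := ca x; first by apply: (monoL k) xk; rewrite leq_maxl.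
exists (maxn (maxn k N).+1 M), z; split; last exact: lt_trans xz lt.
apply: (monoD (maxn k N).+1 _ M _ _ _ z) => //; first exact: leq_maxl.
exact: leq_maxr.
Qed.

End TowerOfCopies.

(** Homomorphisms are contractive, so pointwise convergence need only be checked on a spanning
    set. *)
Lemma csub_cauchy (R : realType) (A D : cstarType R) (F : nat -> A -> D) :
  (forall n, star_hom (F n)) -> csub [set x | is_cauchy (fun n => F n x)].
Proof.
move=> Fh; split=> /= [|x y hx hy|c x hx|x hx] e e0.
- by exists 0%N => n m _ _; rewrite !(hom0 (Fh _)) subrr nm0.
- have [N HN] := hx (e / 2) ltac:(lra); have [M HM] := hy (e / 2) ltac:(lra).
  exists (maxn N M) => n m; rewrite !geq_max => /andP[n1 n2] /andP[m1 m2].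
  rewrite !(homD (Fh _)) opprD addrACA.
  have := HN n m n1 m1; have := HM n m n2 m2.
  by have := nmD (F n x - F m x) (F n y - F m y); lra.
- have c0 : 0 < cm c + 1 by have := cm_ge0 c; lra.
  have [N HN] := hx (e / (cm c + 1)) (divr_gt0 e0 c0).
  exists N => n m n1 m1; rewrite !(homZ (Fh _)) -scalerBr nmZ.
  have := HN n m n1 m1; rewrite ltr_pdivlMr//.
  by have := nm_ge0 (F n x - F m x); lra.
- have [y hy xy] := hx (e / 4) ltac:(lra); have [N HN] := hy (e / 4) ltac:(lra).
  exists N => n m n1 m1; have := HN n m n1 m1.
  have := nm_tri (F n y) (F n x) (F m x); have := nm_tri (F m y) (F n y) (F m x).
  have := hom_le (Fh n) (x - y); have := hom_le (Fh m) (y - x).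
  by rewrite (homB (Fh n)) (homB (Fh m)) (nmBC y x); lra.
Qed.

Lemma lim_hom (R : realType) (A D : cstarType R) (F : nat -> A -> D) (f : A -> D) :
  (forall n, star_hom (F n)) -> (forall x, tends (fun n => F n x) (f x)) -> star_hom f.
Proof.
move=> Fh h; split=> [c x y||x y|x].
- apply: (tends_unique (h _)); apply: tends_ext (tendsD (tendsZ c (h x)) (h y)) _ => n.
  by rewrite (homD (Fh n)) (homZ (Fh n)).
- by apply: (tends_unique (h _)); apply: tends_ext (tends_cst 1) _ => n; rewrite hom1.
- apply: (tends_unique (h _)); apply: tends_ext (tendsM (h x) (h y)) _ => n.
  by rewrite (homM (Fh n)).
- apply: (tends_unique (h _)); apply: tends_ext (tends_star (h x)) _ => n.
  by rewrite (homS (Fh n)).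
Qed.

Lemma tends_eventually (R : realType) (A : cstarType R) (u : nat -> A) l N :
  (forall n, (N <= n)%N -> u n = l) -> tends u l.
Proof. by move=> h e e0; exists N => n /h->; rewrite subrr nm0. Qed.

Lemma csub_continuous (R : realType) (A D : cstarType R) (F : R -> A -> D) :
  (forall t, star_hom (F t)) -> csub [set x | continuous (F^~ x)].
Proof.
move=> Fh; split=> /= [|x y hx hy|c x hx|x hx].
- by under eq_fun do rewrite (hom0 (Fh _)); apply: cont_cst.
- by under eq_fun do rewrite (homD (Fh _)); apply: contD.
- under eq_fun do rewrite (homZ (Fh _)).
  by move=> t; apply: cvgZr; apply: hx.
- apply/continuousE => t e e0; have [y hy xy] := hx (e / 3) ltac:(lra).
  have /continuousE/(_ t (e / 3) ltac:(lra))[d d0 H] := hy.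
  exists d => // s /H h; have := nm_tri (F s y) (F s x) (F t x).
  have := nm_tri (F t y) (F s y) (F t x).
  have := hom_le (Fh s) (x - y); have := hom_le (Fh t) (y - x).
  by rewrite (homB (Fh s)) (homB (Fh t)) (nmBC y x); lra.
Qed.

(** * The UHF flow carried by the tower of copies *)

Section TowerFlow.
Variables (R : realType) (A T : cstarType R) (B : nat -> set A).
Hypothesis hc : uhf_chain B.
Variables (tl tr : A -> T).
Hypotheses (tlh : star_hom tl) (trh : star_hom tr).
Hypothesis tlr : forall a b, tl a * tr b = tr b * tl a.
Variables (st : nat -> (A -> A) * (nat -> set A)) (S : nat -> T -> A).
Hypothesis ist : forall n, stage_inv (st n).
Hypothesis Sh : forall n, star_hom (S n).
Hypothesis stS : forall n, st n.+1 = next_stage B tl tr (st n) (S n).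
Hypothesis st0 : forall m, (st 0%N).2 m = [set x | exists c : R[i], x = c *: 1].
Hypothesis stD : forall x (d : R), 0 < d -> exists n z, (st n).2 n z /\ nm (x - z) < d.
Variable h : nat -> A.
Hypotheses (hB : forall n, B n (h n)) (hS : forall n, star (h n) = h n).

Let rho n := copy tl (st n) (S n).
Let D n := (st n).2.

Lemma tower_copy_hom n : star_hom (rho n).
Proof. exact: copy_hom. Qed.

Lemma tower_mxalg n m : mxalg (D n m).
Proof. by have [_ h' _ _ _] := ist n; apply: h'. Qed.

Lemma tower_comm n m d a : D n m d -> d * rho n a = rho n a * d.
Proof. by have [_ _ _ h' _] := ist n; apply: h'. Qed.

Lemma tower_mono n m k l : (n <= m)%N -> (k <= l)%N -> D n k `<=` D m l.
Proof.
move=> nm_ kl x Dx; have : D n l x by have [_ _ mono _ _] := ist n; apply: mono Dx.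
rewrite -(subnK nm_); elim: (m - n)%N => [//|j IH] /IH h'.
by rewrite addSn /D stS; apply: copy_sub.
Qed.

Lemma tower_copy_mem n m b : B m b -> D n.+1 m (rho n b).
Proof.
move=> Bb; rewrite /D stS -[rho n b]mul1r; apply: prodsetM.
  exact: mxalg1 (tower_mxalg n m).
by exists b.
Qed.

(** Every element is close to some stage of the tower, and all later copies commute exactly with
    that stage. *)
Lemma tower_central x (e : R) : 0 < e -> exists N, forall n, (N <= n)%N ->
  forall a, nm (rho n a * x - x * rho n a) <= e * nm a.
Proof.
move=> e0; have [N [z [Dz xz]]] := stD x (ltac:(lra) : 0 < e / 2).
exists N => n Nn a; have Dz' : D n N z by apply: (tower_mono Nn (leqnn N)).
have -> : rho n a * x - x * rho n a = rho n a * (x - z) - (x - z) * rho n a.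
  by rewrite mulrBr mulrBl (tower_comm _ Dz') opprB addrA subrK.
have := nmB (rho n a * (x - z)) ((x - z) * rho n a).
have := nmM (rho n a) (x - z); have := nmM (x - z) (rho n a).
have := hom_le (tower_copy_hom n) a; have := nm_ge0 (x - z); have := nm_ge0 (rho n a).
move: xz; move: (nm (x - z)) (nm (rho n a)) (nm a) => p q r.
have := nm_ge0 a; move=> _ pe q0 p0 qr h1 h2 h3.
have : q * p <= r * (e / 2).
  by apply: ler_pM => //; apply: ltW.
by lra.
Qed.

(** The product over k < n of the unitaries e^{ith_k}, each placed in its own copy. The copies
    commute, so this is a one-parameter group that acts on the k-th copy as the inner flow of [h k],
    for all k < n at once. *)
Definition tower_u := fix u n t : A :=
  if n is n'.+1 then u n' t * rho n' (ug (h n') t) else 1.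

Lemma ug_chain n t : B n (ug (h n) t).
Proof.
have [mB _ _] := hc; apply: ug_mem; [exact: mxalg_csub|exact: mxalg1| |exact: hB].
by move=> a b; apply: mxalgM.
Qed.

Lemma tower_u_mem n t : D n n (tower_u n t).
Proof.
elim: n => [|n IH] /=; first exact: mxalg1 (tower_mxalg _ _).
apply: mxalgM; first exact: tower_mxalg.
  by apply: tower_mono IH.
apply: tower_copy_mem; have [_ mB _] := hc; apply: (mB n) => //.
exact: ug_chain.
Qed.

Lemma tower_u_unitary n t : unitary (tower_u n t).
Proof.
elim: n => [|n IH] /=; first exact: unitary1.
by apply: unitaryM => //; apply: (hom_unitary (tower_copy_hom n)); apply: ug_unitary.
Qed.

Lemma tower_uD n s t : tower_u n (s + t) = tower_u n s * tower_u n t.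
Proof.
elim: n => [|n IH] /=; first by rewrite mulr1.
rewrite IH ugD (homM (tower_copy_hom n)) -!mulrA; congr (_ * _); rewrite !mulrA.
by congr (_ * _); rewrite (tower_comm _ (tower_u_mem n t)).
Qed.

Lemma tower_u0 n : tower_u n 0 = 1.
Proof. by elim: n => [//|n IH] /=; rewrite IH ug0 (hom1 (tower_copy_hom n)) mulr1. Qed.

Lemma tower_u_cont n : continuous (tower_u n).
Proof.
elim: n => [|n IH] /=; first exact: cont_cst.
by apply: contM => //; apply: cont_hom; [exact: tower_copy_hom|exact: ug_cont].
Qed.

(** The factors added after stage n lie in copies commuting with [D n m]. The approximating flows
    are therefore eventually constant on a dense set, and their limit exists. *)
Lemma tower_Ad_const n m k x t : D n m x -> (n <= k)%N ->
  Ad (tower_u k t) x = Ad (tower_u n t) x.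
Proof.
move=> Dx nk; rewrite -(subnK nk); elim: (k - n)%N => [//|j IH].
rewrite addSn /= -Ad_Ad (Ad_comm (hom_unitary (tower_copy_hom _) (ug_unitary t (hS _)))) ?IH//.
apply/esym/(@tower_comm _ m); apply: (tower_mono _ (leqnn m)) Dx.
exact: leq_addl.
Qed.

Lemma tower_spanning : spanning [set x | exists n m, D n m x].
Proof.
move=> V cV H x; have [_ _ _ Vc] := cV; apply: Vc => e e0.
by have [n [z [Dz xz]]] := stD x e0; exists z => //; apply: H; exists n, n.
Qed.

Lemma tower_flow_ex : exists beta : flow A,
  (forall n m x t, D n m x -> beta t x = Ad (tower_u n t) x) /\
  forall n t a, beta t (rho n a) = rho n (Ad (ug (h n) t) a).
Proof.
have Uh n t : star_hom (Ad (tower_u n t)) by apply: Ad_hom; apply: tower_u_unitary.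
have hlim t x : exists y, tends (fun n => Ad (tower_u n t) x) y.
  apply: cauchy_tends; move: x.
  apply: (tower_spanning (csub_cauchy (fun n => Uh n t))) => x [n [m Dx]] e e0.
  exists n => k l nk nl; rewrite (tower_Ad_const _ Dx nk) (tower_Ad_const _ Dx nl).
  by rewrite subrr nm0.
have /choice[b hb] : forall t, exists f : A -> A, forall x,
    tends (fun n => Ad (tower_u n t) x) (f x).
  by move=> t; have [f hf] := choice (hlim t); exists f.
have bD n m x t : D n m x -> b t x = Ad (tower_u n t) x.
  move=> Dx; apply: (tends_unique (hb t x)); apply: (tends_eventually (N := n)) => k nk.
  exact: tower_Ad_const Dx nk.
have bh t : star_hom (b t) by apply: lim_hom (hb t).
have bDmem n x t : D n n x -> D n n (b t x).
  move=> Dx; rewrite (bD _ _ _ _ Dx) /Ad; have mD := tower_mxalg n n.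
  by apply: mxalgM => //; [apply: mxalgM => //|apply: mxalgS => //]; apply: tower_u_mem.
have bADD s t x : b (s + t) x = b s (b t x).
  move: x; apply: (hom_ext (bh _) (comp_hom (bh s) (bh t)) tower_spanning).
  move=> x [n [m Dx]]; have Dx' : D (maxn n m) (maxn n m) x.
    by apply: tower_mono Dx; rewrite ?leq_maxl ?leq_maxr.
  rewrite /= (bD _ _ _ s (bDmem _ _ t Dx')) !(bD _ _ _ _ Dx').
  by rewrite Ad_Ad tower_uD.
have b0 x : b 0 x = x.
  apply: (tends_unique (hb 0 x)); apply: tends_ext (tends_cst x) _ => n.
  by rewrite tower_u0 Ad_one.
have bbij t : bijective (b t).
  by exists (b (- t)) => x; rewrite -bADD ?addNr ?subrr b0.
have bcont x : continuous (fun t : R => b t x).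
  move: x; apply: (tower_spanning (csub_continuous bh)) => x [n [m Dx]] /=.
  under eq_fun do rewrite (bD _ _ _ _ Dx).
  apply: contM; last exact/cont_star/tower_u_cont.
  by apply: contM; [exact: tower_u_cont|exact: cont_cst].
exists (Flow bh bbij b0 bADD bcont); split=> //= n t.
apply: (hom_ext (comp_hom (bh t) (tower_copy_hom n))
  (comp_hom (tower_copy_hom n) (Ad_hom (ug_unitary t (hS n)))) (uhf_spanning hc)).
(* The n-th copy appears only at stage n + 1, where the last factor of the unitary acts on it as
   [h n] prescribes and the earlier factors commute with it. *)
move=> a [m _ Ba] /=; rewrite (bD _ _ _ _ (tower_copy_mem n Ba)) /= -Ad_Ad.
rewrite -(hom_Ad (tower_copy_hom n)) Ad_comm//; first exact: tower_u_unitary.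
exact: tower_comm (tower_u_mem n t).
Qed.

(** [D n n] contains the unitaries that implement the flow on it, hence is invariant; placing [h n]
    in [B n] is what puts them there. *)
Lemma tower_UHF_flow (beta : flow A) :
  (forall n m x t, D n m x -> beta t x = Ad (tower_u n t) x) -> UHF_flow beta.
Proof.
move=> bD; exists (fun n => D n n).
have bDmem n x t : D n n x -> D n n (beta t x).
  move=> Dx; rewrite (bD _ _ _ _ Dx) /Ad; have mD := tower_mxalg n n.
  by apply: mxalgM => //; [apply: mxalgM => //|apply: mxalgS => //]; apply: tower_u_mem.
split.
- by move=> n; apply/mxalg_full_matrix/tower_mxalg.
- by move=> n; apply: tower_mono.
- exact: mxalg1 (tower_mxalg _ _).
- rewrite -subTset => x _; apply/closure_epsP => e e0.
  by have [n [z [Dz xz]]] := stD x e0; exists z => //; exists n.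
- move=> n t; rewrite eqEsubset; split=> [_ [x Dx <-]|x Dx].
    exact: bDmem.
  exists (beta (- t) x); first exact: bDmem.
  by rewrite -flowD subrr flow0.
Qed.

End TowerFlow.

Lemma inner_flows_absorbing (R : realType) (A T : cstarType R) (B : nat -> set A)
    (tl tr : A -> T) (S0 : T -> A) (h : nat -> A) :
  uhf_chain B -> star_hom tl -> star_hom tr ->
  (forall a b, tl a * tr b = tr b * tl a) ->
  spanning [set x | exists a b, x = tl a * tr b] ->
  star_hom S0 -> bijective S0 ->
  (forall n, B n (h n)) -> (forall n, star (h n) = h n) ->
  exists (beta : flow A) (rho : nat -> A -> A),
    [/\ UHF_flow beta, forall n, star_hom (rho n),
        forall x (e : R), 0 < e -> exists N, forall n, (N <= n)%N ->
          forall a, nm (rho n a * x - x * rho n a) <= e * nm a &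
        forall n t a, beta t (rho n a) = rho n (Ad (ug (h n) t) a)].
Proof.
move=> hc tlh trh tlr tsp S0h S0b hB hS.
have [st [S [ist Sh stS st0 stD]]] := tower_ex hc tlh trh tlr tsp S0h S0b.
have [beta [b1 b2]] := tower_flow_ex hc tlh ist Sh stS stD hB hS.
exists beta, (fun n => copy tl (st n) (S n)); split=> //.
- exact: (tower_UHF_flow hc tlh ist Sh stS stD hB b1).
- by move=> n; apply: copy_hom.
- exact: (tower_central hc tlh ist Sh stS stD).
Qed.

(** * Uniform convergence of flows *)

Section UniformConvergence.
Variables (R : realType) (A : cstarType R) (phi : nat -> R -> A -> A) (al : flow A).
Hypothesis phih : forall n t, star_hom (phi n t).
Hypothesis phi0 : forall n x, phi n 0 x = x.
Hypothesis phiD : forall n s t x, phi n (s + t) x = phi n s (phi n t x).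
Hypothesis phic : forall n x, continuous (fun t => phi n t x).
Hypothesis phil : forall t x, tends (fun n => phi n t x) (al t x).

Lemma phi_nm n t x : nm (phi n t x) = nm x.
Proof.
apply: (can_hom_nm (phih n t) (phih n (- t))) => y.
by rewrite -phiD addNr phi0.
Qed.

(* Baire: some closed set [{t | forall n >= N, nm (phi n t x - al t x) <= e}] has
   an interior point a; compare times a + s and a. *)
Lemma phi_equicontinuous x (e : R) : 0 < e -> exists (N : nat) (d : R), 0 < d /\
  forall n s, (N <= n)%N -> `|s| < d -> nm (phi n s x - x) <= e.
Proof.
move=> e0; pose g n t := nm (phi n t x - al t x).
have gc n : continuous (g n).
  apply: cont_nm; apply: contD; first exact: phic.
  have -> : (fun t => - al t x) = (fun t => (-1 : R[i]) *: al t x).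
    by apply/funext => t; rewrite scaleN1r.
  by move=> t; apply: cvgZr; apply: flow_continuous.
pose F N : set R := \bigcup_(n in [set n | (N <= n)%N]) (g n @^-1` [set y | e / 3 < y]).
have oF N : open (F N).
  apply: bigcup_open => n _; apply: open_comp; last exact: open_gt.
  by move=> t _; apply: gc.
(* [F N] is the open set of times at which the estimate fails for some n >= N. If all of them were
   dense, a common point would contradict convergence at that time. *)
have [N [W [W0 oW WF]]] : exists N (W : set R), [/\ W !=set0, open W & W `&` F N = set0].
  apply: contrapT => H; have dF N : dense (F N).
    move=> W W0 oW; apply: contrapT => /set0P/negP; rewrite negbK => /eqP h.
    by apply: H; exists N, W.
  have := @Baire R R F (fun N => conj (oF N) (dF N)) setT (ex_intro _ 0 I) openT.
  case=> t [_ /= Ft]; have [N HN] := phil t x (ltac:(lra) : 0 < e / 3).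
  have [n /= Nn] := Ft N I; rewrite /g /= => h; have := HN n Nn; lra.
case: W0 => a Oa.
have Ole n s : (N <= n)%N -> W s -> g n s <= e / 3.
  move=> Nn Os; rewrite leNgt; apply/negP => h.
  have : (W `&` F N) s by split=> //; exists n.
  by rewrite WF.
have /nbhs_ballP[d1 /= d10 H1] : nbhs a W by apply: open_nbhs_nbhs.
have /continuousE/(_ a (e / 3) ltac:(lra))[d2 d20 H2] := @flow_continuous _ _ al x.
exists N, (Num.min d1 d2); split; first by rewrite lt_min d10.
move=> n s Nn; rewrite lt_min => /andP[s1 s2].
have -> : phi n s x - x = phi n (- a) (phi n (s + a) x - phi n a x).
  by rewrite (homB (phih _ _)) -!phiD addNr phi0 (addrC s) addKr.
rewrite phi_nm; have Oas : W (s + a).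
  by apply: H1; rewrite /ball/= opprD addrCA subrr addr0 normrN.
have := Ole n _ Nn Oas; have := Ole n _ Nn Oa.
have := H2 (s + a); rewrite addrK => /(_ s2).
have := nm_tri (al (s + a) x) (phi n (s + a) x) (phi n a x).
have := nm_tri (al a x) (al (s + a) x) (phi n a x).
by rewrite /g (nmBC (phi n a x)); lra.
Qed.

Lemma finite_max (P : nat -> nat -> Prop) M :
  (forall j, exists N, forall n, (N <= n)%N -> P j n) ->
  exists N, forall n j, (N <= n)%N -> (j <= M)%N -> P j n.
Proof.
move=> h; elim: M => [|M [N HN]].
  by have [N HN] := h 0%N; exists N => n j Nn; rewrite leqn0 => /eqP->; apply: HN.
have [K HK] := h M.+1; exists (maxn N K) => n j; rewrite geq_max => /andP[Nn Kn].
by rewrite leq_eqVlt => /orP[/eqP->|]; [apply: HK|apply: HN].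
Qed.

(** By the group law, equicontinuity at time 0 holds at every time with the same modulus;
    convergence on a finite grid of [-1, 1] then suffices. *)
Lemma phi_uniform x (e : R) : 0 < e -> exists N, forall n, (N <= n)%N ->
  forall t : R, `|t| <= 1 -> nm (phi n t x - al t x) <= e.
Proof.
move=> e0; have [N1 [d [d0 H1]]] := phi_equicontinuous x (ltac:(lra) : 0 < e / 3).
pose K := (Num.trunc d^-1).+1; have Kd : d^-1 < K%:R by rewrite truncnS_gt.
have K0 : 0 < K%:R :> R by rewrite ltr0n.
(* Grid of mesh 1/K < d starting at -1, with 2K steps; truncating (t + 1)K below gives the grid
   point just before t. *)
pose p j : R := j%:R / K%:R - 1.
have [N2 H2] : exists N, forall n j, (N <= n)%N -> (j <= 2 * K)%N ->
    nm (phi n (p j) x - al (p j) x) < e / 3.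
  apply: (@finite_max (fun j n => nm (phi n (p j) x - al (p j) x) < e / 3)) => j.
  by apply: phil; lra.
exists (maxn N1 N2) => n; rewrite geq_max => /andP[n1 n2] t t1.
have ht : forall m, (N1 <= m)%N -> forall s, `|s| < d -> nm (phi m s x - x) <= e / 3.
  by move=> m hm s; apply: H1.
have hal s : `|s| < d -> nm (al s x - x) <= e / 3.
  move=> sd; apply: (@tends_boundN _ _ (fun m => phi m s x - x) _ _ N1); last by move=> m hm; apply: H1.
  by apply: tendsD (phil s x) (tends_cst _).
have tp : 0 <= (t + 1) * K%:R 
  by apply: mulr_ge0; [move: t1; rewrite ler_norml => /andP[]; lra | exact: ltW].
pose j := Num.trunc ((t + 1) * K%:R).
have /andP[j1 j2] := truncn_itv tp; rewrite -/j in j1 j2.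
have jK : (j <= 2 * K)%N.
  rewrite -(ler_nat R) (le_trans j1)// natrM ler_wpM2r ?(ltW K0)//.
  by move: t1; rewrite ler_norml => /andP[]; lra.
have ts : `|t - p j| < d.
  have -> : t - p j = ((t + 1) * K%:R - j%:R) / K%:R by rewrite /p; field; lra.
  rewrite ger0_norm; last by rewrite divr_ge0 ?(ltW K0)// subr_ge0.
  rewrite ltr_pdivrMr//; move: j2; rewrite -natr1 => j2.
  have : 1 < d * K%:R by rewrite -ltr_pdivrMl// mulr1.
  by lra.
have et : t = p j + (t - p j) by rewrite addrC subrK.
have e1 : nm (phi n t x - phi n (p j) x) <= e / 3.
  by rewrite {1}et phiD -(homB (phih _ _)) phi_nm ht.
have e2 : nm (al t x - al (p j) x) <= e / 3.
  by rewrite {1}et flowD -(homB (flow_hom _ _)) flow_nm hal.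
have := nm_tri (phi n (p j) x) (phi n t x) (al t x).
have := nm_tri (al (p j) x) (phi n (p j) x) (al t x).
have := H2 n j n2 jK; rewrite (nmBC (al (p j) x)).
by lra.
Qed.

End UniformConvergence.

(** Each generator is replaced by a self-adjoint element of a matrix subalgebra whose unitary group
    is within 2^-n of the original on [-1, 1]. The chain is then reindexed so that the n-th
    generator lies in its n-th algebra. *)
Lemma adapted_generators (R : realType) (A : cstarType R) (B : nat -> set A) (al : flow A) :
  uhf_chain B -> approximately_inner al -> exists (B' : nat -> set A) (h : nat -> A),
    [/\ uhf_chain B', forall n, B' n (h n), forall n, star (h n) = h n &
        forall x (e : R), 0 < e -> exists N, forall n, (N <= n)%N ->
          forall t, `|t| <= 1 -> nm (Ad (ug (h n) t) x - al t x) <= e].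
Proof.
move=> [hB mB dB] [g [gS gl]].
have q0 n : 0 < 2^-1 ^+ n :> R by rewrite exprn_gt0// invr_gt0.
have /choice[hm Hhm] n : exists hm : A * nat, [/\ B hm.2 hm.1, star hm.1 = hm.1 &
    forall t, `|t| <= 1 -> nm (ug (g n) t - ug hm.1 t) <= 2^-1 ^+ n].
  have [d d0 Hd] := ug_near (g n) (q0 n); have [m [y [By gy]]] := dB (g n) d d0.
  have [_ BD BZ _] := mxalg_csub (hB m).
  exists ((2^-1 : R)%:C *: (y + star y), m); split=> /=.
  - by apply: BZ; apply: BD => //; apply: mxalgS.
  - by rewrite starZR starD starK addrC.
  - apply: Hd; rewrite -{1}(half_add (g n)) -scalerBr nmZR; last lra.
    rewrite opprD addrACA -[X in _ + (X - _)]gS -starB.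
    by have := nmD (g n - y) (star (g n - y)); rewrite nm_star; lra.
(* The sum makes M monotone and at least the index needed by the n-th generator; the added n makes
   it cofinal, so density survives. *)
pose M n := (\sum_(k < n.+1) (hm k).2 + n)%N.
have monoM n k : (n <= k)%N -> (M n <= M k)%N.
  move=> nk; rewrite /M leq_add// (big_ord_widen k.+1 (fun i => (hm i).2))//.
  by rewrite [X in (X <= _)%N]big_mkcond/= leq_sum// => i _; case: ifP.
exists (fun n => B (M n)), (fun n => (hm n).1); split.
- split=> [n|n k nk|x d d0]; first exact: hB.
    exact/mB/monoM.
  have [n [y [By xy]]] := dB x d d0; exists n, y; split=> //.
  by apply: mB By; rewrite /M leq_addl.
- move=> n; have [Bh _ _] := Hhm n; apply: mB Bh.
  by rewrite /M big_ord_recr/= -addnA addnCA leq_addr.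
- by move=> n; have [] := Hhm n.
move=> x e e0.
have [|||||N1 H1] := @phi_uniform _ _ (fun n t => Ad (ug (g n) t)) al _ _ _ _ _ x (e / 2) ltac:(lra).
- by move=> n t; apply: Ad_hom; apply: ug_unitary.
- by move=> n y; rewrite ug0 Ad_one.
- by move=> n s t y; rewrite Ad_Ad ugD.
- move=> n y; apply: contM; last exact/cont_star/ug_cont.
  by apply: contM; [exact: ug_cont|exact: cont_cst].
- by move=> t y; apply/cvg_tends; apply: gl.
have [N2 H2] := half_lt (2 * nm x) (ltac:(lra) : 0 < e / 2).
exists (maxn N1 N2) => n; rewrite geq_max => /andP[n1 n2] t t1.
have := H1 n n1 t t1; have [_ hS' Hn] := Hhm n.
have := Hn t t1; rewrite nmBC.
have := @nm_AdB _ _ (ug (hm n).1 t) (ug (g n) t) x.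
rewrite (unitary_nm (ug_unitary t hS')) (unitary_nm (ug_unitary t (gS n))) lexx.
move=> /(_ isT isT); have := H2 n n2; have := nm_ge0 x.
have := nm_tri (Ad (ug (g n) t) x) (Ad (ug (hm n).1 t) x) (al t x).
have := nm_ge0 (ug (hm n).1 t - ug (g n) t).
move: (nm (ug (hm n).1 t - _)) (nm x) (2^-1 ^+ n) => p q r p0 h1 q0' h2 h3 h4 h5.
have : p * q <= r * q by rewrite ler_wpM2r.
by lra.
Qed.

(** * Quasi-UHF flows *)

Section Generator.
Variables (R : realType) (A : cstarType R).
Implicit Types (s b : A) (w : seq bool).

Fixpoint word w s : A :=
  if w is c :: w' then (if c then s else star s) * word w' s else 1.

Lemma word_cat w1 w2 s : word (w1 ++ w2) s = word w1 s * word w2 s.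
Proof. by elim: w1 => [|c w IH] /=; rewrite ?mul1r// IH mulrA. Qed.

(** The empty word is excluded because C need not contain 1. *)
Lemma word_mem (C : set A) w s : (forall x y, C x -> C y -> C (x * y)) ->
  (forall x, C x -> C (star x)) -> C s -> w != [::] -> C (word w s).
Proof.
move=> CM CS Cs; case: w => [//|c w] _; elim: w c => [|d w IH] c.
  by rewrite /= mulr1; case: c => //; apply: CS.
by rewrite [word _ _]/=; apply: CM; [case: c => //; apply: CS | apply: IH].
Qed.

Lemma word_continuous w s (e : R) : 0 < e -> exists2 d : R, 0 < d &
  forall b, nm (s - b) < d -> nm (word w s - word w b) < e.
Proof.
elim: w e => [|c w IH] e e0; first by exists 1 => // b _; rewrite subrr nm0.
have s0 := nm_ge0 s; pose K := nm (word w s); have K0 : 0 <= K := nm_ge0 _.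
have c0 : 0 < nm s + K + 2 by lra.
pose d := Num.min 1 (e / (nm s + K + 2)).
have d0 : 0 < d by rewrite lt_min ltr01 divr_gt0.
have d1 : d <= 1 by rewrite ge_min lexx.
have d2 : d * (nm s + K + 2) <= e by rewrite -ler_pdivlMr// ge_min lexx orbT.
have [d3 d30 H] := IH d d0; exists (Num.min d d3) => [|b]; first by rewrite lt_min d0.
rewrite lt_min => /andP[h1 /H h2] /=.
set s' := if c then s else star s; set b' := if c then b else star b.
have h3 : nm (s' - b') < d by rewrite /s' /b'; case: (c); rewrite -?starB ?nm_star.
have h4 : nm b' <= nm s + 1.
  have -> : nm b' = nm b by rewrite /b'; case: (c); rewrite ?nm_star.
  by have := nm_le_add b s; rewrite nmBC; lra.
have := nm_mulB s' (word w s) b' (word w b).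
have : nm (s' - b') * K <= d * K by rewrite ler_wpM2r// ltW.
have : nm b' * nm (word w s - word w b) <= (nm s + 1) * d.
  by apply: ler_pM; rewrite ?nm_ge0// ltW.
by rewrite -/K; lra.
Qed.

(** s is the nilpotent shift. Its highest nonzero power is the corner unit from the first to the
    last index, and powers of [star s] on the left and on the right move that corner to any
    position. *)
Lemma shift_words k (e : 'I_k.+1 -> 'I_k.+1 -> A) : munits e -> \sum_i e i i = 1 ->
  exists s, forall i j, exists2 w, w != [::] & e i j = word w s.
Proof.
move=> eP e1; case: k e eP e1 => [|k] e eP e1.
  (* In size one the shift is zero, so the single unit itself serves as generator. *)
  by exists (e 0 0) => i j; exists [:: true] => //=; rewrite mulr1 !ord1.
pose E i j := e (inord i) (inord j) : A.
have EM i j l : E i j * E j l = E i l by rewrite /E mu_mulE.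
have EM0 i j j' l : (j <= k.+1)%N -> (j' <= k.+1)%N -> j != j' -> E i j * E j' l = 0.
  move=> hj hj' jj; rewrite /E mu_mul0//; apply: contra_neq jj => /(congr1 val) /=.
  by rewrite !inordK.
pose s := \sum_(i < k.+1) E i i.+1.
have sE j l : (j <= k)%N -> s * E j.+1 l = E j l.
  move=> jk; rewrite /s mulr_suml (@sum_only _ _ (Ordinal (jk : (j < k.+1)%N)))/=.
    by rewrite EM.
  by move=> i ij; have ik := ltn_ord i; rewrite EM0.
have sE0 l : s * E 0%N l = 0.
  by rewrite /s mulr_suml big1// => i _; have ik := ltn_ord i; rewrite EM0.
have ES i j : star (E i j) = E j i by rewrite /E mu_star.
have ssE i l : (i <= k)%N -> star s * E i l = E i.+1 l.
  move=> ik; rewrite /s star_sum mulr_suml (@sum_only _ _ (Ordinal (ik : (i < k.+1)%N)))/=.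
    by rewrite ES EM.
  move=> j ji; have jk := ltn_ord j; rewrite ES EM0//; [exact: ltnW|exact: leqW].
have spE p j l : (j + p <= k.+1)%N -> s ^+ p * E (j + p)%N l = E j l.
  elim: p => [|p IH] h; first by rewrite mul1r addn0.
  rewrite addnS in h *; rewrite exprSr -mulrA sE// IH//.
  exact: ltnW.
have spE0 p l : s ^+ p.+1 * E 0%N l = 0 by rewrite exprSr -mulrA sE0 mulr0.
have lowE i l : (i < k.+1)%N -> s ^+ k.+1 * E i l = 0.
  move=> ik; have -> : s ^+ k.+1 = s ^+ (k - i).+1 * s ^+ i by rewrite -exprD addSn subnK.
  by have := @spE i 0%N l; rewrite add0n -mulrA => ->; rewrite ?spE0// ltnW.
have sK : s ^+ k.+1 = E 0%N k.+1.
  rewrite -[LHS]mulr1 -e1 mulr_sumr (@sum_only _ _ ord_max) => [|j jk].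
    by have := @spE k.+1 0%N k.+1 (leqnn _); rewrite add0n /E (_ : inord k.+1 = ord_max)//; apply/val_inj; rewrite /= inordK.
  have jk' : (j < k.+1)%N.
    by rewrite ltn_neqAle -ltnS ltn_ord andbT; apply: contra_neq jk => h; apply/val_inj.
  by rewrite (_ : e j j = E j j) ?lowE// /E inord_val.
have sspE i l : (i <= k.+1)%N -> star s ^+ i * E 0%N l = E i l.
  elim: i => [|i IH] h; first by rewrite mul1r.
  by rewrite exprS -mulrA IH ?ssE// ltnW.
have wn n c : word (nseq n c) s = (if c then s else star s) ^+ n.
  by elim: n => [//|n IH] /=; rewrite IH exprS.
exists s => i j; exists (nseq i false ++ nseq k.+1 true ++ nseq (k.+1 - j) false).
  by case: (i : nat).
have ik : (i <= k.+1)%N by rewrite -ltnS ltn_ord.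
have jk : (j <= k.+1)%N by rewrite -ltnS ltn_ord.
have Ej : E 0%N k.+1 * star s ^+ (k.+1 - j) = E 0%N j.
  rewrite -(ES k.+1) -starX -starM.
  by have := @spE (k.+1 - j)%N j 0%N; rewrite subnKC// => -> //; rewrite ES.
by rewrite !word_cat !wn sK Ej sspE// /E !inord_val.
Qed.

(** Matrix units are words in one generator s, and words are continuous, so a closed *-subalgebra
    with an element near s nearly contains B. Since s is chosen before d, the same s can be used for
    a fixed tolerance and for arbitrarily small ones. *)
Lemma mxalg_generator (B : set A) : mxalg B -> exists s, forall d : R, 0 < d ->
  exists2 r : R, 0 < r & forall (C : set A) b, csub C ->
    (forall x y, C x -> C y -> C (x * y)) -> (forall x, C x -> C (star x)) ->
    C b -> nm (s - b) < r ->
    forall x, B x -> exists2 y, C y & nm (x - y) <= d * nm x.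
Proof.
move=> hB; have [k [e [eP BE]]] := full_matrix_munits (mxalg_full_matrix hB).
have e1 : \sum_i e i i = 1.
  by have := mxalg1 hB; rewrite BE => B1; rewrite -[LHS]mulr1 mu_unit_l.
have [s hs] := shift_words eP e1; exists s => d d0; pose N : R := #|{: 'I_k.+1 * 'I_k.+1}|%:R.
have N0 : 0 < N by rewrite ltr0n card_prod card_ord.
have /choice[w hw] (p : 'I_k.+1 * 'I_k.+1) : exists w, w != [::] /\ e p.1 p.2 = word w s.
  by have [w w0 h] := hs p.1 p.2; exists w.
have /choice[r hr] (p : 'I_k.+1 * 'I_k.+1) : exists r : R, 0 < r /\
    forall b, nm (s - b) < r -> nm (word (w p) s - word (w p) b) < d / N.
  by have [r r0 h] := @word_continuous (w p) s (d / N) (divr_gt0 d0 N0); exists r.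
exists (\big[Num.min/1]_p r p).
  by apply: lt_bigmin => // p _; have [] := hr p.
move=> C b cC CM CS Cb sb x; rewrite BE => -[c ->].
exists (\sum_i \sum_j c i j *: word (w (i, j)) b).
  apply: csub_sum => // i _; apply: csub_sum => // j _; case: (cC) => _ _ CZ _.
  by apply: CZ; apply: word_mem => //; have [] := hw (i, j).
rewrite /mcomb -sumrB; apply: (le_trans (nm_sum _ _ _)).
apply: (@le_trans _ _ (\sum_(i < k.+1) \sum_(j < k.+1) (nm (mcomb e c) * (d / N)))).
  apply: ler_sum => i _; rewrite -sumrB; apply: (le_trans (nm_sum _ _ _)).
  apply: ler_sum => j _; rewrite -scalerBr nmZ; have [_ ->] := hw (i, j).
  apply: ler_pM; rewrite ?cm_ge0 ?nm_ge0//; first exact: mcoef_le.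
  apply/ltW; have [_] := hr (i, j); apply; apply: lt_le_trans sb _.
  exact: bigmin_le.
rewrite !sumr_const !card_ord -[X in X <= _]mulr_natr -[X in X * _ <= _]mulr_natr.
rewrite /N card_prod !card_ord natrM le_eqVlt; apply/orP; left; apply/eqP.
have : (k.+1%:R : R) != 0 by rewrite pnatr_eq0.
by move: (k.+1%:R : R) => K K0; field.
Qed.

End Generator.

Lemma proj_small_0 (R : realType) (A : cstarType R) (p : A) :
  star p = p -> p * p = p -> nm p < 1 -> p = 0.
Proof.
move=> sp pp h; apply: contrapT => /eqP p0; have := nm_proj1 sp pp p0; lra.
Qed.

(** If p is the unit of C, then p y = y and 1 - p = (1 - p)(1 - y) is a projection of norm less than
    1, hence 0. This recovers unitality of those subalgebras of a quasi-UHF sequence that nearly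
    contain 1. *)
Lemma full_matrix_near1 (R : realType) (A : cstarType R) (C : set A) y :
  full_matrix_subalgebra C -> C y -> nm (1 - y) < 1 -> mxalg C.
Proof.
move=> fC Cy y1; have [k [e [eP CE]]] := full_matrix_munits fC.
exists 'I_k.+1, e; split=> //; rewrite CE in Cy.
set p := \sum_i e i i; have sp : star p = p := mu_unit_star eP.
have pp : p * p = p := mu_unit_l eP (mspan_unit e).
apply/esym/eqP; rewrite -subr_eq0; apply/eqP; apply: proj_small_0.
- by rewrite starB star1 sp.
- by rewrite mulrBl mul1r mulrBr mulr1 pp subrr subr0.
have sq : star (1 - p) = 1 - p by rewrite starB star1 sp.
have qq : (1 - p) * (1 - p) = 1 - p by rewrite mulrBl mul1r mulrBr mulr1 pp subrr subr0.
have -> : 1 - p = (1 - p) * (1 - y).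
  by rewrite mulrBr mulr1 mulrBl mul1r (mu_unit_l eP Cy) subrr subr0.
apply: (le_lt_trans (nmM _ _)); have := nm_proj_le1 sq qq; have := nm_ge0 (1 - p).
by have := nm_ge0 (1 - y); nra.
Qed.

Section QuasiUHF.
Variables (R : realType) (A : cstarType R).

Lemma eps_subsetE (e : R) (X Y : set A) : eps_subset e X Y <->
  forall x, X x -> exists2 y, Y y & nm (x - y) <= e * nm x.
Proof.
by split=> h x /h[y Yy xy]; exists y => //; move: xy; rewrite !nmE -rmorphM/= lecR.
Qed.

Lemma eps_subset_mono (d e : R) (X Y : set A) : d <= e -> eps_subset d X Y -> eps_subset e X Y.
Proof.
move=> de /eps_subsetE h; apply/eps_subsetE => x /h[y Yy xy]; exists y => //.
by apply: (le_trans xy); rewrite ler_wpM2r// nm_ge0.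
Qed.

Lemma subalg_dist_set_lb (X Y : set A) :
  has_lbound [set e : R | [/\ 0 < e, eps_subset e X Y & eps_subset e Y X]].
Proof. by exists 0 => e [e0 _ _]; apply: ltW. Qed.

Lemma eps_subset1 (X Y : set A) : Y 0 -> eps_subset 1 X Y.
Proof. by move=> Y0; apply/eps_subsetE => x _; exists 0 => //; rewrite subr0 mul1r. Qed.

Lemma subalg_dist_le1 (X Y : set A) : X 0 -> Y 0 -> subalg_dist X Y <= 1.
Proof.
move=> X0 Y0; apply: ge_inf; first exact: subalg_dist_set_lb.
by split; [exact: ltr01|exact: eps_subset1..].
Qed.

Lemma subalg_dist_lt (X Y : set A) (e : R) : X 0 -> Y 0 -> subalg_dist X Y < e ->
  eps_subset e X Y.
Proof.
move=> X0 Y0 h; 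
have hi : has_inf [set d : R | [/\ 0 < d, eps_subset d X Y & eps_subset d Y X]].
  split; last exact: subalg_dist_set_lb.
  by exists 1; split; [exact: ltr01|exact: eps_subset1..].
have [d [d0 {}h _] de] := inf_lt hi.1 h.
by apply: eps_subset_mono h; apply: ltW.
Qed.

(** A real supremum dominates its set only when the set is bounded. The distances are at most 1,
    because approximation by 0 is always allowed with constant 1. *)
Lemma quasi_near (al : flow A) (An : nat -> set A) (e : R) : (forall n, An n 0) ->
  (fun n => sup [set subalg_dist (An n) (al t @` An n) | t in [set t : R | `|t| <= 1]])
    @ \oo --> (0 : R) -> 0 < e ->
  exists N, forall n, (N <= n)%N -> forall t : R, `|t| <= 1 -> eps_subset e (An n) (al t @` An n).
Proof.
move=> A0 /cvgrPdist_lt/(_ e) + e0 => /(_ e0)[N _ HN]; exists N => n /HN /=.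
rewrite sub0r normrN => h t t1.
have At0 s : (al s @` An n) 0 by exists 0 => //; apply: hom0; apply: flow_hom.
apply: subalg_dist_lt => //; apply: le_lt_trans (le_lt_trans (ler_norm _) h).
apply: ub_le_sup; last by exists t.
by exists 1 => _ [s _ <-]; apply: subalg_dist_le1.
Qed.

Variables (B : nat -> set A) (An : nat -> set A).
Hypothesis hc : uhf_chain B.
Hypothesis fA : forall n, full_matrix_subalgebra (An n).
Hypothesis dA : closure (\bigcup_n An n) = [set: A].

Lemma fullmx_csub n : csub (An n).
Proof. by have [k [e [eP ->]]] := full_matrix_munits (fA n); apply: csub_mspan. Qed.

Lemma fullmxM n x y : An n x -> An n y -> An n (x * y).
Proof. by have [k [e [eP ->]]] := full_matrix_munits (fA n); apply: mspanM. Qed.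

Lemma fullmxS n x : An n x -> An n (star x).
Proof. by have [k [e [eP ->]]] := full_matrix_munits (fA n); apply: mspan_star. Qed.

(* Otherwise a generator of each large [B m] would be approximated only by, hence
   lie in, one of finitely many [An n]; some [An n] would then contain every [B m]. *)
Lemma near_contains_or_full :
  (exists n, An n = setT) \/
  forall N m (d : R), 0 < d -> exists2 n, (N <= n)%N &
    forall x, B m x -> exists2 y, An n y & nm (x - y) <= d * nm x.
Proof.
apply: contrapT => /not_orP[nfull nnear]; have [hB mB _] := hc.
have [N [m0 [d [d0 H]]]] : exists N m (d : R), 0 < d /\ forall n, (N <= n)%N ->
    ~ forall x, B m x -> exists2 y, An n y & nm (x - y) <= d * nm x.
  apply: contrapT => H; apply: nnear => N m d d0; apply: contrapT => H2.
  apply: H; exists N, m, d; split=> // n Nn h; apply: H2; by exists n.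
have cont m : (m0 <= m)%N -> exists2 n, (n < N)%N & B m `<=` An n.
  move=> mm; have [s hs] := mxalg_generator (hB m).
  have [r r0 hr] := hs d d0.
  have far n b : (N <= n)%N -> An n b -> r <= nm (s - b).
    move=> Nn Ab; rewrite leNgt; apply/negP => sb; apply: (H n Nn) => x Bx.
    by apply: (hr _ b (fullmx_csub n) _ _ Ab sb) (mB _ _ mm _ Bx) => ? ?;
      [exact: fullmxM|exact: fullmxS].
  have [n nN sn] : exists2 n, (n < N)%N & An n s.
    apply: contrapT => ns.
    have [r' [r'0 r'r far']] : exists r' : R, [/\ 0 < r', r' <= r &
        forall n b, (n < N)%N -> An n b -> r' <= nm (s - b)].
      have fn n : (n < N)%N -> exists2 q : R, 0 < q & forall b, An n b -> q <= nm (s - b).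
        move=> nN; apply: contrapT => Hn; apply: ns; exists n => //.
        have [_ _ _ Ac] := fullmx_csub n; apply: Ac => e e0; apply: contrapT => He.
        apply: Hn; exists e => // b Ab; rewrite leNgt; apply/negP => sb.
        by apply: He; exists b.
      elim: (N) fn => [|M IH] fn; first by exists r; split.
      have [r1 [h1 h2 h3]] := IH (fun n nM => fn n (ltnW nM)).
      have [q q0 hq] := fn M (ltnSn M).
      exists (Num.min r1 q); split; [by rewrite lt_min h1|by rewrite ge_min h2|].
      move=> n b; rewrite ltnS leq_eqVlt => /orP[/eqP->|nM] Ab.
        by rewrite ge_min hq ?orbT.
      by rewrite ge_min (h3 n).
    have : closure (\bigcup_n An n) s by rewrite dA.
    move=> /closure_epsP/(_ r' r'0)[b [n _ Ab]].
    have [nN|Nn] := ltnP n N; first by have := far' n b nN Ab; lra.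
    by have := far n b Nn Ab; lra.
  (* With s itself in [An n], the generator property applies to b = s at every tolerance, and
     closedness of [An n] gives inclusion. *)
  exists n => //; move=> x Bx; have [_ _ _ Ac] := fullmx_csub n; apply: Ac => e e0.
  have nx := nm_ge0 x; have e1 : 0 < e / (nm x + 1) by rewrite divr_gt0//; lra.
  have [r2 r20 hr2] := hs _ e1.
  have ss : nm (s - s) < r2 by rewrite subrr nm0.
  have [y Ay xy] := hr2 _ s (fullmx_csub n) (@fullmxM n) (@fullmxS n) sn ss x Bx.
  exists y => //; apply: (le_lt_trans xy); rewrite mulrAC ltr_pdivrMr; last lra.
  by rewrite ltr_pM2l//; lra.
have [n hn] : exists n, forall m, B m `<=` An n.
  apply: contrapT => Hn.
  have bad n : exists m, ~ (B m `<=` An n).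
    by apply: contrapT => h; apply: Hn; exists n => m; apply: contrapT => h2; apply: h; exists m.
  (* Pigeonhole: as the chain increases, one stage M witnesses at once that none of the finitely
     many [An n] with n < N contains the whole chain. *)
  have [M [mM HM]] : exists M, (m0 <= M)%N /\ forall n, (n < N)%N -> ~ (B M `<=` An n).
    elim: (N) => [|K [M [mM IH]]]; first by exists m0.
    have [k hk] := bad K; exists (maxn M k); split; first by rewrite leq_max mM.
    move=> n; rewrite ltnS leq_eqVlt => /orP[/eqP->|nK] hs.
      by apply: hk; apply: subset_trans hs; apply: mB; apply: leq_maxr.
    by apply: (IH n nK); apply: subset_trans hs; apply: mB; apply: leq_maxl.
  by have [n nN hs] := cont M mM; apply: (HM n nN).
apply: nfull; exists n; rewrite -subTset => x _.
by apply: (uhf_spanning hc (fullmx_csub n)) => y [m _ By]; apply: hn By.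
Qed.

End QuasiUHF.

(** The subalgebras of a quasi-UHF sequence need not increase, so density of their union does not by
    itself put a finite set near a late one; [near_contains_or_full] does. In the exceptional case A
    is itself a matrix algebra, and C = A is invariant. *)
Lemma quasi_UHF_approx (R : realType) (A : cstarType R) (B : nat -> set A) (al : flow A)
    (l : seq A) (e : R) : uhf_chain B -> quasi_UHF al -> 0 < e ->
  exists C : set A, [/\ mxalg C,
    forall x, x \in l -> exists2 y, C y & nm (x - y) <= e &
    forall t : R, `|t| <= 1 -> eps_subset e C (al t @` C)].
Proof.
move=> hc [An [fA dA cA]] e0; have [hB mB dB] := hc.
have A0 n : An n 0 by have [] := fullmx_csub fA n.
have [[n An_full]|near] := near_contains_or_full hc fA dA.
  exists setT; split.
  - by rewrite -An_full; apply: full_matrix_mxalg (fA n) _; rewrite An_full.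
  - by move=> x _; exists x => //; rewrite subrr nm0 ltW.
  - move=> t _; apply/eps_subsetE => x _; exists x.
      by exists (al (- t) x) => //; rewrite -flowD subrr flow0.
    by rewrite subrr nm0 mulr_ge0 ?nm_ge0// ltW.
have [N HN] := quasi_near A0 cA e0.
have [m [K [K0 Hm]]] : exists m (K : R), 0 <= K /\ forall x, x \in l ->
    exists y, [/\ B m y, nm (x - y) <= e / 2 & nm y <= K].
  elim: l => [|x l [m [K [K0 Hm]]]]; first by exists 0%N, 0.
  have [n [y [By xy]]] := dB x (e / 2) ltac:(lra).
  exists (maxn m n), (Num.max K (nm y)); rewrite le_max K0; split=> // z.
  rewrite inE => /orP[/eqP->|/Hm[w [Bw zw wK]]].
    exists y; split; [by apply: mB By; apply: leq_maxr|exact: ltW|by rewrite le_max lexx orbT].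
  by exists w; split=> //; [apply: mB Bw; apply: leq_maxl|rewrite le_max wK].
(* The bound 1/2 brings 1 close enough to [An n] for unitality; the other gives d K <= e/2, the part
   of e left after approximation in [B m]. *)
pose d := Num.min 2^-1 (e / (2 * K + 2)).
have c0 : 0 < 2 * K + 2 by lra.
have d0 : 0 < d by rewrite lt_min divr_gt0// andbT; lra.
have d1 : d <= 2^-1 by rewrite ge_min lexx.
have d2 : d * (2 * K + 2) <= e by rewrite -ler_pdivlMr// ge_min lexx orbT.
have [n Nn Hn] := near N m d d0.
exists (An n); split; last exact: HN.
  have [y Ay y1] := Hn 1 (mxalg1 (hB m)).
  by apply: (full_matrix_near1 (fA n) Ay); rewrite nm1 in y1; lra.
move=> x /Hm[y [By xy yK]]; have [z Az yz] := Hn y By; exists z => //.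
have := nm_tri y x z; have : d * nm y <= d * K by rewrite ler_wpM2l// ltW.
by lra.
Qed.

(** * Approximate intertwining *)

Section SequenceTools.
Variables (R : realType) (A : cstarType R).

Lemma tends_cauchy (u : nat -> A) l : tends u l -> is_cauchy u.
Proof.
move=> h e e0; have [N HN] := h (e / 2) ltac:(lra); exists N => n m Nn Nm.
have := HN n Nn; have := HN m Nm; have := nm_tri l (u n) (u m).
by rewrite (nmBC l); lra.
Qed.

Lemma geom_from (u : nat -> A) (c : R) N :
  (forall n, (N <= n)%N -> nm (u n.+1 - u n) <= c * 2^-1 ^+ n) ->
  exists2 l, tends u l & forall n, (N <= n)%N -> nm (u n - l) <= 2 * c * 2^-1 ^+ n.
Proof.
move=> h; have h' k : nm (u (k.+1 + N)%N - u (k + N)%N) <= (c * 2^-1 ^+ N) * 2^-1 ^+ k.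
  by rewrite addSn (le_trans (h _ (leq_addl _ _)))// -mulrA -exprD (addnC N).
have [l hl hd] := geom_tends (u := fun k => u (k + N)%N) h'.
exists l => [e e0|n Nn].
  have [M HM] := hl e e0; exists (M + N)%N => n MNn.
  have := HM (n - N)%N; rewrite subnK ?(leq_trans (leq_addl _ _) MNn)//.
  by apply; rewrite leq_subRL ?(leq_trans (leq_addl _ _) MNn)// addnC.
by have := hd (n - N)%N; rewrite subnK// -!mulrA -exprD subnKC// mulrA.
Qed.

Lemma lim_unitary (u : nat -> A) l : (forall n, unitary (u n)) -> tends u l -> unitary l.
Proof.
move=> uu ul; split.
  apply: (tends_unique (tendsM (tends_star ul) ul)).
  by apply: tends_ext (tends_cst 1) _ => n; case: (uu n).
apply: (tends_unique (tendsM ul (tends_star ul))).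
by apply: tends_ext (tends_cst 1) _ => n; case: (uu n).
Qed.

Lemma tends_Ad (u x : nat -> A) v y : tends u v -> tends x y ->
  tends (fun n => Ad (u n) (x n)) (Ad v y).
Proof. by move=> uv xy; apply/tendsM/tends_star => //; apply: tendsM. Qed.

(** An isometric image of a complete space is complete, hence closed. *)
Lemma csub_range (D : cstarType R) (f : A -> D) : star_hom f ->
  (forall x, nm (f x) = nm x) -> csub (range f).
Proof.
move=> fh fi; split=> [|_ _ [x _ <-] [y _ <-]|c _ [x _ <-]|y hy].
- by exists 0; rewrite // hom0.
- by exists (x + y); rewrite // homD.
- by exists (c *: x); rewrite // homZ.
have /choice[a ha] n : exists a, nm (y - f a) < 2^-1 ^+ n.
  have [_ [a _ <-] ya] := hy (2^-1 ^+ n) (exprn_gt0 n (ltac:(lra) : 0 < 2^-1 :> R)).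
  by exists a.
have [n|l al _] := @geom_tends _ _ a 2.
  rewrite -fi (homB fh); have := ha n; have := ha n.+1; rewrite exprS.
  have := nm_tri y (f (a n.+1)) (f (a n)); rewrite (nmBC _ y).
  have : (0 : R) < 2^-1 ^+ n by rewrite exprn_gt0// invr_gt0.
  by lra.
exists l => //; apply: (tends_unique (hom_tends fh al)) => e e0.
have [N HN] := half_lt 1 e0; exists N => n /HN; rewrite mul1r nmBC.
by apply: lt_trans.
Qed.

(** The time t is cut into n steps of length at most 1; as the flow is isometric, each step adds at
    most e. *)
Lemma flow_almost_invariant (al : flow A) v (e : R) :
  (forall t, `|t| <= 1 -> nm (al t v - v) <= e) ->
  forall (n : nat) t, `|t| <= n%:R -> nm (al t v - v) <= n%:R * e.
Proof.
move=> h; elim=> [|n IH] t.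
  by rewrite normr_le0 => /eqP->; rewrite flow0 subrr nm0 mul0r.
move=> tn; have n0 : 0 < n.+1%:R :> R by rewrite ltr0n.
pose r := t / n.+1%:R; pose s := r * n%:R.
have tE : t = s + r by rewrite /s -[X in _ + X]mulr1 -mulrDr natr1 /r divfK// gt_eqF.
have r1 : `|r| <= 1 by rewrite /r normrM normfV (ger0_norm (ltW n0)) ler_pdivrMr// mul1r.
have sn : `|s| <= n%:R by rewrite /s normrM normr_nat ler_piMl.
have := IH s sn; have := h r r1.
have : nm (al t v - v) <= nm (al r v - v) + nm (al s v - v).
  have -> : al t v - v = al s (al r v - v) + (al s v - v).
    by rewrite (homB (flow_hom al s)) -flowD -tE addrA subrK.
  by rewrite (le_trans (nmD _ _))// flow_nm.
by rewrite -natr1; lra.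
Qed.

End SequenceTools.

Lemma inj_surj_bij (U V : Type) (f : U -> V) :
  injective f -> (forall y, exists x, f x = y) -> bijective f.
Proof.
move=> fi /choice[g hg]; exists g => // x.
by apply: fi; rewrite hg.
Qed.

(** * Cocycle perturbation as an equivalence relation *)

Section CocyclePerturbation.
Variables (R : realType) (A : cstarType R).
Implicit Types (al be ga : R -> A -> A).

Lemma cocycle_perturbation_sym al be : (forall t, star_hom (al t)) ->
  cocycle_perturbation be al -> cocycle_perturbation al be.
Proof.
move=> alh [u [uc uu ucoc] hbe]; exists (fun t => star (u t)).
  split=> [|t|s t]; [exact: cont_star|exact: unitary_star|].
  rewrite hbe /Ad (homS (alh s)) -ucoc starM !mulrA.
  by case: (uu s) => -> _; rewrite mul1r.
by move=> t x; rewrite hbe AdK.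
Qed.

Lemma cocycle_perturbation_trans al be ga : (forall t, star_hom (al t)) ->
  cocycle_perturbation be al -> cocycle_perturbation ga be ->
  cocycle_perturbation ga al.
Proof.
move=> alh [u [uc uu ucoc] hbe] [v [vc vu vcoc] hga].
exists (fun t => v t * u t).
  split=> [|t|s t]; [exact: contM|exact: unitaryM|].
  rewrite -ucoc -vcoc hbe /Ad (homM (alh s)) !mulrA; congr (_ * _).
  by rewrite -(mulrA _ (star (u s))); case: (uu s) => -> _; rewrite mulr1.
by move=> t x; rewrite hga hbe Ad_Ad.
Qed.

Lemma cocycle_perturbation_iso (D : cstarType R) (f : A -> D) (g : D -> A) al be :
  star_hom f -> cancel f g ->
  cocycle_perturbation be al ->
  cocycle_perturbation (fun t x => f (be t (g x))) (fun t x => f (al t (g x))).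
Proof.
move=> fh fK [u [uc uu ucoc] hbe]; exists (fun t => f (u t)).
  split=> [|t|s t]; [exact: cont_hom|exact: hom_unitary|].
  by rewrite fK -(homM fh) ucoc.
by move=> t x; rewrite hbe hom_Ad.
Qed.

End CocyclePerturbation.

(** * One-sided intertwining *)

Section Intertwining.
Variables (R : realType) (A M : cstarType R) (i : A -> M) (Ga : flow M) (de : flow A).
Hypotheses (ih : star_hom i) (inm : forall a, nm (i a) = nm a).
Hypothesis iGa : forall t a, Ga t (i a) = i (de t a).
Variables (L : nat -> seq A) (X : nat -> seq M).
Hypothesis Lsp : spanning [set x | exists n, x \in L n].
Hypothesis Xmono : forall n m, (n <= m)%N -> {subset X n <= X m}.
Hypothesis Xsp : spanning [set x | exists n, x \in X n].
Hypothesis absorb : forall (F : seq A) (Y : seq M) (e : R), 0 < e -> exists v : M,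
  [/\ unitary v, forall t : R, `|t| <= 1 -> nm (Ga t v - v) <= e,
      forall b, b \in F -> nm (Ad v (i b) - i b) <= e &
      forall y, y \in Y -> exists c, nm (Ad (star v) y - i c) <= e].

(** The first component is the product of the unitaries so far, the second a finite set of elements
    that all later unitaries must nearly fix. Recording there the elements c that approximate the
    rotated [X n] makes these approximations persist in the limit, which yields surjectivity. *)
Definition next n (p q : M * seq A) := exists v, [/\ unitary v, q.1 = p.1 * v,
  forall t : R, `|t| <= 1 -> nm (Ga t v - v) <= 2^-1 ^+ n,
  forall b, b \in p.2 -> nm (Ad v (i b) - i b) <= 2^-1 ^+ n &
  [/\ {subset p.2 <= q.2}, {subset L n <= q.2} & forall x, x \in X n ->
    exists2 c, c \in q.2 & nm (Ad (star q.1) x - i c) <= 2^-1 ^+ n]].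

Lemma next_ex n p : exists q, next n p q.
Proof.
have q0 : (0 : R) < 2^-1 ^+ n by rewrite exprn_gt0// invr_gt0.
have [v [uv v1 v2 v3]] := absorb p.2 [seq Ad (star p.1) x | x <- X n] q0.
have [cs hcs] : exists cs : seq A, forall x, x \in X n ->
    exists2 c, c \in cs & nm (Ad (star (p.1 * v)) x - i c) <= 2^-1 ^+ n.
  have : forall x, x \in X n -> exists c, nm (Ad (star (p.1 * v)) x - i c) <= 2^-1 ^+ n.
    move=> x xX; have [|c hc'] := v3 (Ad (star p.1) x); first exact: map_f.
    by exists c; rewrite starM -Ad_Ad.
  elim: (X n) => [|x l IH] H; first by exists [::].
  have [cs hcs] := IH (fun y yl => H y (mem_behead (s := x :: l) yl)).
  have [c hc'] := H x (mem_head _ _); exists (c :: cs) => y.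
  rewrite inE => /orP[/eqP->|/hcs[d dcs hd]]; first by exists c; rewrite ?mem_head.
  by exists d; rewrite // inE dcs orbT.
exists (p.1 * v, p.2 ++ L n ++ cs), v; split=> //=; split.
- by move=> x xp; rewrite mem_cat xp.
- by move=> x xp; rewrite !mem_cat xp orbT.
- by move=> x /hcs[c cc hc']; exists c => //; rewrite !mem_cat cc !orbT.
Qed.

(* One-sided approximate intertwining: theta = lim Ad(v_0 ... v_n) i is onto because
   ever larger parts of M are rotated into the range of i, and the near invariance
   of the v_n turns [Ga] into a cocycle perturbation. *)
Lemma intertwining : exists (theta : A -> M) (w : R -> M),
  [/\ star_hom theta, bijective theta, cocycle Ga w &
      forall t a, Ad (w t) (Ga t (theta a)) = theta (de t a)].
Proof.
have /choice[f hf] (p : nat * (M * seq A)) : exists q, next p.1 p.2 q := next_ex p.1 p.2.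
pose Z := fix Z n := if n is n'.+1 then f (n', Z n') else ((1 : M), [::] : seq A).
have ZS n : next n (Z n) (Z n.+1) by apply: (hf (n, Z n)).
pose V n := (Z n).1; pose F n := (Z n).2.
have uV n : unitary (V n).
  elim: n => [|n IH]; first exact: unitary1.
  by have [v [uv e _ _ _]] := ZS n; rewrite /V e; apply: unitaryM.
have monoF n m : (n <= m)%N -> {subset F n <= F m}.
  move=> nm_; rewrite -(subnK nm_); elim: (m - n)%N => [//|k IH] x /IH h.
  by have [v [_ _ _ _ [h1 _ _]]] := ZS (k + n)%N; apply: h1.
pose th n a := Ad (V n) (i a).
have thh n : star_hom (th n) by apply: (comp_hom (Ad_hom (uV n)) ih).
have thF n m a : (n <= m)%N -> a \in F n -> nm (th m.+1 a - th m a) <= 1 * 2^-1 ^+ m.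
  move=> nm_ /(monoF _ _ nm_) aF; have [v [uv e _ h _]] := ZS m.
  rewrite /th /V e -Ad_Ad -AdB.
  by rewrite (nm_Ad _ (uV m)) mul1r; apply: h.
have hlim a : exists y, tends (fun n => th n a) y.
  apply: cauchy_tends; move: a; apply: (Lsp (csub_cauchy thh)) => a [n aL].
  have aF : a \in F n.+1 by have [v [_ _ _ _ [_ h _]]] := ZS n; apply: h.
  have [l hl _] := @geom_from _ _ (fun m => th m a) 1 n.+1 (fun m nm_ => thF _ _ _ nm_ aF).
  exact: tends_cauchy hl.
have /choice[theta ht] := hlim.
have th_hom : star_hom theta by apply: lim_hom ht.
have th_nm a : nm (theta a) = nm a.
  apply/eqP; rewrite eq_le hom_le//= leNgt; apply/negP => lt.
  have [N HN] := ht a (nm a - nm (theta a)) ltac:(lra).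
  have := HN N (leqnn _); have := nm_le_add (th N a) (theta a).
  by rewrite {2}/th nm_Ad// inm; lra.
(* For x in [X n] the recorded c satisfies two estimates: [th n.+1 c] is within 2^-n of x, and since
   c is nearly fixed from then on, [theta c] is within 2^-n of [th n.+1 c]. *)
have th_surj y : exists a, theta a = y.
  suff [a _ ay] : range theta y by exists a.
  move: y; apply: (Xsp (csub_range th_hom th_nm)) => x [m xX].
  have [_ _ _ rc] := csub_range th_hom th_nm; apply: rc => e e0.
  have [N HN] := half_lt 3 e0; pose n := maxn m N.
  have [v [_ _ _ _ [_ _ h]]] := ZS n.
  have [|c cF hc'] := h x; first by apply: Xmono xX; apply: leq_maxl.
  exists (theta c); first by exists c.
  have h1 : nm (x - th n.+1 c) <= 2^-1 ^+ n.
    by rewrite -(nm_Ad _ (unitary_star (uV n.+1))) AdB /th AdK.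
  have [l hl hd] := @geom_from _ _ (fun m => th m c) 1 n.+1 (fun m nm_ => thF _ _ _ nm_ cF).
  rewrite -(tends_unique hl (ht c)) in hd *.
  have := hd n.+1 (leqnn _); rewrite exprS.
  have := HN n (leq_maxr _ _); have := nm_tri (th n.+1 c) x l.
  by lra.
(* Each [wn n] is a coboundary. The [V n] need not converge, but near invariance of the v_n makes
   the [wn n] converge uniformly on bounded times, and the cocycle identity, unitarity and
   continuity pass to the limit. *)
pose wn n t := V n * Ga t (star (V n)).
have uwn n t : unitary (wn n t).
  apply: unitaryM => //; apply: (hom_unitary (flow_hom Ga t)).
  exact: unitary_star.
have wnd (K : nat) n t : `|t| <= K%:R -> nm (wn n.+1 t - wn n t) <= K%:R * 2^-1 ^+ n.
  move=> tK; have [v [uv e h _ _]] := ZS n.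
  have -> : wn n.+1 t - wn n t = V n * (v * Ga t (star v) - 1) * Ga t (star (V n)).
    rewrite /wn /V e starM (homM (flow_hom Ga t)) mulrBr mulrBl mulr1 !mulrA//.
  rewrite nm_ur; last by apply: (hom_unitary (flow_hom Ga t)); apply: unitary_star.
  rewrite nm_ul//; have -> : v * Ga t (star v) - 1 = v * star (Ga t v - v).
    by rewrite starB (homS (flow_hom Ga t)) mulrBr; case: uv => _ ->.
  by rewrite nm_ul// nm_star; apply: flow_almost_invariant.
have wlim (K : nat) t : `|t| <= K%:R -> exists2 l, tends (fun n => wn n t) l &
    forall n, nm (wn n t - l) <= 2 * K%:R * 2^-1 ^+ n.
  by move=> tK; apply: geom_tends => n; apply: wnd.
have big (t : R) : `|t| <= (Num.trunc `|t|).+1%:R by apply: ltW; exact: truncnS_gt.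
have /choice[w hw] t : exists l, tends (fun n => wn n t) l.
  by have [l hl _] := wlim _ t (big t); exists l.
have wK (K : nat) t n : `|t| <= K%:R -> nm (wn n t - w t) <= 2 * K%:R * 2^-1 ^+ n.
  by move=> /wlim[l hl]; rewrite (tends_unique hl (hw t)).
have th_inj : injective theta.
  move=> a b ab; apply/eqP; rewrite -subr_eq0; apply/eqP/nm_eq0.
  by rewrite -th_nm (homB th_hom) ab subrr nm0.
exists theta, w; split=> //; first exact: inj_surj_bij.
- split.
  + apply/continuousE => t e e0; pose K := (Num.trunc (`|t| + 1)).+1.
    have tK : `|t| + 1 <= K%:R by apply: ltW; exact: truncnS_gt.
    have [N HN] := half_lt (2 * K%:R) (ltac:(lra) : 0 < e / 3).
    have cN : continuous (wn N) by apply: contM; [exact: cont_cst|exact: flow_continuous].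
    have /continuousE/(_ t (e / 3) ltac:(lra))[d d0 H] := cN.
    exists (Num.min 1 d) => [|s]; first by rewrite lt_min ltr01.
    rewrite lt_min => /andP[s1 /H h1].
    have hs : `|s| <= `|t| + 1 by have := ler_normD (s - t) t; rewrite subrK; lra.
    have := wK K s N (le_trans hs tK); have := wK K t N ltac:(lra).
    have := HN N (leqnn _); have := nm_tri (wn N s) (w s) (w t).
    have := nm_tri (wn N t) (wn N s) (w t); rewrite (nmBC (w s) (wn N s)).
    by lra.
  + by move=> t; apply: lim_unitary (hw t).
  + move=> s t; apply: (tends_unique (tendsM (hw s) (hom_tends (flow_hom Ga s) (hw t)))).
    apply: tends_ext (hw (s + t)) _ => n; rewrite /wn (homM (flow_hom Ga s)) -flowD.
    rewrite mulrA -(mulrA (V n)) -(homM (flow_hom Ga s)).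
    by case: (uV n) => -> _; rewrite (hom1 (flow_hom Ga s)) mulr1.
(* The conjugation formula holds exactly at each stage, with [wn n] and [th n]; only the limit is
   taken. *)
move=> t a; apply: (tends_unique (tends_Ad (hw t) (hom_tends (flow_hom Ga t) (ht a)))).
apply: tends_ext (ht (de t a)) _ => n; rewrite /th (hom_Ad (flow_hom Ga t)) Ad_Ad /wn.
rewrite -mulrA -(homM (flow_hom Ga t)); case: (uV n) => -> _.
by rewrite (hom1 (flow_hom Ga t)) mulr1 iGa.
Qed.

End Intertwining.

(** * Tensor products of flows *)

Section TensorProducts.
Variable R : realType.

Lemma tensor_spanning (A B : cstarType R) (T : tensor_product A B) :
  spanning [set x | exists a b, x = tinl T a * tinr T b].
Proof.
move=> V cV h; apply: (dense_spanning (tin_dense T) cV) => _ [n [a [b ->]]].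
by apply: csub_sum => // k _; apply: h; exists (a k), (b k).
Qed.

Lemma tensor_approx (A B : cstarType R) (T : tensor_product A B) (x : T) (e : R) : 0 < e ->
  exists s : seq (A * B), nm (x - \sum_(p <- s) tinl T p.1 * tinr T p.2) < e.
Proof.
move=> e0; have : closure [set x | exists n (a : 'I_n -> A) (b : 'I_n -> B),
    x = \sum_i tinl T (a i) * tinr T (b i)] x by rewrite tin_dense.
move=> /closure_epsP/(_ e e0)[_ [n [a [b ->]]] xy].
exists [seq (a k, b k) | k <- enum 'I_n].
by rewrite big_map big_enum.
Qed.

Lemma tensor_hom_ext (A B D : cstarType R) (T : tensor_product A B) (f g : T -> D) :
  star_hom f -> star_hom g ->
  (forall a b, f (tinl T a * tinr T b) = g (tinl T a * tinr T b)) -> f =1 g.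
Proof.
move=> fh gh h; apply: (hom_ext fh gh (@tensor_spanning _ _ T)).
by move=> _ [a [b ->]].
Qed.

Lemma tensor_is_flow (A B : cstarType R) (T : tensor_product A B) (al : flow A) (be : flow B) :
  exists Ga : flow T, Ga = tensor_flow T al be :> (R -> T -> T).
Proof.
have th := tensor_flow_hom T al be.
have tD s t x : tensor_flow T al be (s + t) x = tensor_flow T al be s (tensor_flow T al be t x).
  move: x; apply: tensor_hom_ext => // [|a b]; first exact: (comp_hom (th s) (th t)).
  by rewrite /= !tensor_flowE !flowD.
have t0 x : tensor_flow T al be 0 x = x.
  move: x; apply: tensor_hom_ext => // a b; first by rewrite tensor_flowE !flow0.
have tb t : bijective (tensor_flow T al be t).
  by exists (tensor_flow T al be (- t)) => x; rewrite -tD ?addNr ?subrr t0.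
have tc x : continuous (fun t : R => tensor_flow T al be t x).
  move: x; apply: (tensor_spanning (csub_continuous th)) => _ [a [b ->]] /=.
  under eq_fun do rewrite tensor_flowE.
  by apply: contM; apply: cont_hom; [exact: tinl_hom|exact: flow_continuous|
    exact: tinr_hom|exact: flow_continuous].
by exists (Flow th tb t0 tD tc).
Qed.

Lemma iso_flow (A B : cstarType R) (f : A -> B) (g : B -> A) (al : flow A) :
  star_hom f -> star_hom g -> cancel f g -> cancel g f ->
  exists be : flow B, be = (fun t x => f (al t (g x))) :> (R -> B -> B).
Proof.
move=> fh gh fK gK; pose b (t : R) x := f (al t (g x)).
have bh t : star_hom (b t) by apply: (comp_hom fh (comp_hom (flow_hom al t) gh)).
have bD s t x : b (s + t) x = b s (b t x) by rewrite /b fK flowD.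
have b0 x : b 0 x = x by rewrite /b flow0 gK.
have bb t : bijective (b t) by exists (b (- t)) => x; rewrite -bD ?addNr ?subrr b0.
have bc x : continuous (fun t : R => b t x) by apply: cont_hom => //; apply: flow_continuous.
by exists (Flow bh bb b0 bD bc).
Qed.

Lemma iso_UHF_flow (A B : cstarType R) (f : A -> B) (g : B -> A) (al : flow A) (be : flow B) :
  star_hom f -> cancel f g -> cancel g f ->
  be = (fun t x => f (al t (g x))) :> (R -> B -> B) -> UHF_flow al -> UHF_flow be.
Proof.
move=> fh fK gK E [An [fA mA A1 dA iA]]; have gh := bij_hom_inv fh fK gK.
exists (fun n => f @` An n); split.
- move=> n; have [k [m [ml mM mS mi mr]]] := fA n.
  exists k, (f \o m); split=> [c x y|x y|x||].
  + by rewrite /= ml (homD fh) (homZ fh).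
  + by rewrite /= mM (homM fh).
  + by rewrite /= mS (homS fh).
  + by apply: inj_comp => //; apply: can_inj fK.
  + by rewrite -mr image_comp.
- by move=> n _ [x Ax <-]; exists x => //; apply: mA.
- by exists 1 => //; apply: hom1.
- rewrite -subTset => x _; apply/closure_epsP => e e0.
  have : closure (\bigcup_n An n) (g x) by rewrite dA.
  move=> /closure_epsP/(_ e e0)[y [n _ Ay] xy]; exists (f y); first by exists n => //; exists y.
  by rewrite -{1}(gK x) -(homB fh) (le_lt_trans (hom_le fh _)).
- move=> n t; rewrite E -[in RHS](iA n t) image_comp image_comp.
  by apply: eq_imagel => x _ /=; rewrite fK.
Qed.

Section Transport.
Variables (A B : cstarType R) (T : tensor_product B B) (f : A -> B) (g : B -> A).
Hypotheses (fh : star_hom f) (fK : cancel f g) (gK : cancel g f).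

Lemma transport_inj n (a b : 'I_n -> A) :
  (forall c : 'I_n -> R[i], \sum_k c k *: b k = 0 -> forall k, c k = 0) ->
  \sum_k tinl T (f (a k)) * tinr T (f (b k)) = 0 -> forall k, a k = 0.
Proof.
move=> hb h k; apply: (can_inj fK); rewrite (hom0 fh); move: k.
apply: (@tin_inj _ _ _ T n (f \o a) (f \o b)) => // c hc; apply: hb.
apply: (can_inj fK); rewrite (hom0 fh) -[RHS]hc (hom_sum fh).
by apply: eq_bigr => k _; rewrite (homZ fh).
Qed.

Lemma transport_dense : closure [set x | exists n (a b : 'I_n -> A),
  x = \sum_k tinl T (f (a k)) * tinr T (f (b k))] = [set: T].
Proof.
rewrite -(tin_dense T); congr closure; rewrite eqEsubset; split=> _ [n [a [b ->]]].
  by exists n, (f \o a), (f \o b).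
exists n, (g \o a), (g \o b); apply: eq_bigr => k _ /=.
by rewrite !gK.
Qed.

Lemma transport_univ (D : cstarType R) (p q : A -> D) :
  star_hom p -> star_hom q -> (forall a b, p a * q b = q b * p a) ->
  exists2 h : T -> D, star_hom h &
    forall a b, h (tinl T (f a) * tinr T (f b)) = p a * q b.
Proof.
move=> ph qh pq; have gh := bij_hom_inv fh fK gK.
have [h hh hE] := tin_univ T (comp_hom ph gh) (comp_hom qh gh) (fun a b => pq (g a) (g b)).
by exists h => // a b; rewrite hE /= !fK.
Qed.

(** Universality of a flow on A quantifies over tensor squares of A; this turns a tensor square of
    an isomorphic algebra into one of A, with the same underlying C*-algebra. *)
Definition transport_tensor : tensor_product A A :=
  TensorProduct (comp_hom (tinl_hom T) fh) (comp_hom (tinr_hom T) fh)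
    (fun a b => tin_comm T (f a) (f b)) transport_inj transport_dense transport_univ.

End Transport.

Lemma tensor_flow_perturbation (A B : cstarType R) (T : tensor_product A B) (al : flow A)
    (be ga : flow B) : cocycle_perturbation be ga ->
  cocycle_perturbation (tensor_flow T al be) (tensor_flow T al ga).
Proof.
case=> u [uc uu ucoc] hbe; have lh := tinl_hom T; have rh := tinr_hom T.
have urT t := hom_unitary rh (uu t).
exists (fun t => tinr T (u t)).
  split=> [|//|s t]; first exact: cont_hom.
  have -> : tinr T (u t) = tinl T 1 * tinr T (u t) by rewrite (hom1 lh) mul1r.
  by rewrite tensor_flowE (hom1 (flow_hom al s)) (hom1 lh) mul1r -(homM rh) ucoc.
move=> t; apply: tensor_hom_ext => [||a b].
- exact: tensor_flow_hom.
- exact: (comp_hom (Ad_hom (urT t)) (tensor_flow_hom T al ga t)).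
rewrite !tensor_flowE hbe (hom_Ad rh) /Ad !mulrA; congr (_ * _ * _).
exact: tin_comm.
Qed.

End TensorProducts.

(** * Unitaries absorbing the first tensor factor into the second *)

Section Absorption.
Variables (R : realType) (A : cstarType R) (T : tensor_product A A) (B : nat -> set A).
Variables (al de : flow A) (rho : nat -> A -> A) (Ga : flow T).
Hypothesis hc : uhf_chain B.
Hypothesis qal : quasi_UHF al.
Hypothesis GaE : forall t a b, Ga t (tinl T a * tinr T b) = tinl T (al t a) * tinr T (de t b).
Hypothesis rhoh : forall n, star_hom (rho n).
Hypothesis rho_central : forall a x (e : R), 0 < e -> exists N, forall n, (N <= n)%N ->
  nm (rho n a * x - x * rho n a) <= e.
Hypothesis rho_equi : forall a (e : R), 0 < e -> exists N, forall n, (N <= n)%N ->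
  forall t, `|t| <= 1 -> nm (de t (rho n a) - rho n (al t a)) <= e.

Lemma eventually_all (I : eqType) (P : I -> nat -> Prop) (l : seq I) :
  (forall x, x \in l -> exists N, forall n, (N <= n)%N -> P x n) ->
  exists N, forall n, (N <= n)%N -> forall x, x \in l -> P x n.
Proof.
elim: l => [|x l IH] h; first by exists 0%N.
have [N HN] := IH (fun y yl => h y (mem_behead (s := x :: l) yl)).
have [M HM] := h x (mem_head _ _); exists (maxn N M) => n; rewrite geq_max => /andP[Nn Mn] y.
by rewrite inE => /orP[/eqP->|]; [apply: HM|apply: HN].
Qed.

(** v is the flip of C with its second leg in the n-th copy. C is chosen first, from its near
    invariance and nearness to l; n is chosen afterwards, so errors on the copy may be multiplied by
    the number of matrix units of C. *)
Lemma flip_absorb (l m : seq A) (e : R) : 0 < e -> exists v : T,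
  [/\ unitary v, forall t : R, `|t| <= 1 -> nm (Ga t v - v) <= e,
      forall b, b \in m -> nm (Ad v (tinr T b) - tinr T b) <= e &
      forall a, a \in l -> exists2 a', nm (a - a') <= e &
        exists2 a'', nm a'' <= nm a' & Ad (star v) (tinl T a') = tinr T a''].
Proof.
move=> e0; have lh := tinl_hom T; have rh := tinr_hom T.
(* Gives 8 e1 < 1, as [flip_path_near] demands, and 8 e1 <= e/2. *)
pose e1 := Num.min 16^-1 (e / 16).
have e10 : 0 < e1 by rewrite lt_min; apply/andP; split; lra.
have e1a : e1 <= 16^-1 by rewrite ge_min lexx.
have e1b : e1 <= e / 16 by rewrite ge_min lexx orbT.
have [C [mC lC nC]] := quasi_UHF_approx l hc qal e10.
have [I [f [fP f1 CE]]] := mC; rewrite CE in lC nC.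
pose K : R := #|{: I * I}|%:R; have K0 : 0 <= K by [].
(* The tolerance for one pair of indices, so that K such errors add up to at most e/2; the 1 avoids
   a division by zero. *)
pose e2 := e / 2 / (K + 1).
have e20 : 0 < e2 by rewrite !divr_gt0//; lra.
have Ke2 : K * e2 <= e / 2.
  rewrite /e2 mulrCA ger_pMr; last lra.
  by rewrite ler_pdivrMr; lra.
have [N1 H1] : exists N, forall n, (N <= n)%N -> forall p : I * I, p \in enum {: I * I} ->
    forall t, `|t| <= 1 -> nm (de t (rho n (f p.1 p.2)) - rho n (al t (f p.1 p.2))) <= e2.
  by apply: eventually_all => p _; apply: rho_equi.
have [N2 H2] : exists N, forall n, (N <= n)%N -> forall p : I * I, p \in enum {: I * I} ->
    forall b, b \in m -> nm (rho n (f p.1 p.2) * b - b * rho n (f p.1 p.2)) <= e2.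
  apply: eventually_all => p _.
  apply: (@eventually_all _ (fun b n => nm (rho n (f p.1 p.2) * b - b * rho n (f p.1 p.2)) <= e2)).
  by move=> b _; apply: rho_central.
pose n := maxn N1 N2.
have G1 a b t : `|t| <= 1 -> nm (de t (rho n (f a b)) - rho n (al t (f a b))) <= e2.
  by apply: (H1 n (leq_maxl _ _) (a, b)); rewrite mem_enum.
have G2 a b x : x \in m -> nm (rho n (f a b) * x - x * rho n (f a b)) <= e2.
  by apply: (H2 n (leq_maxr _ _) (a, b)); rewrite mem_enum.
pose j := tinr T \o rho n; have jh : star_hom j := comp_hom rh (rhoh n).
have ij a b : tinl T a * j b = j b * tinl T a by apply: tin_comm.
pose v := flip (tinl T) j f.
have uv : unitary v by apply: flip_unitary.
have sv : star v = v by apply: flip_star.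
have sumK (x : I -> I -> T) : (forall a b, nm (x a b) <= e2) ->
    nm (\sum_a \sum_b x a b) <= e / 2.
  move=> hx; apply: le_trans Ke2.
  rewrite pair_big/=; apply: (le_trans (nm_sum _ _ _)).
  apply: (@le_trans _ _ (\sum_(p : I * I) e2)); first by apply: ler_sum => p _; apply: hx.
  by rewrite sumr_const mulr_natl.
exists v; split=> //.
(* v' moves both legs by [al] before embedding. It is near v by the size-free estimate, and differs
   from [Ga t v] only in that the second leg is moved by [de] after embedding, a termwise error. *)
- move=> t t1; pose v' := flip (tinl T) j (fun a b => al t (f a b)).
  have h1 : nm (v' - v) <= 8 * e1.
    by apply: flip_path_near => //; [exact: ltW|lra].
  have h2 : nm (Ga t v - v') <= e / 2.
    rewrite /v /v' /flip (hom_sum (flow_hom Ga t)) -sumrB.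
    under eq_bigr do rewrite (hom_sum (flow_hom Ga t)) -sumrB.
    apply: sumK => a b; rewrite GaE -mulrBr -(homB rh).
    apply: (le_trans (nmM _ _)); rewrite -[X in _ <= X]mul1r.
    apply: ler_pM; rewrite ?nm_ge0//.
      by rewrite (le_trans (hom_le lh _))// flow_nm mu_nm.
    by rewrite (le_trans (hom_le rh _))//; apply: G1.
  by have := nm_tri v' (Ga t v) v; lra.
- move=> b bm; have -> : Ad v (tinr T b) - tinr T b =
      (v * tinr T b - tinr T b * v) * star v.
    by rewrite mulrBl -(mulrA (tinr T b)); case: uv => _ ->; rewrite mulr1.
  rewrite nm_ur; last exact: unitary_star.
  have : nm (v * tinr T b - tinr T b * v) <= e / 2.
    rewrite {1 2}/v /flip mulr_suml mulr_sumr -sumrB.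
    under eq_bigr do rewrite mulr_suml mulr_sumr -sumrB.
    apply: sumK => a c; rewrite mulrA -tin_comm -!mulrA -mulrBr.
    rewrite -!(homM rh) -(homB rh); apply: (le_trans (nmM _ _)); rewrite -[X in _ <= X]mul1r.
    apply: ler_pM; rewrite ?nm_ge0//.
      by rewrite (le_trans (hom_le lh _))// mu_nm.
    by rewrite (le_trans (hom_le rh _))//; apply: G2.
  by lra.
- move=> a al'; have [a' Ca' aa'] := lC a al'; exists a'; first lra.
  exists (rho n a'); first exact: hom_le.
  by rewrite /Ad !sv /v (flip_i lh jh ij fP Ca') -mulrA flip_sq// mulr1.
Qed.

(** Each y is approximated by a finite sum of elementary tensors. The first legs are among the
    elements carried into the right factor and the second legs among those nearly fixed, so Ad of
    [star v] sends every summand, hence y, near the right factor. *)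
Lemma tensor_absorb (F : seq A) (Y : seq T) (e : R) : 0 < e -> exists v : T,
  [/\ unitary v, forall t : R, `|t| <= 1 -> nm (Ga t v - v) <= e,
      forall b, b \in F -> nm (Ad v (tinr T b) - tinr T b) <= e &
      forall y, y \in Y -> exists c, nm (Ad (star v) y - tinr T c) <= e].
Proof.
move=> e0; have lh := tinl_hom T; have rh := tinr_hom T.
have [S [K [K0 SK HS]]] : exists (S : seq (A * A)) (K : R), [/\ 0 <= K,
    forall p, p \in S -> nm p.1 <= K /\ nm p.2 <= K &
    forall y, y \in Y -> exists s, [/\ {subset s <= S}, (size s <= size S)%N &
      nm (y - \sum_(p <- s) tinl T p.1 * tinr T p.2) < e / 2]].
  elim: Y => [|y Y [S [K [K0 SK HS]]]]; first by exists [::], 0.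
  have [s hs] := tensor_approx y (ltac:(lra) : 0 < e / 2).
  have [K' [K'0 sK']] : exists K' : R, 0 <= K' /\
      forall p, p \in s -> nm p.1 <= K' /\ nm p.2 <= K'.
    elim: (s) => [|p l [K' [K'0 H]]]; first by exists 0.
    exists (K' + nm p.1 + nm p.2); have h1 := nm_ge0 p.1; have h2 := nm_ge0 p.2.
    split=> [|q]; first lra.
    by rewrite inE => /orP[/eqP->|/H[]]; split; lra.
  exists (s ++ S), (K + K'); split; first lra.
    by move=> p; rewrite mem_cat => /orP[/sK'|/SK] []; split; lra.
  move=> z; rewrite inE => /orP[/eqP->|/HS[s' [h1 h2 h3]]].
    by exists s; split=> // [p|]; rewrite ?mem_cat ?size_cat ?leq_addr// => ->.
  exists s'; split=> //; first by move=> p /h1; rewrite mem_cat => ->; rewrite orbT.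
  by rewrite size_cat (leq_trans h2)// leq_addl.
pose n : R := (size S)%:R; have n0 : 0 <= n by [].
have c0 : 0 < 2 * (n + 1) * (2 * K + 2) by rewrite !mulr_gt0//; lra.
(* An elementary tensor with legs bounded by K costs at most d K + (K + 1) d. At most n of them
   occur, which stays within e/2; the other half of e is spent on the approximation of y. *)
pose d := Num.min (Num.min 1 e) (e / (2 * (n + 1) * (2 * K + 2))).
have d0 : 0 < d by rewrite !lt_min ltr01 e0 divr_gt0.
have d1 : d <= 1 by rewrite !ge_min lexx.
have d_e : d <= e by rewrite !ge_min lexx orbT.
have dn : d * (2 * (n + 1) * (2 * K + 2)) <= e by rewrite -ler_pdivlMr// ge_min lexx orbT.
have [v [uv v1 v2 v3]] := flip_absorb [seq p.1 | p <- S] (F ++ [seq p.2 | p <- S]) d0.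
exists v; split=> //.
- by move=> t /v1 h; apply: le_trans h d_e.
- by move=> b bF; apply: le_trans (v2 b _) d_e; rewrite mem_cat bF.
move=> y /HS[s [sS ss ys]].
have hp p : p \in S -> exists c, nm (Ad (star v) (tinl T p.1 * tinr T p.2) - tinr T c) <= d * (2 * K + 2).
  move=> pS; have [k1 k2] := SK p pS; have uv' := unitary_star uv.
  have [|a' aa' [a'' na'' E]] := v3 p.1; first exact: map_f.
  exists (a'' * p.2); rewrite (AdM _ _ uv') (homM rh).
  apply: (le_trans (nm_mulB _ _ _ _)); rewrite -E -AdB -(homB lh).
  have h1 : nm (Ad (star v) (tinl T (p.1 - a'))) <= d.
    by rewrite nm_Ad// (le_trans (hom_le lh _)).
  have h2 : nm (Ad (star v) (tinr T p.2)) <= K.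
    by rewrite nm_Ad// (le_trans (hom_le rh _)).
  have h3 : nm (Ad (star v) (tinl T a')) <= K + 1.
    rewrite nm_Ad// (le_trans (hom_le lh _))//.
    by have := nm_le_add a' p.1; rewrite nmBC; lra.
  have h4 : nm (Ad (star v) (tinr T p.2) - tinr T p.2) <= d.
    rewrite -(nm_Ad _ uv) AdB AdKV// nmBC; apply: v2.
    by rewrite mem_cat map_f ?orbT.
  have g1 : nm (Ad (star v) (tinl T (p.1 - a'))) * nm (Ad (star v) (tinr T p.2)) <= d * K.
    by apply: ler_pM => //; apply: nm_ge0.
  have g2 : nm (Ad (star v) (tinl T a')) * nm (Ad (star v) (tinr T p.2) - tinr T p.2) <= (K + 1) * d.
    by apply: ler_pM => //; apply: nm_ge0.
  by lra.
have [c hc'] : exists c, nm (\sum_(p <- s) Ad (star v) (tinl T p.1 * tinr T p.2) - tinr T c)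
    <= (size s)%:R * (d * (2 * K + 2)).
  elim: (s) sS => [|p l IH] lS.
    by exists 0; rewrite big_nil (hom0 rh) subrr nm0 mul0r.
  have [c hc'] := IH (fun q ql => lS q (mem_behead (s := p :: l) ql)).
  have [c' hc''] := hp p (lS p (mem_head _ _)); exists (c' + c).
  rewrite big_cons (homD rh) opprD addrACA (le_trans (nmD _ _))//=.
  by rewrite -natr1; lra.
exists c; have := nm_tri (\sum_(p <- s) Ad (star v) (tinl T p.1 * tinr T p.2))
  (Ad (star v) y) (tinr T c).
have -> : \sum_(p <- s) Ad (star v) (tinl T p.1 * tinr T p.2) =
    Ad (star v) (\sum_(p <- s) tinl T p.1 * tinr T p.2).
  by rewrite (hom_sum (Ad_hom (unitary_star uv))).
rewrite -AdB nm_Ad; last exact: unitary_star.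
move: hc'; rewrite (hom_sum (Ad_hom (unitary_star uv))) => hc'.
have hsn : (size s)%:R <= n by rewrite ler_nat.
have dk : 0 <= d * (2 * K + 2) by rewrite mulr_ge0//; lra.
have : (size s)%:R * (d * (2 * K + 2)) <= n * (d * (2 * K + 2)) by rewrite ler_wpM2r.
by lra.
Qed.

End Absorption.

(** * Transport of universality and final assembly *)

(** A UHF flow on T and a tensor square of T are pulled back along f to A, where universality of
    [ga] applies; the conjugacy found there is pushed forward again. *)
Lemma iso_universal (R : realType) (A : cstarType R) (T : tensor_product A A)
    (f : A -> T) (g : T -> A) (ga : flow A) (si : flow T) :
  star_hom f -> cancel f g -> cancel g f ->
  si = (fun t x => f (ga t (g x))) :> (R -> T -> T) ->
  universal_UHF_flow ga -> universal_UHF_flow si.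
Proof.
move=> fh fK gK E [uga _ hga]; have gh := bij_hom_inv fh fK gK; split.
- exact: iso_UHF_flow fh fK gK E uga.
(* Transport along g makes T, a tensor square of A, a tensor square of T itself, so the required
   isomorphism is the identity. *)
- exists (transport_tensor T gh gK fK), id; split; first exact: id_hom.
  by exists id.
move=> T2 be ube; pose T2' := transport_tensor T2 fh fK gK.
have [be' E'] := iso_flow be gh fh gK fK.
have [phi [psi [phih phiK psiK [u uc hu]]]] := hga T2' be' (iso_UHF_flow gh gK fK E' ube).
have tE t : tensor_flow T2 si be t =1 tensor_flow T2' ga be' t.
  apply: (@tensor_hom_ext _ _ _ _ T2').
  - exact: (tensor_flow_hom T2).
  - exact: (tensor_flow_hom T2').
  move=> a b; apply: (etrans (tensor_flowE T2 si be t (f a) (f b))).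
  apply/esym/(etrans (tensor_flowE T2' ga be' t a b)).
  by rewrite E E' /= !fK gK.
exists (f \o phi), (psi \o g); split.
- exact: comp_hom.
- by move=> x /=; rewrite fK phiK.
- by move=> x /=; rewrite psiK gK.
have EE : (fun t x => (psi \o g) (si t ((f \o phi) x))) = (fun t x => psi (ga t (phi x))).
  by apply/funext => t; apply/funext => x; rewrite E /= !fK.
exists u => [|t x]; first by move: uc; rewrite -EE.
by rewrite tE hu /= E !fK.
Qed.

(** [de] is gamma (x) beta transported to A by the conjugacy that universality provides. The copies
    sit in the second factor, so they commute exactly with the first one and asymptotically with the
    second. On them [de] acts as Ad e^{ith_n}, which converges to the given flow uniformly on
    [-1, 1]. *)
Lemma absorbing_perturbation (R : realType) (A : cstarType R) (T : tensor_product A A)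
    (ga al : flow A) : UHF_algebra A -> star_isomorphic T A ->
  universal_UHF_flow ga -> approximately_inner al -> quasi_UHF al ->
  exists (de : flow A) (rho : nat -> A -> A), [/\ cocycle_perturbation de ga,
    forall n, star_hom (rho n),
    forall a x (e : R), 0 < e -> exists N, forall n, (N <= n)%N ->
      nm (rho n a * x - x * rho n a) <= e &
    forall a (e : R), 0 < e -> exists N, forall n, (N <= n)%N ->
      forall t, `|t| <= 1 -> nm (de t (rho n a) - rho n (al t a)) <= e].
Proof.
move=> uA [S0 [S0h S0b]] [_ _ hga] inner qal.
have lh := tinl_hom T; have rh := tinr_hom T.
have [B0 hc0] := uhf_chainP uA.
have [B [h [hc hB hS happ]]] := adapted_generators hc0 inner.
have [be [rho [ube rhoh rhoc rhoE]]] := inner_flows_absorbing hc lh rh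
  (tin_comm T) (@tensor_spanning _ _ _ T) S0h S0b hB hS.
have [phi [psi [phih phiK psiK cp]]] := hga T be ube.
have psih := bij_hom_inv phih phiK psiK.
have [Ga EGa] := tensor_is_flow T ga be.
have [de Ede] := iso_flow Ga phih psih phiK psiK.
exists de, (fun n => phi \o (tinr T \o rho n)); split.
- have := cocycle_perturbation_iso phih phiK cp.
  rewrite Ede EGa (_ : (fun t x => phi (psi (ga t (phi (psi x))))) = ga)//.
  by apply/funext => t; apply/funext => x; rewrite !psiK.
- by move=> n; apply: comp_hom => //; apply: comp_hom.
(* Asymptotic commutation defines a closed subspace, since the copies are contractive, so it is
   checked on elementary tensors only. *)
- move=> a x e e0 /=.
  suff H y : forall d : R, 0 < d -> exists N, forall n, (N <= n)%N ->
      nm (tinr T (rho n a) * y - y * tinr T (rho n a)) <= d.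
    have [N HN] := H (psi x) e e0; exists N => n Nn.
    rewrite -{1 2}(psiK x) -!(homM phih) -(homB phih).
    by rewrite (le_trans (hom_le phih _))// HN.
  move: y; have cS : csub [set y : T | forall d : R, 0 < d -> exists N, forall n, (N <= n)%N ->
      nm (tinr T (rho n a) * y - y * tinr T (rho n a)) <= d].
    split=> /= [d d0|y z hy hz d d0|c y hy d d0|y hy d d0].
    + by exists 0%N => n _; rewrite mulr0 mul0r subrr nm0 ltW.
    + have [N1 H1] := hy (d / 2) ltac:(lra); have [N2 H2] := hz (d / 2) ltac:(lra).
      exists (maxn N1 N2) => n; rewrite geq_max => /andP[/H1 h1 /H2 h2].
      rewrite mulrDr mulrDl opprD addrACA (le_trans (nmD _ _))//.
      by lra.
    + have c0 : 0 < cm c + 1 by have := cm_ge0 c; lra.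
      have [N HN] := hy (d / (cm c + 1)) (divr_gt0 d0 c0); exists N => n /HN.
      rewrite -scalerAr -scalerAl -scalerBr nmZ ler_pdivlMr//.
      by have := nm_ge0 (tinr T (rho n a) * y - y * tinr T (rho n a)); lra.
    + have a0 := nm_ge0 a; have c0 : 0 < 4 * (nm a + 1) by lra.
      have [z hz yz] := hy (d / (4 * (nm a + 1))) (divr_gt0 d0 c0).
      have [N HN] := hz (d / 2) ltac:(lra); exists N => n /HN h1.
      set r := tinr T (rho n a) in h1 *.
      have nr : nm r <= nm a by rewrite (le_trans (hom_le rh _))// hom_le.
      have -> : r * y - y * r = (r * (y - z) - (y - z) * r) + (r * z - z * r).
        by rewrite mulrBr mulrBl opprB addrAC !addrA !subrK.
      move: yz; rewrite ltr_pdivlMr// => yz.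
      have := nmD (r * (y - z) - (y - z) * r) (r * z - z * r).
      have := nmB (r * (y - z)) ((y - z) * r); have := nmM r (y - z); have := nmM (y - z) r.
      have : nm r * nm (y - z) <= nm a * nm (y - z) by rewrite ler_wpM2r// nm_ge0.
      by have := nm_ge0 (y - z); lra.
  apply: (tensor_spanning (T := T) cS) => _ [b [c ->]] d d0 /=.
  have b0 := nm_ge0 b; have a0 := nm_ge0 a.
  have c0 : 0 < (nm b + 1) * (nm a + 1) by rewrite mulr_gt0//; lra.
  have [N HN] := rhoc c (d / ((nm b + 1) * (nm a + 1))) (divr_gt0 d0 c0).
  exists N => n /HN/(_ a) hn.
  rewrite mulrA -tin_comm -!mulrA -mulrBr -!(homM rh) -(homB rh).
  apply: (le_trans (nmM _ _)); move: hn; rewrite mulrAC ler_pdivlMr// => hn.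
  have h1 := hom_le rh (rho n a * c - c * rho n a); have h2 := hom_le lh b.
  have h3 := nm_ge0 (rho n a * c - c * rho n a).
  apply: (le_trans (ler_pM (nm_ge0 _) (nm_ge0 _) h2 h1)).
  have : d * nm a <= d * (nm a + 1) by rewrite ler_wpM2l ?(ltW d0)//; lra.
  move: hn h3; move: (nm (rho n a * c - c * rho n a)) => q hn h3 h4.
  have a1 : 0 < nm a + 1 by lra.
  rewrite -(ler_pM2r a1); nra.
- move=> a e e0; have [N HN] := happ a e e0; exists N => n /HN hn t /hn.
  have E1 : de t (phi (tinr T (rho n a))) = phi (tinr T (rho n (Ad (ug (h n) t) a))).
    rewrite Ede phiK EGa -[tinr T _]mul1r -(hom1 lh) tensor_flowE rhoE.
    by rewrite (hom1 (flow_hom ga t)) (hom1 lh) mul1r.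
  rewrite /= E1 -(homB phih) -(homB rh) -(homB (rhoh n)); apply: le_trans.
  by rewrite (le_trans (hom_le phih _))// (le_trans (hom_le rh _))// hom_le.
Qed.

Theorem corollary4p7 (R : realType) (A : cstarType R)
    (T : tensor_product A A) (gamma alpha : flow A) :
  UHF_algebra A ->
  star_isomorphic T A ->
  universal_UHF_flow gamma ->
  approximately_inner alpha ->
  quasi_UHF alpha ->
  exists sigma : flow T,
    universal_UHF_flow sigma /\
    cocycle_perturbation (tensor_flow T alpha gamma) sigma.
Proof.
move=> uA TA ugamma inner qalpha.
have [de [rho [cp_de rhoh rhoc rhoE]]] :=
  absorbing_perturbation uA TA ugamma inner qalpha.
have [B hc] := uhf_chainP uA.
have [L [Lmono Lsp]] := uhf_lists hc.
have [Ga EGa] := tensor_is_flow T alpha de.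
have lh := tinl_hom T; have rh := tinr_hom T.
have GaE t a b : Ga t (tinl T a * tinr T b) = tinl T (alpha t a) * tinr T (de t b).
  by rewrite EGa tensor_flowE.
have iGa t a : Ga t (tinr T a) = tinr T (de t a).
  rewrite -[tinr T a]mul1r -(hom1 lh) GaE.
  by rewrite (hom1 (flow_hom alpha t)) (hom1 lh) mul1r.
pose X n := [seq tinl T a * tinr T b | a <- L n, b <- L n].
have Xmono n m : (n <= m)%N -> {subset X n <= X m}.
  move=> nm_ _ /allpairsP[[a b] /= [aL bL ->]]; apply/allpairsP; exists (a, b).
  by split; rewrite //=; apply: (Lmono n).
have Xsp : spanning [set x : T | exists n, x \in X n].
  move=> V cV hV; apply: (tensor_spanning cV) => _ [a [b ->]].
  apply: (Lsp _ (csub_preimage (bounded_linear_comp (bounded_linear_hom lh)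
    (bounded_linear_mulr (tinr T b))) cV)) => {}a [n aL] /=.
  apply: (Lsp _ (csub_preimage (bounded_linear_comp (bounded_linear_hom rh)
    (bounded_linear_mull (tinl T a))) cV)) => {}b [m bL] /=.
  apply: hV; exists (maxn n m); apply/allpairsP; exists (a, b); split=> //=.
    by apply: (Lmono n) aL; apply: leq_maxl.
  by apply: (Lmono m) bL; apply: leq_maxr.
(* The embedding of A as right factor conjugates [de] to the restriction of alpha (x) delta; the
   intertwining deforms it into an isomorphism onto T. *)
have [theta [w [th tb wcoc wE]]] := intertwining rh (uhf_hom_isometric hc rh) iGa Lsp Xmono Xsp
  (tensor_absorb hc qalpha GaE rhoh rhoc rhoE).
have [theta' thK thK'] := tb.
have th'h := bij_hom_inv th thK thK'.
have [sigma Esigma] := iso_flow gamma th th'h thK thK'.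
exists sigma; split; first exact: iso_universal th thK thK' Esigma ugamma.
rewrite Esigma.
have cp1 : cocycle_perturbation (tensor_flow T alpha gamma) (tensor_flow T alpha de).
  apply: cocycle_perturbation_sym; first exact: tensor_flow_hom.
  exact: tensor_flow_perturbation.
have cp2 : cocycle_perturbation (tensor_flow T alpha de) (fun t x => theta (de t (theta' x))).
  apply: cocycle_perturbation_sym; first exact: tensor_flow_hom.
  rewrite -EGa; exists w => // t x; rewrite -wE thK'//.
have cp3 := cocycle_perturbation_iso th thK cp_de.
have h1 t : star_hom (fun x => theta (gamma t (theta' x))).
  exact: (comp_hom th (comp_hom (flow_hom gamma t) th'h)).
have h2 t : star_hom (fun x => theta (de t (theta' x))).
  exact: (comp_hom th (comp_hom (flow_hom de t) th'h)).
(* The chain from sigma = theta gamma theta^-1 passes through theta delta theta^-1 and alpha (x)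
   delta to alpha (x) gamma. *)
exact: (cocycle_perturbation_trans h1 cp3 (cocycle_perturbation_trans h2 cp2 cp1)).
Qed.
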